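(* Let $k\ge 0$ be an integer and let $G$ be a graph with $m$ edges. (1) If $G$ is a tree with a perfect matching, then $\alpha_{k-reg}(L(G))\ge \frac{m}{6\chi_k(L(G))}$. (2) If $G$ is a maximal outerplanar graph with a $2$-factor, then $\alpha_{k-reg}(L(G))\ge \frac{m}{14\chi_k(L(G))}$. (3) If $G$ is a triangulation with a $2$-factor, then $\alpha_{k-reg}(L(G))\ge \frac{m}{33\chi_k(L(G))}$. (4) If $G$ is a triangulation with a $2$-factor and minimum degree $4$, then $\alpha_{k-reg}(L(G))\ge \frac{m}{27\chi_k(L(G))}$. (5) If $G$ is a triangulation with a $2$-factor and minimum degree $5$, then $\alpha_{k-reg}(L(G))\ge \frac{m}{15\chi_k(L(G))}$.
   Context: All graphs are finite, simple and undirected. A triangulation is a maximal planar graph. $L(G)$ is the line graph of $G$. For a graph $H$, $D_i(H)$ denotes the set of vertices of degree $i$ in $H$. For an integer $k\ge 0$, a set $S\subseteq V(H)$ is $k$-independent if $H[S]$ has maximum degree at most $k$; a regular $k$-independent set is a $k$-independent set contained in some $D_i(H)$; $\alpha_{k-reg}(H)$ is the maximum cardinality of a regular $k$-independent set of $H$. The $k$-chromatic number $\chi_k(H)$ is the minimum number of colors in a coloring of $V(H)$ such that each color class induces a subgraph of maximum degree at most $k$. *)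

(* Defs.v *)
From HB Require Import structures.
From mathcomp Require Import all_boot all_order all_algebra.
From mathcomp Require Import all_classical all_reals all_analysis.

Set Implicit Arguments.
Unset Strict Implicit.
Unset Printing Implicit Defensive.

Import Order.TTheory GRing.Theory Num.Theory.
Import numFieldNormedType.Exports.

Local Open Scope classical_set_scope.

Record sgraph := SGraph {
  svertex :> finType;
  adj : rel svertex;
  adj_sym : symmetric adj;
  adj_irr : irreflexive adj }.

Definition degree (G : sgraph) (x : G) : nat := #|[set y : G | adj x y]%SET|.

Definition max_degree (G : sgraph) : nat := \max_(x : G) degree x.

Definition has_min_degree (d : nat) (G : sgraph) : Prop :=
  (exists x : G, degree x = d) /\ (forall x : G, (d <= degree x)%N).

Definition edge_set (G : sgraph) : {set {set G}} :=
  [set [set p.1; p.2] | p in [set q : G * G | adj q.1 q.2]]%SET.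

Definition edge (G : sgraph) : finType := {A : {set G} | A \in edge_set G}.

Definition line_adj (G : sgraph) : rel (edge G) :=
  fun a b => (a != b) && (val a :&: val b != finset.set0)%SET.

Lemma line_adj_sym (G : sgraph) : symmetric (@line_adj G).
Proof. by move=> a b; rewrite /line_adj eq_sym finset.setIC. Qed.

Lemma line_adj_irr (G : sgraph) : irreflexive (@line_adj G).
Proof. by move=> a; rewrite /line_adj eqxx. Qed.

Definition line_graph (G : sgraph) : sgraph :=
  SGraph (@line_adj_sym G) (@line_adj_irr G).

Section Induced.
Variables (G : sgraph) (S : {set G}).

Definition induced_adj : rel {x : G | x \in S} := fun x y => adj (val x) (val y).

Lemma induced_adj_sym : symmetric induced_adj.
Proof. by move=> x y; rewrite /induced_adj adj_sym. Qed.

Lemma induced_adj_irr : irreflexive induced_adj.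
Proof. by move=> x; rewrite /induced_adj adj_irr. Qed.

Definition induced : sgraph := SGraph induced_adj_sym induced_adj_irr.
End Induced.

Definition k_indep (k : nat) (G : sgraph) (S : {set G}) : bool :=
  (max_degree (induced S) <= k)%N.

Definition deg_class (G : sgraph) (i : nat) : {set G} :=
  [set x : G | degree x == i]%SET.

(* Degrees are smaller than #|G|, so bounding i only serves decidability (the
   successor leaves an index for the empty set when G has no vertex). *)
Definition regular_k_indep (k : nat) (G : sgraph) (S : {set G}) : bool :=
  k_indep k S && [exists i : 'I_#|G|.+1, S \subset deg_class G i].

Definition alpha_reg (k : nat) (G : sgraph) : nat :=
  \max_(S : {set G} | regular_k_indep k S) #|S|.

Definition k_colorable (k : nat) (G : sgraph) (n : nat) : bool :=
  [exists c : {ffun G -> 'I_n},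
     [forall i : 'I_n, k_indep k [set x : G | c x == i]%SET]].

Lemma k_colorable_card (k : nat) (G : sgraph) : exists n, k_colorable k G n.
Proof.
exists #|G|; apply/existsP; exists [ffun x => enum_rank x]; apply/forallP => i.
apply/bigmax_leqP => x _; rewrite /degree.
have -> // : #|[set y | adj x y]%SET| = 0%N.
apply: eq_card0 => y; rewrite inE /= /induced_adj.
have := valP x; have := valP y; rewrite /= !inE !ffunE => /eqP ey /eqP ex.
by have /enum_rank_inj -> := etrans ex (esym ey); rewrite adj_irr.
Qed.

Definition chi_k (k : nat) (G : sgraph) : nat := ex_minn (k_colorable_card k G).

Definition is_tree (G : sgraph) : Prop :=
  [/\ (0 < #|G|)%N, (forall x y : G, connect (@adj G) x y) &
      (forall s : seq G, (2 < size s)%N -> ~ ucycle (@adj G) s)].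

(* A d-factor (spanning d-regular subgraph) is given by its set M of edges;
   a 1-factor is the same thing as a perfect matching. *)
Definition has_factor (d : nat) (G : sgraph) : Prop :=
  exists2 M : {set {set G}}, M \subset edge_set G &
    forall x : G, #|[set A in M | x \in A]%SET| = d.

Definition has_perfect_matching (G : sgraph) : Prop := has_factor 1 G.

Record plane_drawing (R : realType) (G : sgraph) := PlaneDrawing {
  pos : G -> R * R;
  edge_arc : edge G -> R -> R * R;
  pos_inj : injective pos;
  arc_cont : forall a, {within `[0%R, 1%R], continuous (edge_arc a)};
  arc_inj : forall a, {in `[0%R, 1%R] &, injective (edge_arc a)};
  arc_ends : forall a : edge G, exists x y : G,
    [/\ val a = [set x; y]%SET, edge_arc a 0%R = pos x & edge_arc a 1%R = pos y];
  arc_vertex : forall a x (t : R), (0 < t < 1)%R -> edge_arc a t <> pos x;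
  arc_disjoint : forall a b (s t : R),
    a != b -> (0 < s < 1)%R -> (0 < t < 1)%R -> edge_arc a s <> edge_arc b t }.

Definition drawn_set (R : realType) (G : sgraph) (D : plane_drawing R G) :
    set (R * R) :=
  range (pos D) `|` \bigcup_a (edge_arc D a @` `[0%R, 1%R]).

(* The complement of the (compact) drawn set has exactly one unbounded component;
   vertices are on the drawn set, so lying in the closure of that component means
   lying on its boundary. *)
Definition outer_face (R : realType) (G : sgraph) (D : plane_drawing R G) :
    set (R * R) :=
  [set p | (~` drawn_set D) p /\
           ~ bounded_set (connected_component (~` drawn_set D) p)].

Definition planar (R : realType) (G : sgraph) : Prop :=
  inhabited (plane_drawing R G).

Definition outerplanar (R : realType) (G : sgraph) : Prop :=
  exists D : plane_drawing R G, forall x : G, closure (outer_face D) (pos D x).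

Definition edge_maximal (P : sgraph -> Prop) (G : sgraph) : Prop :=
  P G /\ forall (e : rel G) (e_sym : symmetric e) (e_irr : irreflexive e),
    subrel (@adj G) e -> P (SGraph e_sym e_irr) -> subrel e (@adj G).

Definition triangulation (R : realType) : sgraph -> Prop :=
  edge_maximal (planar R).

Definition maximal_outerplanar (R : realType) : sgraph -> Prop :=
  edge_maximal (outerplanar R).

(* Main.v *)
(** Let [B] be [chi_k * alpha_reg] of the line graph. Edges of a factor [M] with
    the same degree sum have the same degree in [L(G)], so a [k]-colouring of
    [L(G)] splits them into regular [k]-independent sets and there are at most [B]
    of them. If all degree sums in [M] are at least [s], the total degree sum of [M],
    which is [2 d m] for a [d]-factor, is therefore large unless [B] is; comparing
    it with a linear bound on [m] in the number [n] of vertices gives the constants.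

    What is left is graph theory: [m < n] for trees, [m <= 3 n - 6] for planar
    graphs, and lower bounds for degree sums of adjacent vertices ([3] for trees
    with more than one edge, [7] for triangulations with at least five vertices).
    The bound [3 n - 6] follows from Mader's theorem on graphs without a [K5]
    minor, where planarity is replaced by the vanishing of the van Kampen
    obstruction, which is algebraic and inherited by minors. For degree sums, a
    drawing is first made polygonal; in a triangulation the vertices on a face are
    pairwise adjacent, since otherwise an edge could be drawn inside the face, so
    if two adjacent vertices have too few neighbours the faces around them fill
    the complement of an arc, leaving no room for further vertices. A maximal
    outerplanar graph becomes a triangulation when a vertex adjacent to all others
    is added: one direction places it in the outer face, the other one uses
    an inversion centred at it. *)

Require Import Defs.
From mathcomp Require Import all_boot all_order all_algebra.
From mathcomp Require Import ring lra zify.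

Set Implicit Arguments.
Unset Strict Implicit.
Unset Printing Implicit Defensive.

(** * The van Kampen obstruction modulo 2 *)

(** Counting [c] weights from [s] on costs [c (c + 1) / 2] times [B]. Against the edge bounds this
    gives the factor [c (c + 1) / (c - 1)] for trees ([s = 3]), [c (c + 1) / (c - 3)] for maximal
    outerplanar graphs ([s = 5]) and [3 c (c + 1) / (2 (s + c - 12))] for triangulations
    ([s = 7, 8, 10]). The constants 6, 14, 33, 27, 15 are the minima over [c], attained at
    [c = 3, 7, 11, 9, 5]. Graphs with few edges are covered by [B >= 1], so the degree sum bounds
    may assume enough vertices. The obstacle is that the arcs of a drawing are merely continuous.
    Counting faces for Euler's formula would need the Jordan curve theorem, and contracting an edge
    inside a drawing is awkward; a linear system modulo 2 needs only crossing parities and is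
    contracted by adding equations. For the degree sums the one fact about separation is that an arc
    does not separate the plane. It is elementary for polygonal arcs, which locally are one or two
    rays. *)

Section VanKampen.
Variable (V : finType) (lt : rel V).
Hypothesis lt_asym : forall x y, x != y -> lt x y = ~~ lt y x.

(* For a plane drawing, [lt a c] says in which half-plane [c] lies as seen from
   [a], and [w a b c] is the parity of the number of times that the edge [ab]
   crosses the negative half-axis based at [c]. *)
Definition even_crossings (e : rel V) (A : {set V})
    (w : V -> V -> V -> bool) : Prop :=
  forall a b c d, a \in A -> b \in A -> c \in A -> d \in A ->
    uniq [:: a; b; c; d] -> e a b -> e c d ->
    w a b c (+) w a b d (+) (w c d a (+) w c d b)
    = lt a c (+) lt a d (+) (lt b c (+) lt b d).

Definition vK_planar (e : rel V) (A : {set V}) : Prop :=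
  exists w, even_crossings e A w.

(** Each edge counts in both directions, so the bound [3 n - 6] on edges becomes [6 n - 12]. *)
Definition arcs_in (e : rel V) (A : {set V}) : nat :=
  \sum_(x in A) \sum_(y in A) e x y.

Lemma vK_planar_sub (e e' : rel V) (A B : {set V}) :
  subrel e' e -> B \subset A -> vK_planar e A -> vK_planar e' B.
Proof.
move=> ee' /subsetP BA [w wP]; exists w => a b c d aB bB cB dB u eab ecd.
by apply: wP; rewrite ?BA ?ee'.
Qed.

Let ux4 (x : nat -> V) a b c d :
  (forall i j, i < 5 -> j < 5 -> i != j -> x i != x j) ->
  a < 5 -> b < 5 -> c < 5 -> d < 5 -> uniq [:: a; b; c; d] ->
  [/\ uniq [:: x a; x b; x c; x d], x a != x b & x c != x d].
Proof.
move=> x_inj a5 b5 c5 d5; rewrite /= !inE !negb_or -!andbA.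
by case/and5P=> ? ? ? ? /and3P[? ? _]; rewrite !x_inj.
Qed.

(* The coordinates [n < 25], [25 <= n < 150] and [n = 150] of the vector [v]
   stand for [lt], [w] and the constant [true]; summing the crossing equations
   of the 15 pairs of disjoint edges of K5 with the asymmetry equations of [lt]
   leaves only the last coordinate. *)
Lemma vK_planarN_K5 (e : rel V) (A : {set V}) (s : seq V) :
  size s = 5 -> uniq s -> {subset s <= A} ->
  {in s &, forall x y, x != y -> e x y} -> ~ vK_planar e A.
Proof.
move=> sz us sA es [w wP].
have [x [xs x_inj]] : exists x : nat -> V, (forall i, i < 5 -> x i \in s) /\
    (forall i j, i < 5 -> j < 5 -> i != j -> x i != x j).
  case: s sz us {sA es} => [//|x0 s'] sz us; exists (nth x0 (x0 :: s')); split.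
    by move=> i i5; rewrite mem_nth ?sz.
  by move=> i j i5 j5 ij; rewrite nth_uniq ?sz.
pose v n := if n < 25 then lt (x (n %/ 5)) (x (n %% 5)) else
  if n < 150 then w (x ((n - 25) %/ 25)) (x ((n - 25) %/ 5 %% 5)) (x (n %% 5))
  else true.
pose L i j := i * 5 + j; pose W i j k := 25 + (i * 25 + j * 5 + k).
have vL i j : i < 5 -> j < 5 -> v (L i j) = lt (x i) (x j).
  move=> i5 j5; rewrite /v /L ifT; last by lia.
  by congr (lt (x _) (x _)); lia.
have vW i j k : i < 5 -> j < 5 -> k < 5 -> v (W i j k) = w (x i) (x j) (x k).
  move=> i5 j5 k5; rewrite /v /W.
  have /negbTE-> : ~~ (25 + (i * 25 + j * 5 + k) < 25) by rewrite -leqNgt leq_addr.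
  have -> : 25 + (i * 25 + j * 5 + k) < 150 by move: i5 j5 k5; clear; lia.
  rewrite addKn; congr (w (x _) (x _) (x _)).
  - by rewrite -addnA divnMDl // divn_small ?addn0 //; lia.
  - have -> : i * 25 + j * 5 + k = (i * 5 + j) * 5 + k by lia.
    by rewrite divnMDl // (divn_small k5) addn0 modnMDl modn_small.
  - have -> : 25 + (i * 25 + j * 5 + k) = (5 + i * 5 + j) * 5 + k by lia.
    by rewrite modnMDl modn_small.
have v150 : v 150 = true by [].
pose cr (q : nat * nat * nat * nat) := let: (a, b, c, d) := q in
  [:: W a b c; W a b d; W c d a; W c d b; L a c; L a d; L b c; L b d].
pose as_ (p : nat * nat) := [:: L p.1 p.2; L p.2 p.1; 150].
(* The 15 unordered pairs of disjoint edges, every edge with its smaller end first, so that each [W]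
   coordinate occurs in exactly two equations. *)
pose qs := [:: (0, 1, 2, 3); (0, 1, 2, 4); (0, 1, 3, 4); (0, 2, 1, 3); (0, 2, 1, 4); (0, 2, 3, 4); (0, 3, 1, 2); (0, 3, 1, 4); (0, 3, 2, 4); (0, 4, 1, 2); (0, 4, 1, 3); (0, 4, 2, 3); (1, 2, 3, 4); (1, 3, 2, 4); (1, 4, 2, 3)].
(* The pairs for which both directions of [lt] occur an odd number of times in the crossing
   equations. There are three of them, so the constant survives. *)
pose ps := [:: (2, 3); (2, 4); (3, 4)].
have crP a b c d : [&& a < 5, b < 5, c < 5 & d < 5] -> uniq [:: a; b; c; d] ->
    \big[addb/false]_(n <- cr (a, b, c, d)) v n = false.
  case/and4P=> a5 b5 c5 d5 u; rewrite -(big_map v xpredT id).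
  rewrite [map v _](_ : _ = [:: w (x a) (x b) (x c); w (x a) (x b) (x d);
    w (x c) (x d) (x a); w (x c) (x d) (x b); lt (x a) (x c); lt (x a) (x d);
    lt (x b) (x c); lt (x b) (x d)]); last first.
    by congr [:: _; _; _; _; _; _; _; _]; first [exact: vW | exact: vL].
  rewrite !big_cons big_nil.
  have [ux ab cd] := ux4 x_inj a5 b5 c5 d5 u.
  have eq4 := wP _ _ _ _ (sA _ (xs _ a5)) (sA _ (xs _ b5)) (sA _ (xs _ c5))
    (sA _ (xs _ d5)) ux (es _ _ (xs _ a5) (xs _ b5) ab) (es _ _ (xs _ c5) (xs _ d5) cd).
  rewrite addbF !addbA in eq4 *.
  rewrite eq4.
  by case: (lt (x a) (x c)); case: (lt (x a) (x d)); case: (lt (x b) (x c)); case: (lt (x b) (x d)).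
have asP i j : i < 5 -> j < 5 -> i != j ->
    \big[addb/false]_(n <- as_ (i, j)) v n = false.
  move=> i5 j5 ij; rewrite -(big_map v xpredT id).
  rewrite [map v _](_ : _ = [:: lt (x i) (x j); lt (x j) (x i); true]); last first.
    by congr [:: _; _; _]; exact: vL.
  by rewrite !big_cons big_nil lt_asym ?x_inj //; case: (lt (x j) (x i)).
pose r := flatten (map cr qs ++ map as_ ps).
pose t := flatten [seq nseq (count_mem n r)./2 n | n <- iota 0 151].
have r0 : \big[addb/false]_(n <- r) v n = false.
  rewrite big_flatten big1_seq // => z /andP[_]; rewrite mem_cat => /orP[] /mapP[q].
    have : all (fun q : nat * nat * nat * nat => let: (a, b, c, d) := q in
      [&& a < 5, b < 5, c < 5 & d < 5] && uniq [:: a; b; c; d]) qs by [].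
    by move=> /allP h /h; case: q => [[[a b] c] d] /andP[? ?] ->; exact: crP.
  have : all (fun p : nat * nat => [&& p.1 < 5, p.2 < 5 & p.1 != p.2]) ps by [].
  by move=> /allP h /h; case: q => [i j] /= /and3P[? ? ?] ->; exact: asP.
(* By computation [r] consists of two copies of [t], which cancel, and one more 150. *)
have rt : perm_eq r (150 :: t ++ t) by vm_compute.
have {rt} r1 := perm_big _ rt.
by move: r0; rewrite {}r1 big_cons v150 big_cat /= addbb.
Qed.

(** The merged vertex keeps the name [u]; the relation is meant for vertex sets without [v]. *)
Definition contract (e : rel V) (u v : V) : rel V := fun x y =>
  if x == u then (y != u) && (e u y || e v y)
  else if y == u then e x u || e x v else e x y.

Lemma contract_sym e u v : symmetric e -> symmetric (contract e u v).
Proof.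
move=> se x y; rewrite /contract.
case: (eqVneq x u) => xu; case: (eqVneq y u) => yu //=.
- by rewrite se [e v y]se.
- by rewrite se [e x v]se.
Qed.

Lemma contract_irr e u v : irreflexive e -> irreflexive (contract e u v).
Proof. by move=> ie x; rewrite /contract; case: eqP => [->|_] /=; rewrite ?eqxx. Qed.

(** An edge that is new after the contraction is routed along the old path through [v], as in [w'].
    Parities add along a path, and the terms of [v] occur twice, so the crossing equations of the
    two halves add up to the one for the new edge. *)
Lemma vK_planar_contract e (A : {set V}) u v : symmetric e -> irreflexive e -> e u v ->
  u \in A -> v \in A -> vK_planar e A -> vK_planar (contract e u v) (A :\ v).
Proof.
move=> se ie euv uA vA [w wP].
pose w' x y c := if e x y then w x y c else
  if x == u then w u v c (+) w v y c else w x v c (+) w v u c.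
have old a b c d : a \in A :\ v -> b \in A :\ v -> c \in A :\ v -> d \in A :\ v ->
    uniq [:: a; b; c; d] -> e a b -> e c d ->
    w a b c (+) w a b d (+) (w c d a (+) w c d b)
    = lt a c (+) lt a d (+) (lt b c (+) lt b d).
  by move=> /setD1P[_ aA] /setD1P[_ bA] /setD1P[_ cA] /setD1P[_ dA]; exact: wP.
have eab a b : contract e u v a b -> ~~ e a b ->
    (a = u /\ e v b) \/ (a <> u /\ b = u /\ e a v).
  rewrite /contract; case: eqP => [->|au]; first by case/andP=> _ /orP[->//|]; left.
  by case: eqP => [->|bu] => [/orP[->//|]|->//]; right.
have uniq5 a b c d : a \in A :\ v -> b \in A :\ v -> c \in A :\ v -> d \in A :\ v ->
    uniq [:: a; b; c; d] -> [/\ uniq [:: a; v; c; d], uniq [:: v; b; c; d],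
     uniq [:: a; b; c; v] & uniq [:: a; b; v; d]].
  rewrite !inE /= !inE !negb_or => /andP[av _] /andP[bv _] /andP[cv _] /andP[dv _].
  case/and4P=> /and3P[ab ac ad] /andP[bc bd] cd _.
  by rewrite !(eq_sym v) av bv cv dv ab ac ad bc bd cd.
have step a b c d : a \in A :\ v -> b \in A :\ v -> c \in A :\ v -> d \in A :\ v ->
    uniq [:: a; b; c; d] -> e c d -> e a v -> e v b ->
    w a v c (+) w v b c (+) (w a v d (+) w v b d) (+) (w c d a (+) w c d b)
    = lt a c (+) lt a d (+) (lt b c (+) lt b d).
  move=> aA' bA' cA' dA' ud ecd eav evb.
  have [u1 u2 _ _] := uniq5 _ _ _ _ aA' bA' cA' dA' ud.
  case/setD1P: aA' => _ aA; case/setD1P: bA' => _ bA.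
  case/setD1P: cA' => _ cA; case/setD1P: dA' => _ dA.
  have E1 := wP _ _ _ _ aA vA cA dA u1 eav ecd; have E2 := wP _ _ _ _ vA bA cA dA u2 evb ecd.
  have bool_id x1 x2 x3 x4 x5 x6 x7 : x1 (+) x5 (+) (x2 (+) x6) (+) (x3 (+) x7)
      = (x1 (+) x2 (+) (x3 (+) x4)) (+) (x5 (+) x6 (+) (x4 (+) x7)).
    by move: x1 x2 x3 x4 x5 x6 x7 => [] [] [] [] [] [] [].
  rewrite (bool_id _ _ _ (w c d v)) E1 E2.
  by case: (lt v c); case: (lt v d); case: (lt a c); case: (lt a d);
    case: (lt b c); case: (lt b d).
have main a b c d : a \in A :\ v -> b \in A :\ v -> c \in A :\ v -> d \in A :\ v ->
    uniq [:: a; b; c; d] -> contract e u v a b -> e c d ->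
    w' a b c (+) w' a b d (+) (w' c d a (+) w' c d b)
    = lt a c (+) lt a d (+) (lt b c (+) lt b d).
  move=> aA bA cA dA ud cab ecd; rewrite /w' ecd.
  case: (boolP (e a b)) => [eab1|/(eab _ _ cab)]; first exact: old.
  case=> [[au evb]|[/eqP/negbTE-> [bu eav]]].
    by rewrite au eqxx in ud aA *; apply: step => //.
  by rewrite bu in ud bA *; apply: step => //; rewrite se.
exists w' => a b c d aA bA cA dA ud cab ccd.
case: (boolP (e c d)) => [|ncd]; first exact: main.
(* Two new edges would share the end [u], so of two disjoint edges at least one is old. Exchanging
   their roles then flips all four [lt] terms, an even number. *)
have eab1 : e a b.
  apply: contraT => nab; move: ud; rewrite /= !inE !negb_or.
  case/and4P=> /and3P[_ /eqP ac /eqP ad] /andP[/eqP bc /eqP bd] _ _.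
  by case: (eab _ _ cab nab) => [[? _]|[_ [? _]]];
     case: (eab _ _ ccd ncd) => [[? _]|[_ [? _]]]; congruence.
have udc : uniq [:: c; d; a; b] by rewrite -(rot_uniq 2).
rewrite addbC (main c d a b) //.
move: ud; rewrite /= !inE !negb_or.
case/and4P=> /and3P[_ ac ad] /andP[bc bd] _ _.
rewrite (lt_asym ac) (lt_asym ad) (lt_asym bc) (lt_asym bd).
by case: (lt c a); case: (lt d a); case: (lt c b); case: (lt d b).
Qed.

Lemma arcs_inD1 e (A : {set V}) v : symmetric e -> irreflexive e -> v \in A ->
  arcs_in e A = arcs_in e (A :\ v) + (\sum_(y in A :\ v) e v y).*2.
Proof.
move=> se ie vA; rewrite /arcs_in (big_setD1 v) //= (big_setD1 v vA) /= ie add0n.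
have -> : \sum_(x in A :\ v) \sum_(y in A) e x y
    = \sum_(x in A :\ v) (e v x + \sum_(y in A :\ v) e x y).
  by apply: eq_bigr => x _; rewrite (big_setD1 v vA) /= se.
by rewrite big_split /=; lia.
Qed.

(** Besides the edge [uv], one edge is lost for each common neighbour, and each lost edge counts as
    two arcs. *)
Lemma arcs_in_contract e (A : {set V}) u v : symmetric e -> irreflexive e -> e u v ->
  u \in A -> v \in A ->
  arcs_in e A = arcs_in (contract e u v) (A :\ v) + 2
                + (\sum_(y in A) (e u y && e v y)).*2.
Proof.
move=> se ie euv uA vA.
have uv : u != v by apply: contraTneq euv => ->; rewrite ie.
have uAv : u \in A :\ v by rewrite !inE uv.
rewrite (arcs_inD1 se ie vA) (arcs_inD1 se ie uAv).
rewrite (arcs_inD1 (contract_sym u v se) (contract_irr u v ie) uAv).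
rewrite (big_setD1 u uAv) /= se euv.
rewrite (big_setD1 v vA) /= ie andbF add0n (big_setD1 u uAv) /= ie add0n.
have -> : arcs_in (contract e u v) ((A :\ v) :\ u) = arcs_in e ((A :\ v) :\ u).
  apply: eq_bigr => x; rewrite !inE => /and3P[xu _ _].
  apply: eq_bigr => y; rewrite !inE => /and3P[yu _ _].
  by rewrite /contract (negbTE xu) (negbTE yu).
have : \sum_(y in (A :\ v) :\ u) contract e u v u y + \sum_(y in (A :\ v) :\ u) (e u y && e v y)
   = \sum_(y in (A :\ v) :\ u) e u y + \sum_(y in (A :\ v) :\ u) e v y
   :> nat.
  rewrite -!big_split /=; apply: eq_bigr => y; rewrite !inE => /and3P[yu _ _].
  by rewrite /contract eqxx yu; case: (e u y); case: (e v y).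
lia.
Qed.

Lemma arcs_in_del (e : rel V) (A : {set V}) a b : symmetric e -> irreflexive e ->
  e a b -> a \in A -> b \in A ->
  arcs_in e A = arcs_in (fun x y => e x y && ([set x; y] != [set a; b])) A + 2.
Proof.
move=> se ie eab aA bA.
have ab : a != b by apply: contraTneq eab => ->; rewrite ie.
have one x0 : x0 \in A -> \sum_(x in A) (x == x0) = 1.
  move=> x0A; rewrite (big_setD1 x0) //= eqxx big1 ?addn0 // => x.
  by rewrite !inE => /andP[/negbTE->].
have two x0 y0 : x0 \in A -> y0 \in A ->
    \sum_(x in A) \sum_(y in A) ((x == x0) * (y == y0)) = 1.
  move=> x0A y0A; rewrite -(one x0 x0A); apply: eq_bigr => x _.
  by rewrite -big_distrr /= one // muln1.
rewrite -[2]/(1 + 1) -{1}(two a b aA bA) -(two b a bA aA) /arcs_in -!big_split /=.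
apply: eq_bigr => x _; rewrite -!big_split /=; apply: eq_bigr => y _.
have -> : [set x; y] != [set a; b] = ~~ ((x == a) && (y == b) || (x == b) && (y == a)).
  congr (~~ _); apply/eqP/orP => [E|[]/andP[/eqP-> /eqP->] //]; last by rewrite setUC.
  have : b \in [set x; y] by rewrite E set22.
  have : a \in [set x; y] by rewrite E set21.
  rewrite !inE => /orP[]/eqP ax /orP[]/eqP bx; move: ab; rewrite ax bx ?eqxx //= => _;
    by [left|right].
have ba : b == a = false by rewrite eq_sym (negbTE ab).
case: (eqVneq x a) => [->|xa]; case: (eqVneq y b) => [->|yb];
  rewrite ?(negbTE ab) ?ba ?eab ?andbT ?andbF ?muln0 ?addn0 //=.
- by rewrite andbT.
case: (eqVneq x b) => [->|xb]; case: (eqVneq y a) => [->|ya] //=; rewrite ?andbT ?addn0 //.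
by rewrite se eab.
Qed.

Lemma pairwise_sym (f : rel V) s : symmetric f -> pairwise f s ->
  {in s &, forall x y, x != y -> f x y}.
Proof.
move=> sf; elim: s => //= z s IH /andP[/allP zs /IH fs] x y.
rewrite !inE => /orP[/eqP->|xs] /orP[/eqP->|ys]; rewrite ?eqxx //.
- by move=> _; apply: zs.
- by move=> _; rewrite sf; apply: zs.
- exact: fs.
Qed.

(* Mader's argument: in a minimal counterexample every edge lies in three
   triangles and some vertex has degree at most 5, which produces a K5 minor. *)
Lemma vK_planar_arcs (e : rel V) (A : {set V}) : symmetric e -> irreflexive e ->
  vK_planar e A -> 2 < #|A| -> arcs_in e A + 12 <= 6 * #|A|.
Proof.
move: {2}(#|A| + arcs_in e A) (leqnn (#|A| + arcs_in e A)) => n.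
elim: n e A => [|n IH] e A; first by case: #|A|.
move=> szn se ie pA A3; rewrite leqNgt; apply/negP => big.
pose H v := [set y in A | e v y].
have degE v : \sum_(y in A) e v y = #|H v|.
  rewrite -sum1_card big_mkcond [RHS]big_mkcond /=; apply: eq_bigr => y _.
  by rewrite inE; case: (y \in A) => //; case: (e v y).
have HA v : v \in A -> #|H v| <= #|A|.-1.
  move=> vA; rewrite (cardsD1 v A) vA add1n /=; apply: subset_leq_card.
  apply/subsetP=> y; rewrite !inE => /andP[-> evy]; rewrite andbT.
  by apply: contraTneq evy => ->; rewrite ie.
have arcsE : arcs_in e A = \sum_(v in A) #|H v|.
  by apply: eq_bigr => v _; rewrite degE.
(* On three or four vertices the complete graph attains the bound, so there is no counterexample. *)
have A5 : 4 < #|A|.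
  have : arcs_in e A <= #|A| * #|A|.-1.
    by rewrite arcsE -sum_nat_const; apply: leq_sum => v; exact: HA.
  by move: A3 big; case: #|A| => [|[|[|[|[|k]]]]] //=; lia.
have cardD v : v \in A -> #|A :\ v| = #|A|.-1 by move=> vA; rewrite (cardsD1 v A) vA.
(* Deleting [v] lowers the bound by 6; a vertex of degree at most 3 would take at most 6 arcs with
   it and leave a smaller counterexample. *)
have deg4 v : v \in A -> 3 < #|H v|.
  move=> vA; have := arcs_inD1 se ie vA.
  have -> : \sum_(y in A :\ v) e v y = #|H v|.
    by rewrite -degE (big_setD1 v vA) /= ie.
  have := IH e (A :\ v); rewrite cardD // => /(_ _ se ie) IHv E.
  have := IHv _ (vK_planar_sub _ (subsetDl _ _) pA) _.
  by move=> /(_ ltac:(lia) ltac:(by []) ltac:(lia)); lia.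
(* Contracting [uv] lowers the bound by 6 and, with at most two common neighbours, the number of
   arcs by at most 6. *)
have common3 u v : u \in A -> v \in A -> e u v -> 2 < #|H u :&: H v|.
  move=> uA vA euv; have := arcs_in_contract se ie euv uA vA.
  have -> : \sum_(y in A) (e u y && e v y) = #|H u :&: H v|.
    rewrite -sum1_card big_mkcond [RHS]big_mkcond /=; apply: eq_bigr => y _.
    by rewrite !inE; case: (y \in A) => //; case: (e u y); case: (e v y).
  have := IH (contract e u v) (A :\ v); rewrite cardD //.
  move=> /(_ _ (contract_sym u v se) (contract_irr u v ie)
    (vK_planar_contract se ie euv uA vA pA)) IHv E.
  by have := IHv ltac:(lia) ltac:(lia); lia.
(* Without one edge the bound holds, so there are at most [6 * #|A| - 10] arcs and the average
   degree is below 6. *)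
have [v vA deg5] : exists2 v, v \in A & #|H v| <= 5.
  have [a [b [aA bA eab]]] : exists a b, [/\ a \in A, b \in A & e a b].
    have /card_gt0P[a aA] : 0 < #|A| by lia.
    have /card_gt0P[b] : 0 < #|H a| by have := deg4 _ aA; lia.
    by rewrite !inE => /andP[bA eab]; exists a, b.
  have E := arcs_in_del se ie eab aA bA.
  set e' := (fun x y => _) in E.
  have se' : symmetric e' by move=> x y; rewrite /e' se setUC.
  have ie' : irreflexive e' by move=> x; rewrite /e' ie.
  have /(_ ltac:(lia) A3) le' := IH e' A _ se' ie'
    (vK_planar_sub (fun x y (h : e' x y) => proj1 (andP h)) (subxx _) pA).
  case: (pickP [pred v in A | #|H v| <= 5]) => [v /andP[]|no]; first by exists v.
  have : 6 * #|A| <= arcs_in e A.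
    rewrite mulnC arcsE -sum_nat_const; apply: leq_sum => v vA.
    by have := no v; rewrite /= vA /= leqNgt => /negbFE.
  lia.
have HvA x : x \in H v -> x \in A by rewrite inE => /andP[].
have evH x : x \in H v -> e v x by rewrite inE => /andP[].
have vH : v \notin H v by rewrite inE ie andbF.
have inH3 x : x \in H v -> 2 < #|H v :&: H x|.
  by move=> xH; apply: common3; [exact: vA|exact: HvA|exact: evH].
have [H4|H5] : #|H v| = 4 \/ #|H v| = 5 by have := deg4 _ vA; lia.
  (* With degree 4, each neighbour of [v] is adjacent to the three others, so [v] and its neighbours
     form a K5. *)
  apply: (@vK_planarN_K5 e A (v :: enum (H v))) pA.
  - by rewrite [size _]/= -cardE H4.
  - by rewrite /= mem_enum vH enum_uniq.
  - by move=> x; rewrite inE mem_enum => /orP[/eqP->|/HvA].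
  have nb x y : x \in H v -> y \in H v -> x != y -> e x y.
    move=> xH yH xy; apply: contraT => nexy.
    have : #|H v :&: H x| <= #|H v :\ x :\ y|.
      apply/subset_leq_card/subsetP=> z; rewrite !inE.
      case/andP=> [/andP[-> ->] /andP[_ exz]]; rewrite !andbT.
      apply/andP; split; first by apply: contraNneq nexy => <-.
      by apply: contraTneq exz => ->; rewrite ie.
    have := inH3 x xH.
    by have := cardsD1 x (H v); have := cardsD1 y (H v :\ x); rewrite !inE; move: xH yH; rewrite !inE eq_sym xy => -> ->; lia.
  move=> x y; rewrite !inE !mem_enum => /orP[/eqP->|xH] /orP[/eqP->|yH]; rewrite ?eqxx //.
  - by move=> _; exact: evH.
  - by move=> _; rewrite se; exact: evH.
  - exact: nb.
(* With degree 5, each neighbour of [v] misses at most one of the four others. *)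
have almost z y1 y2 : z \in H v -> y1 \in H v -> y2 \in H v ->
    uniq [:: z; y1; y2] -> e z y1 || e z y2.
  move=> zH y1H y2H uz; apply: contraT; rewrite negb_or => /andP[n1 n2].
  have : #|H v :&: H z| <= #|H v :\: [set z; y1; y2]|.
    apply/subset_leq_card/subsetP=> t; rewrite !inE.
    case/andP=> [/andP[-> ->] /andP[_ ezt]]; rewrite !andbT !negb_or -!andbA.
    apply/and3P; split; [|by apply: contraNneq n1 => <-|by apply: contraNneq n2 => <-].
    by apply: contraTneq ezt => ->; rewrite ie.
  have := cardsID [set z; y1; y2] (H v).
  have -> : H v :&: [set z; y1; y2] = [set z; y1; y2].
    by apply/setIidPr/subsetP=> t; rewrite !in_setU !in_set1 => /orP[/orP[]|] /eqP->.
  have -> : #|[set z; y1; y2]| = 3.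
    by rewrite -[3]/(size [:: z; y1; y2]) -(card_uniqP uz);
      apply: eq_card => t; rewrite !inE -orbA.
  by have := inH3 z zH; lia.
case: (pickP [pred p | [&& p.1 \in H v, p.2 \in H v, p.1 != p.2 & ~~ e p.1 p.2]]) => [[x y]|no]; last first.
  apply: (@vK_planarN_K5 e A (enum (H v))) pA.
  - by rewrite -cardE.
  - exact: enum_uniq.
  - by move=> x; rewrite mem_enum => /HvA.
  - move=> x y; rewrite !mem_enum => xH yH xy; apply: contraT => nxy.
    by have := no (x, y); rewrite /= xH yH xy nxy.
case/and4P=> /= xH yH xy nxy.
(* Among the three neighbours other than [x] and [y] at most one pair is not adjacent; [p] is a
   vertex outside such a pair. *)
have [p [q [r [pqr epq epr]]]] : exists p q r,
    [/\ [/\ p \in H v, q \in H v, r \in H v & uniq [:: x; y; p; q; r]], e p q & e p r].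
  have T3 : #|H v :\ x :\ y| = 3.
    have := cardsD1 x (H v); have := cardsD1 y (H v :\ x); rewrite !in_setD1 yH xH eq_sym xy; lia.
  have := enum_uniq (H v :\ x :\ y).
  have : forall z, z \in enum (H v :\ x :\ y) -> [/\ z \in H v, z != x & z != y].
    by move=> z; rewrite mem_enum !in_setD1 => /and3P[].
  move: T3; rewrite cardE; case: (enum _) => [|t1 [|t2 [|t3 []]]] // _ tH.
  have [h1 x1 y1] := tH t1 ltac:(by rewrite !inE eqxx).
  have [h2 x2 y2] := tH t2 ltac:(by rewrite !inE eqxx orbT).
  have [h3 x3 y3] := tH t3 ltac:(by rewrite !inE eqxx !orbT).
  rewrite /= !inE !negb_or -!andbA => /and3P[n12 n13 /andP[n23 _]].
  have al z a b : z \in H v -> a \in H v -> b \in H v -> z != a -> z != b ->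
      a != b -> ~~ e z a -> e z b.
    move=> zH aH bH za zb ab nz; have := almost z a b zH aH bH.
    by rewrite /= !inE negb_or za zb ab (negbTE nz) /=; apply.
  have n21 := n12; have n31 := n13; have n32 := n23.
  rewrite eq_sym in n21; rewrite eq_sym in n31; rewrite eq_sym in n32.
  have ux a b c : [&& a != x, b != x, c != x, a != y, b != y & c != y] ->
     [&& a != b, a != c & b != c] -> uniq [:: x; y; a; b; c].
    case/and5P=> ax bx cx ay /andP[by_ cy] /and3P[ab ac bc].
    by rewrite /= !inE !negb_or !(eq_sym x) !(eq_sym y) xy ax bx cx ay by_ cy ab ac bc.
  case: (boolP (e t1 t2)) => [e12|ne12]; last first.
    exists t3, t1, t2; split; first by split=> //; apply: ux; rewrite ?x1 ?x2 ?x3 ?y1 ?y2 ?y3 ?n31 ?n32 ?n12.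
    - by rewrite se (al t1 t2 t3).
    - by rewrite se (al t2 t1 t3) // se.
  case: (boolP (e t1 t3)) => [e13|ne13].
    by exists t1, t2, t3; split=> //; split=> //; apply: ux; rewrite ?x1 ?x2 ?x3 ?y1 ?y2 ?y3 ?n12 ?n13 ?n23.
  exists t2, t1, t3; split; first by split=> //; apply: ux; rewrite ?x1 ?x2 ?x3 ?y1 ?y2 ?y3 ?n21 ?n23 ?n13.
    by rewrite se.
  by rewrite se (al t3 t1 t2) // se.
case: pqr => pH qH rH u5.
have nx z : z \in H v -> x != z -> y != z -> e x z /\ e y z.
  move=> zH xz yz; have := almost x y z xH yH zH; have := almost y x z yH xH zH.
  rewrite /= !inE !negb_or (eq_sym y x) xy xz yz (se y x) (negbTE nxy) /=.
  by move=> /(_ isT) -> /(_ isT) ->.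
move: u5; rewrite /= !inE !negb_or -!andbA.
case/and5P=> _ xp xq xr /and5P[yp yq yr pq /and3P[pr qr _]].
have [exp eyp] := nx p pH xp yp.
have [exq eyq] := nx q qH xq yq.
have [exr eyr] := nx r rH xr yr.
have vz z : z \in H v -> v != z by move=> zH; apply: contraNneq vH => {1}->.
have eqx : e q x by rewrite se.
(* Contracting [qx] removes one vertex of the non-adjacent pair and supplies the possibly missing
   edge [qr], since [x] is adjacent to [r]. *)
apply: (@vK_planarN_K5 (contract e q x) (A :\ x) [:: v; p; q; r; y]).
- by [].
- by rewrite /= !inE !negb_or !vz // !(eq_sym _ y) yp yq yr pq pr qr.
- move=> z; rewrite !inE => /or4P[/eqP->|/eqP->|/eqP->|/orP[]/eqP->].
  + by rewrite vz.
  + by rewrite eq_sym xp HvA.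
  + by rewrite eq_sym xq HvA.
  + by rewrite eq_sym xr HvA.
  + by rewrite eq_sym xy HvA.
- apply: pairwise_sym; first exact: contract_sym.
  have qv : v == q = false by apply/negbTE/vz.
  have py : e p y by rewrite se.
  have ry : e r y by rewrite se.
  have qy : e q y by rewrite se.
  have [qp' qr' qy'] : [/\ p == q = false, r == q = false & y == q = false].
    by rewrite (negbTE pq) [r == q]eq_sym (negbTE qr) (negbTE yq).
  by rewrite /= /contract eqxx qv qp' qr' qy' !evH //= epq epr py ry qy exr !orbT.
- exact: vK_planar_contract (HvA _ qH) (HvA _ xH) pA.
Qed.

End VanKampen.

(** * Degree sums over a factor *)

Section Counting.
Variable G : sgraph.
Implicit Types (x y : G) (A : {set G}) (M : {set {set G}}).

Lemma edge_setP A : reflect (exists x y, adj x y /\ A = [set x; y]) (A \in edge_set G).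
Proof.
apply: (iffP imsetP) => [[[x y] /= h ->]|[x [y [xy ->]]]].
  by exists x, y; rewrite inE in h.
by exists (x, y); rewrite ?inE.
Qed.

Lemma adj_neq x y : adj x y -> x != y.
Proof. by apply: contraTneq => ->; rewrite adj_irr. Qed.

Lemma card_edges_at x : #|[set A in edge_set G | x \in A]| = degree x.
Proof.
rewrite /degree -(card_in_imset (f := fun y => [set x; y])).
  apply: eq_card => A; rewrite inE; apply/andP/imsetP => [[/edge_setP[a [b [ab ->]]]]|[y]].
    rewrite !inE => /orP[]/eqP xE; subst x; first by exists b; rewrite ?inE.
    by exists a; rewrite ?inE 1?adj_sym // setUC.
  by rewrite inE => xy ->; rewrite set21; split=> //; apply/edge_setP; exists x, y.
move=> y z; rewrite !inE => xy xz E.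
have : y \in [set x; z] by rewrite -E set22.
by rewrite !inE eq_sym (negbTE (adj_neq xy)) => /eqP.
Qed.

Definition weight A := \sum_(x in A) degree x.

Lemma sum_weight M (d : nat) : (forall x, #|[set A in M | x \in A]| = d) ->
  \sum_(A in M) weight A = d * \sum_(x : G) degree x.
Proof.
move=> hM; rewrite /weight (exchange_big_dep xpredT) //= big_distrr /=.
apply: eq_bigr => x _; rewrite sum_nat_const -(hM x); congr (_ * _).
by apply: eq_card => A; rewrite !inE.
Qed.

Lemma sum_card M (d : nat) : M \subset edge_set G ->
  (forall x, #|[set A in M | x \in A]| = d) -> 2 * #|M| = d * #|G|.
Proof.
move=> /subsetP sM hM.
have : \sum_(A in M) #|A| = d * #|G|.
  rewrite (eq_bigr (fun A => \sum_(x in A) 1)) => [|A _]; last by rewrite sum1_card.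
  rewrite (exchange_big_dep xpredT) //= mulnC -sum_nat_const; apply: eq_bigr => x _.
  by rewrite sum1_card -(hM x); apply: eq_card => A; rewrite !inE.
rewrite (eq_bigr (fun=> 2)) => [|A /sM/edge_setP[x [y [xy ->]]]].
  by rewrite sum_nat_const mulnC.
by rewrite cards2 adj_neq.
Qed.

Lemma sum_degree : \sum_(x : G) degree x = 2 * #|edge_set G|.
Proof.
have : \sum_(A in edge_set G) #|A| = \sum_(x : G) degree x.
  rewrite (eq_bigr (fun A => \sum_(x in A) 1)) => [|A _]; last by rewrite sum1_card.
  rewrite (exchange_big_dep xpredT) //=; apply: eq_bigr => x _.
  by rewrite sum1_card -card_edges_at; apply: eq_card => A; rewrite !inE.
rewrite (eq_bigr (fun=> 2)) => [<-|A /edge_setP[x [y [xy ->]]]].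
  by rewrite sum_nat_const mulnC.
by rewrite cards2 adj_neq.
Qed.

(** The edges at [x] and those at [y] have only [a] in common, and [a] is not its own neighbour;
    this accounts for the 2. *)
Lemma line_degree (a : edge G) : (degree (a : line_graph G)).+2 = weight (val a).
Proof.
have /edge_setP[x [y [xy aE]]] := valP a.
have nxy := adj_neq xy.
rewrite /weight aE big_setU1 ?inE ?nxy //= big_set1.
pose I z := [set A in edge_set G | z \in A].
have -> : degree (a : line_graph G) = #|(I x :|: I y) :\ val a|.
  rewrite /degree -(card_imset _ (val_inj : injective (val : edge G -> {set G}))).
  apply: eq_card => A; apply/imsetP/idP => [[b bN ->]|].
    have /andP[ab /set0Pn[z]] : line_adj a b by rewrite inE in bN.
    rewrite inE => /andP[za zb]; rewrite aE in za.
    have vne : val b != val a by rewrite (inj_eq val_inj) eq_sym.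
    have be := valP b; rewrite in_setD1 vne in_setU !inE be /=.
    by move: za; rewrite !inE => /orP[]/eqP zE; rewrite zE in zb; rewrite zb ?orbT.
  rewrite !inE => /andP[Aa]; rewrite -andb_orr => /andP[AE xyA].
  exists (exist (fun A : {set G} => A \in edge_set G) A AE) => //=.
  rewrite inE /= /line_adj; apply/andP; split; first by rewrite -(inj_eq val_inj) eq_sym.
  by case/orP: xyA => zA; apply/set0Pn; [exists x|exists y]; rewrite inE aE !inE eqxx ?orbT.
have aI : val a \in I x :|: I y by rewrite !inE aE set21 -aE (valP a).
have IxIy : I x :&: I y = [set val a].
  apply/setP => A; rewrite !inE; apply/andP/eqP => [[/andP[/edge_setP[u [v [uv ->]]] xA] /andP[_ yA]]|->].
    apply/eqP; rewrite eq_sym eqEcard aE !cards2 nxy (adj_neq uv) andbT.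
    by apply/subsetP => z; rewrite [z \in [set x; y]]in_set2 => /orP[]/eqP->.
  by rewrite (valP a) aE set21 set22.
have := cardsD1 (val a) (I x :|: I y); rewrite aI add1n => cD.
have := cardsUI (I x) (I y); rewrite IxIy cards1 !card_edges_at => cU.
by rewrite -cU cD addn1.
Qed.

Lemma k_indep_sub k (H : sgraph) (S T : {set H}) : S \subset T -> k_indep k T -> k_indep k S.
Proof.
move=> /subsetP ST kT; apply/bigmax_leqP => x _; apply: leq_trans kT.
pose x' : induced T := exist (fun z => z \in T) (val x) (ST _ (valP x)).
apply: leq_trans (leq_bigmax x').
rewrite /degree -(card_imset _ (val_inj : injective (val : induced S -> H))).
rewrite -(card_imset _ (val_inj : injective (val : induced T -> H))).
apply: subset_leq_card; apply/subsetP => y /imsetP[z]; rewrite inE => xz ->.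
apply/imsetP; exists (exist (fun z => z \in T) (val z) (ST _ (valP z))) => //.
by rewrite inE.
Qed.

(** An optimal [k]-colouring cuts a degree class into [chi_k] sets, each of them regular and
    [k]-independent. *)
Lemma alpha_chi k (H : sgraph) i : #|deg_class H i| <= chi_k k H * alpha_reg k H.
Proof.
rewrite /chi_k; case: ex_minnP => n /existsP[c /forallP cP] _.
have -> : #|deg_class H i| = \sum_(j < n) #|[set x in deg_class H i | c x == j]|.
  rewrite -sum1_card (partition_big c xpredT) //=; apply: eq_bigr => j _.
  by rewrite -sum1_card; apply: eq_bigl => x; rewrite !inE.
rewrite -[n in n * _]card_ord -sum_nat_const; apply: leq_sum => j _.
(* Beyond the range of indices allowed in [regular_k_indep] the degree class is empty. *)
have [i_lt|i_ge] := ltnP i #|H|.+1; last first.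
  suff -> : [set x in deg_class H i | c x == j] = set0 by rewrite cards0.
  apply/setP => x; rewrite !inE; apply/negbTE; rewrite negb_and; apply/orP; left.
  by rewrite neq_ltn; apply/orP; left; apply: leq_ltn_trans (max_card _) i_ge.
apply: (@leq_bigmax_cond _ (fun S => regular_k_indep k S) (fun S : {set H} => #|S|)).
apply/andP; split.
  by apply: k_indep_sub (cP j); apply/subsetP => x; rewrite !inE => /andP[].
by apply/existsP; exists (Ordinal i_lt); apply/subsetP => x; rewrite !inE => /andP[].
Qed.

Lemma weight_class k M w : M \subset edge_set G ->
  #|[set A in M | weight A == w]| <= chi_k k (line_graph G) * alpha_reg k (line_graph G).
Proof.
move=> /subsetP sM; have [w2|w2] := ltnP w 2.
  suff -> : [set A in M | weight A == w] = set0 by rewrite cards0.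
  apply/setP => A; rewrite !inE; apply/negbTE; apply/negP => /andP[/sM Ae /eqP wA].
  by move: w2; rewrite -wA -(line_degree (exist (fun A : {set G} => A \in edge_set G) A Ae)).
apply: leq_trans (alpha_chi k (line_graph G) w.-2).
rewrite -(card_imset _ (val_inj : injective (val : edge G -> {set G}))).
apply: subset_leq_card; apply/subsetP => A; rewrite inE => /andP[/sM Ae /eqP wA].
apply/imsetP; exists (exist (fun A : {set G} => A \in edge_set G) A Ae) => //.
by rewrite inE -eqSS -eqSS (line_degree (exist _ A Ae)) /= wA; case: w w2 {wA} => [|[]].
Qed.

(* Each of the weights [s], ..., [s + c - 1] is attained at most
   [chi_k * alpha_reg] times, and an edge of weight [s + i] falls short of [s + c]
   by [c - i]. *)
Lemma weight_average k M (s c : nat) : M \subset edge_set G ->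
  (forall A, A \in M -> s <= weight A) ->
  (s + c) * #|M| <= \sum_(A in M) weight A
     + (\sum_(i < c) (c - i)) * (chi_k k (line_graph G) * alpha_reg k (line_graph G)).
Proof.
move=> sM lo; set B := chi_k _ _ * _.
have -> : (s + c) * #|M| = \sum_(A in M) (s + c) by rewrite sum_nat_const mulnC.
apply: (@leq_trans (\sum_(A in M) (weight A + (s + c - weight A)))).
  by apply: leq_sum => A _; lia.
rewrite big_split /= leq_add2l.
have -> : \sum_(A in M) (s + c - weight A)
   = \sum_(i < c) \sum_(A in M | weight A == s + i) (c - i).
  rewrite [LHS](bigID (fun A => weight A < s + c)) /= [X in _ + X]big1 ?addn0; last first.
    by move=> A /andP[_]; rewrite -leqNgt => h; apply/eqP; rewrite subn_eq0.
  rewrite [RHS](exchange_big_dep (mem M)) /=; last by move=> i A _ /andP[].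
  rewrite big_mkcondr /=; apply: eq_bigr => A AM; rewrite AM /=.
  have sA := lo A AM; case: ltnP => h.
    have lt : weight A - s < c by lia.
    rewrite (bigD1 (Ordinal lt)) /=; last by apply/eqP; lia.
    rewrite big1 ?addn0; first by lia.
    move=> i /andP[/eqP wi /eqP ni]; exfalso; apply: ni; apply: val_inj => /=; lia.
  by rewrite big1 // => i /eqP wi; have := ltn_ord i; lia.
rewrite big_distrl /=; apply: leq_sum => i _; rewrite sum_nat_const mulnC leq_mul2l.
apply/orP; right; apply: leq_trans (weight_class k (s + i) sM).
by apply: eq_leq; apply: eq_card => A; rewrite !inE.
Qed.

End Counting.

(** * Edges of acyclic graphs *)

Lemma acyclic_leaf (V : finType) (e : rel V) (A : {set V}) :
  symmetric e -> irreflexive e -> (forall s, 2 < size s -> ~ ucycle e s) ->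
  0 < #|A| -> exists2 v, v \in A & #|[set y in A | e v y]| <= 1.
Proof.
move=> se ie acyc A0.
case: (pickP [pred v in A | #|[set y in A | e v y]| <= 1]) => [v /andP[]|no]; first by exists v.
exfalso.
(* In a longest path all neighbours of the first vertex [x] lie on the path, and a neighbour other
   than the next vertex closes a cycle. *)
pose P n := [exists t : n.-tuple V, exists x, [&& path e x t, uniq (x :: t) & all (mem A) (x :: t)]].
have P0 : exists n, P n.
  case/card_gt0P: A0 => x xA; exists 0; apply/existsP; exists [tuple]; apply/existsP; exists x.
  by rewrite /= xA.
have Pmax n : P n -> n <= #|V|.
  case/existsP=> t /existsP[x /and3P[_ /andP[_ ut] _]].
  by rewrite -(size_tuple t) -(card_uniqP ut) max_card.
case: (ex_maxnP P0 Pmax) => n /existsP[t /existsP[x /and3P[pt ut At]]] nmax.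
have ext y : y \in A -> e x y -> y \in (t : seq V).
  move=> yA exy; apply: contraT => yt.
  have : P n.+1.
    apply/existsP; exists [tuple of x :: t]; apply/existsP; exists y.
    rewrite /= se exy pt /= yA inE negb_or yt andbT.
    move: ut At => /= -> ->; rewrite !andbT.
    by apply: contraTneq exy => ->; rewrite ie.
  by move/nmax; rewrite ltnn.
have xA : x \in A by move: At => /= /andP[].
have N2 : 1 < #|[set y in A | e x y]|.
  by have := no x; rewrite /= xA /= leqNgt => /negbFE.
have [y] : exists y, y \in [set y in A | e x y] :\ head x t.
  by apply/card_gt0P; move: N2; rewrite (cardsD1 (head x t)); case: (_ \in _); lia.
rewrite !inE => /and3P[yh yA exy].
have yt := ext y yA exy.
have {pt ut yt yh} [s [pt ut yt yh]] : exists s : seq V,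
  [/\ path e x s, uniq (x :: s), y \in s & y != head x s] by exists t.
case/splitPr: yt pt ut yh => p1 p2 pt ut yh.
have p1n : p1 != [::] by apply: contraNneq yh => ->.
apply: (acyc (x :: rcons p1 y)).
  by rewrite /= size_rcons; case: p1 p1n {pt ut yh}.
rewrite -cat_rcons cat_path in pt; case/andP: pt => pt _.
rewrite /ucycle /ucycleb /= rcons_path pt last_rcons se exy /=.
by rewrite -cat_rcons -cat_cons cat_uniq in ut; case/andP: ut.
Qed.

Lemma acyclic_arcs (V : finType) (e : rel V) (A : {set V}) :
  symmetric e -> irreflexive e -> (forall s, 2 < size s -> ~ ucycle e s) ->
  0 < #|A| -> arcs_in e A + 2 <= 2 * #|A|.
Proof.
move=> se ie acyc; elim: {A}_.+1 {-2}A (ltnSn #|A|) => // n IH A An A0.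
have [v vA dv] := acyclic_leaf se ie acyc A0.
have dE : \sum_(y in A :\ v) e v y <= 1.
  apply: leq_trans dv; rewrite -sum1_card big_mkcond [X in _ <= X]big_mkcond /=.
  apply: leq_sum => y _; rewrite !inE; case: (y == v); case: (y \in A); case: (e v y) => //.
have cA := cardsD1 v A; rewrite vA in cA.
have [A1|A1] := posnP #|A :\ v|.
  have -> : arcs_in e A = 0; last by lia.
  rewrite (arcs_inD1 se ie vA).
  have -> : A :\ v = set0 by apply/cards0_eq.
  by rewrite /arcs_in !big_set0.
have := IH (A :\ v) ltac:(lia) A1; rewrite (arcs_inD1 se ie vA); lia.
Qed.

Lemma arcs_in_setT (G : sgraph) : arcs_in (@adj G) [set: G] = 2 * #|edge_set G|.
Proof.
rewrite -sum_degree /arcs_in; apply: eq_big => [x|x _]; first by rewrite inE.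
rewrite /degree -sum1_card big_mkcond [RHS]big_mkcond /=.
by apply: eq_bigr => y _; rewrite !inE; case: adj.
Qed.

Lemma tree_edges (G : sgraph) : is_tree G -> #|edge_set G| < #|G|.
Proof.
case=> G0 _ acyc; have := acyclic_arcs (@adj_sym G) (@adj_irr G) acyc (A := [set: G]).
by rewrite arcs_in_setT cardsT => /(_ G0); lia.
Qed.

(** * The counting inequality and the case of trees *)

Section Bounds.
Variables (k : nat) (G : sgraph).
Local Notation m := #|edge_set G|.
Local Notation n := #|G|.
Local Notation B := (chi_k k (line_graph G) * alpha_reg k (line_graph G)).

(** This is [weight_average] multiplied by 2, because a [d]-factor has [d * n / 2] edges; its total
    weight is [d] times the degree sum [2 * m]. *)
Lemma factor_bound (d s c : nat) : has_factor d G ->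
  (forall x y : G, adj x y -> s <= degree x + degree y) ->
  (s + c) * (d * n) <= 4 * (d * m) + 2 * ((\sum_(i < c) (c - i)) * B).
Proof.
move=> [M sM hM] hs.
have lo A : A \in M -> s <= weight A.
  move=> /(subsetP sM)/edge_setP[x [y [xy ->]]].
  by rewrite /weight big_setU1 ?inE ?adj_neq //= big_set1; exact: hs.
have := weight_average k c sM lo; rewrite (sum_weight hM) sum_degree -(sum_card sM hM).
rewrite -(leq_pmul2l (isT : 0 < 2)) mulnDr => h.
by rewrite mulnCA; apply: leq_trans h _; rewrite (mulnCA d) mulnA.
Qed.

(** A single edge makes some weight class nonempty, hence [B] positive. This settles the graphs that
    are too small for the degree sum bounds. *)
Lemma edges_le_mul (K : nat) : m <= K -> m <= K * B.
Proof.
have [->//|m0 mK] := posnP m; apply: leq_trans mK _; rewrite leq_pmulr //.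
case/card_gt0P: m0 => A Ae.
apply: leq_trans (weight_class k (weight A) (subxx (edge_set G))).
by apply/card_gt0P; exists A; rewrite inE Ae eqxx.
Qed.

Lemma edges_le_square : 2 * m <= n * n.
Proof.
rewrite -sum_degree -sum_nat_const; apply: leq_sum => x _; exact: max_card.
Qed.

Lemma tree_bound : is_tree G -> has_perfect_matching G -> m <= 6 * B.
Proof.
move=> tG pm; have [/edges_le_mul//|m7] := leqP m 6.
(* Two adjacent leaves would be a component, hence the whole tree, which has more edges than
   that. *)
have lo (x y : G) : adj x y -> 3 <= degree x + degree y.
  move=> xy; rewrite ltnNge; apply/negP => d2.
  have dx : 0 < degree x by apply/card_gt0P; exists y; rewrite inE.
  have dy : 0 < degree y by apply/card_gt0P; exists x; rewrite inE adj_sym.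
  have /card_le1_eqP x1 : degree x <= 1 by lia.
  have /card_le1_eqP y1 : degree y <= 1 by lia.
  have cl : closed (@adj G) [set x; y].
    apply: (intro_closed (sym_connect_sym (@adj_sym G))) => u v uv.
    rewrite !inE => /orP[]/eqP uE; rewrite uE in uv.
      by rewrite (x1 v y) ?inE ?eqxx ?orbT.
    by rewrite (y1 v x) ?inE ?eqxx // adj_sym.
  have n2 : n <= 2.
    apply: leq_trans (card_size [:: x; y]); apply: subset_leq_card.
    apply/subsetP => z _; case: tG => _ /(_ x z) cz _.
    by have := closed_connect cl cz; rewrite !inE eqxx /= => /esym.
  have := edges_le_square; have := leq_mul n2 n2; lia.
(* With [s = c = 3] the inequality reads [6 n <= 4 m + 12 B], and [m < n]. *)
have := factor_bound 3 pm lo; have := tree_edges tG.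
have -> : \sum_(i < 3) (3 - i) = 6 by rewrite !big_ord_recl big_ord0.
by set b := B; lia.
Qed.

End Bounds.

(** * Adding a vertex adjacent to all others *)

Section Apex.
Variable G : sgraph.

Definition apex_adj : rel (option G) := fun u v =>
  match u, v with
  | Some x, Some y => adj x y
  | None, None => false
  | _, _ => true
  end.

Lemma apex_sym : symmetric apex_adj.
Proof. by move=> [x|] [y|] //=; rewrite adj_sym. Qed.

Lemma apex_irr : irreflexive apex_adj.
Proof. by move=> [x|] //=; rewrite adj_irr. Qed.

Definition apex : sgraph := SGraph apex_sym apex_irr.

Let Some_injG : injective (Some : G -> option G). Proof. by move=> ? ? []. Qed.

Lemma apex_degree (x : G) : degree (Some x : apex) = (degree x).+1.
Proof.
rewrite /degree -(card_imset _ Some_injG).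
set N := [set Some y | y in _]; have NN : None \notin N by apply/imsetP => -[].
have -> : #|N|.+1 = #|None |: N| by rewrite cardsU1 NN.
apply: eq_card => -[y|]; last by rewrite !inE.
by rewrite !inE /= (mem_imset _ _ Some_injG) inE.
Qed.

Lemma apex_degree_None : degree (None : apex) = #|G|.
Proof.
rewrite /degree -cardsT -(card_imset _ Some_injG); apply: eq_card => -[y|].
  by rewrite !inE /= (mem_imset _ _ Some_injG) inE.
by rewrite !inE /=; apply/esym/imsetP => -[].
Qed.

Lemma apex_edges : #|edge_set apex| = #|edge_set G| + #|G|.
Proof.
apply/eqP; rewrite -(eqn_pmul2l (isT : 0 < 2)) -sum_degree mulnDr -sum_degree.
rewrite (bigD1 (None : apex)) //= apex_degree_None.
rewrite (reindex_omap (Some : G -> apex) id) /=; last by case.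
rewrite (eq_big xpredT (fun x : G => degree x + 1)) => [|x|x _]; last 2 first.
- by rewrite eqxx.
- by rewrite apex_degree addn1.
by rewrite big_split /= sum1_card addnCA mul2n addnn.
Qed.

End Apex.

Import Order.TTheory GRing.Theory Num.Theory.
Local Open Scope ring_scope.

Lemma ratio_bound (m K chi alpha : nat) : (m <= K * (chi * alpha))%N ->
  m%:R / (K%:R * chi%:R) <= alpha%:R :> rat.
Proof.
(* If the denominator vanishes, the quotient is 0 by convention. *)
move=> h; have [->|c0] := posnP chi; first by rewrite mulr0 invr0 mulr0 ler0n.
have [K0|K0] := posnP K; first by rewrite K0 mul0r invr0 mulr0 ler0n.
rewrite ler_pdivrMr; last by rewrite -natrM ltr0n muln_gt0 K0.
by rewrite -!natrM ler_nat; apply: leq_trans h _; rewrite [(alpha * _)%N]mulnC mulnA.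
Qed.

From mathcomp Require Import all_classical all_reals all_analysis.

Import Order.TTheory GRing.Theory Num.Theory.
Import numFieldNormedType.Exports.

Local Open Scope classical_set_scope.

(** * Paths in the plane *)

Section Interval.
Variable R : realType.
Implicit Types (f g : R -> R * R).

(** The form of compactness from which uniform continuity, positive distances, boundedness and
    polygonal chains are derived; [P x y] stands for a property of the piece between [x] and [y].
    The supremum of the points reached from [a] is itself reached, and below [b] one could go
    further. *)
Lemma cousin (P : R -> R -> Prop) (a b : R) : a <= b ->
  (forall t : R, a <= t <= b -> exists2 d : R, 0 < d & forall x y,
     a <= x -> x <= t -> t <= y -> y <= b -> y - x < d -> P x y) ->
  (forall x y z, a <= x -> x <= y -> y <= z -> z <= b ->
     P x y -> P y z -> P x z) -> P a b.
Proof.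
move=> ab loc cat.
pose S := [set t : R | a <= t <= b /\ P a t].
have Sa : S a.
  split; first by rewrite lexx ab.
  have [|d d0 h] := loc a; first by rewrite lexx ab.
  by apply: h; rewrite ?lexx ?subrr.
have supS : has_sup S by split; [exists a | exists b => t [/andP[]]].
have aS : a <= sup S by apply: ub_le_sup => //; exact: supS.2.
have Sb : sup S <= b by apply: ge_sup => [|t [/andP[]]] //; exists a.
have [|d d0 h] := loc (sup S); first by rewrite aS Sb.
have d20 : 0 < d / 2 by lra.
have [t [/andP[ta tb] Pt] tS] := sup_adherent d20 supS.
have tS' : t <= sup S by apply: ub_le_sup; [exact: supS.2|split=> //; rewrite ta tb].
pose y := Num.min b (sup S + d / 4).
have yb : y <= b by rewrite ge_min lexx.
have yS : sup S <= y by rewrite le_min Sb; lra.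
have yd : y <= sup S + d / 4 by rewrite ge_min lexx orbT.
have Py : P a y.
  apply: (cat a t y) => //; first by apply: le_trans yS.
  by apply: h => //; lra.
have yle : y <= sup S.
  by apply: ub_le_sup; [exact: supS.2|split=> //; rewrite yb (le_trans aS yS)].
suff -> : b = y by [].
by move: yle; rewrite /y; case: (leP b (sup S + d / 4)) => //; lra.
Qed.

Lemma locally_const (P : R -> Prop) (a b : R) :
  (forall t : R, a <= t <= b -> exists2 d : R, 0 < d & forall s : R, a <= s <= b ->
     `|s - t| < d -> (P s <-> P t)) ->
  forall s t : R, a <= s <= b -> a <= t <= b -> P s -> P t.
Proof.
move=> loc s t s01 t01.
wlog : P loc s t s01 t01 / s <= t.
  move=> H; case: (leP s t) => [st|/ltW ts]; first exact: (H P loc).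
  move=> Ps; apply: contrapT => Pt; apply: (H (fun u => ~ P u) _ t s t01 s01 ts) => //.
  by move=> u u01; have [d d0 h] := loc u u01; exists d => // v v01 /(h v v01); tauto.
move=> st; apply: (@cousin (fun x y => P x -> P y)) => //; last by move=> x y z _ _ _ _ h1 h2 /h1/h2.
move=> u /andP[su ut]; have [|d d0 h] := loc u; first by lra.
exists d => // x y sx xu uy yt yx.
have hx : P x <-> P u by apply: h; [lra|rewrite ler0_norm; lra].
have hy : P y <-> P u by apply: h; [lra|rewrite ger0_norm; lra].
by tauto.
Qed.

(** The predicate is required of all smaller radii too, so that the minimum of finitely many radii
    serves every index. *)
Lemma fin_eps (T : finType) (P : T -> R -> Prop) :
  (forall x, exists2 e : R, 0 < e & forall e' : R, 0 < e' -> e' <= e -> P x e') ->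
  exists2 e : R, 0 < e & forall x (e' : R), 0 < e' -> e' <= e -> P x e'.
Proof.
move=> h.
have /choice[g gP] : forall x, exists e : R,
    0 < e /\ forall e' : R, 0 < e' -> e' <= e -> P x e'.
  by move=> x; have [e e0 he] := h x; exists e.
pose m := \big[Num.min/1]_x g x.
have m0 : 0 < m.
  by rewrite /m; elim/big_ind: _ => // [x y x0 y0|x _]; [rewrite lt_min x0 y0|exact: (gP x).1].
exists m => // x e' e'0 e'm; apply: (gP x).2 => //.
apply: le_trans e'm _.
have : x \in index_enum T by rewrite mem_index_enum.
rewrite /m; elim: (index_enum T) => // y s IH; rewrite inE big_cons => /orP[/eqP<-|/IH le].
  by rewrite ge_min lexx.
by rewrite ge_min le orbT.
Qed.

(** Continuity on the closed unit interval that ignores values outside it, so that paths can be cut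
    and glued by plain formulas. *)
Definition cont01 f := forall t : R, 0 <= t <= 1 -> forall e : R, 0 < e ->
  exists2 d : R, 0 < d & forall s : R, 0 <= s <= 1 -> `|s - t| < d -> `|f s - f t| < e.

Lemma within_cont01 f : {within `[0, 1], continuous f} <-> cont01 f.
Proof.
split=> [/subspace_continuousP fc t t01 e e0|fc].
  have tI : `[0, 1]%classic t by rewrite /= in_itv.
  have /cvgrPdist_lt/(_ e e0) := fc t tI.
  rewrite nearE /within /= => /nbhs_ballP[d d0 h]; exists d => // s s01 sd.
  rewrite distrC; apply: (h s); last by rewrite /= in_itv.
  by rewrite /ball /= distrC.
apply/subspace_continuousP => t; rewrite /= in_itv /= => t01.
apply/cvgrPdist_lt => e e0; have [d d0 h] := fc t t01 e e0.
rewrite nearE /within /=; apply/nbhs_ballP; exists d => // s.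
rewrite /ball /= distrC => sd; rewrite /= in_itv /= => s01; rewrite distrC.
exact: h.
Qed.

Lemma cont01_unif f : cont01 f -> forall e : R, 0 < e -> exists2 d : R, 0 < d &
  forall s t : R, 0 <= s <= 1 -> 0 <= t <= 1 -> `|s - t| < d -> `|f s - f t| < e.
Proof.
move=> fc e e0; apply: (@cousin (fun x y => exists2 d : R, 0 < d & forall s t : R,
  x <= s <= y -> 0 <= t <= 1 -> `|s - t| < d -> `|f s - f t| < e) 0 1) => //.
- move=> t t01; have [|d d0 h] := fc t t01 (e / 2); first by lra.
  exists (d / 2); first by lra.
  move=> x y x0 xt ty y1 yx; exists (d / 2); first by lra.
  move=> s u sxy u01 su.
  have hs : `|f s - f t| < e / 2.
    by apply: h; [lra|move: sxy => /andP[? ?]; rewrite ltr_norml; lra].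
  have hu : `|f u - f t| < e / 2.
    apply: h => //; rewrite ltr_norml; move: su sxy; rewrite ltr_norml => /andP[? ?] /andP[? ?].
    lra.
  have -> : f s - f u = (f s - f t) - (f u - f t) by rewrite opprB addrA subrK.
  by apply: le_lt_trans (ler_normB _ _) _; lra.
- move=> x y z _ xy yz _ [d1 d10 h1] [d2 d20 h2]; exists (Num.min d1 d2).
    by rewrite lt_min d10.
  move=> s t /andP[xs sz] t01; rewrite lt_min => /andP[st1 st2].
  by case: (leP s y) => sy; [apply: h1|apply: h2] => //; lra.
Qed.

Lemma cont01_away f (z : R * R) : cont01 f -> (forall t : R, 0 <= t <= 1 -> f t <> z) ->
  exists2 e : R, 0 < e & forall t : R, 0 <= t <= 1 -> e <= `|f t - z|.
Proof.
move=> fc fz; apply: (@cousin (fun x y => exists2 e : R, 0 < e & forall t : R,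
  x <= t <= y -> e <= `|f t - z|) 0 1) => //.
- move=> t t01; have ftz : 0 < `|f t - z| by rewrite normr_gt0 subr_eq0; apply/eqP/fz.
  have [|d d0 h] := fc t t01 (`|f t - z| / 2); first by lra.
  exists d => // x y x0 xt ty y1 yx; exists (`|f t - z| / 2); first by lra.
  move=> s /andP[xs sy].
  have : `|f s - f t| < `|f t - z| / 2 by apply: h; [lra|rewrite ltr_norml; lra].
  have -> : f s - f t = (f s - z) - (f t - z) by rewrite opprB addrA subrK.
  by have := lerB_dist (f t - z) (f s - z); rewrite distrC; lra.
- move=> x y w _ xy yw _ [d1 d10 h1] [d2 d20 h2]; exists (Num.min d1 d2).
    by rewrite lt_min d10.
  move=> t /andP[xt tz]; rewrite ge_min; apply/orP.
  by case: (leP t y) => ty; [left; apply: h1|right; apply: h2]; lra.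
Qed.

Lemma cont01_apart f g : cont01 f -> cont01 g ->
  (forall s t : R, 0 <= s <= 1 -> 0 <= t <= 1 -> f s <> g t) ->
  exists2 e : R, 0 < e & forall s t : R, 0 <= s <= 1 -> 0 <= t <= 1 -> e <= `|f s - g t|.
Proof.
move=> fc gc fg; apply: (@cousin (fun x y => exists2 e : R, 0 < e & forall s t : R,
  x <= s <= y -> 0 <= t <= 1 -> e <= `|f s - g t|) 0 1) => //.
- move=> t t01; have [|e e0 he] := @cont01_away g (f t) gc.
    by move=> s s01 /esym; exact: fg.
  have [|d d0 h] := fc t t01 (e / 2); first by lra.
  exists d => // x y x0 xt ty y1 yx; exists (e / 2); first by lra.
  move=> s u /andP[xs sy] u01.
  have : `|f s - f t| < e / 2 by apply: h; [lra|rewrite ltr_norml; lra].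
  have -> : f s - g u = (f s - f t) - (g u - f t) by rewrite opprB addrA subrK.
  by have := he u u01; have := lerB_dist (g u - f t) (f s - f t); rewrite distrC; lra.
- move=> x y w _ xy yw _ [d1 d10 h1] [d2 d20 h2]; exists (Num.min d1 d2).
    by rewrite lt_min d10.
  move=> s t /andP[xs sz] t01; rewrite ge_min; apply/orP.
  by case: (leP s y) => sy; [left; apply: h1|right; apply: h2] => //; lra.
Qed.

Lemma cont01_sub f (a b : R) : cont01 f -> 0 <= a <= 1 -> 0 <= b <= 1 ->
  cont01 (fun t => f (a + t * (b - a))).
Proof.
move=> fc /andP[a0 a1] /andP[b0 b1] t /andP[t0 t1] e e0.
have in01 s : 0 <= s <= 1 -> 0 <= a + s * (b - a) <= 1 by move=> /andP[s0 s1]; nra.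
have [||d d0 h] := fc (a + t * (b - a)) _ e => //; first by apply: in01; rewrite t0.
exists d => // s s01 sd; apply: h; first exact: in01.
have -> : a + s * (b - a) - (a + t * (b - a)) = (s - t) * (b - a) by ring.
rewrite normrM; apply: le_lt_trans sd; apply: ler_piMr => //.
by rewrite ler_norml; lra.
Qed.

End Interval.

Lemma xsum_telescope (a : nat -> bool) N :
  \big[addb/false]_(i < N) (a i (+) a i.+1) = a 0%N (+) a N.
Proof.
elim: N => [|N IH]; first by rewrite big_ord0 addbb.
by rewrite big_ord_recr /= IH addbA addbK.
Qed.

(** Stokes' theorem modulo 2: [h] and [v] are values on the horizontal and vertical edges of a grid,
    and every inner edge belongs to two cells. *)
Lemma xsum_grid (h v : nat -> nat -> bool) N :
  (forall i j, (i < N)%N -> (j < N)%N ->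
     h i j (+) h i j.+1 = v i j (+) v i.+1 j) ->
  \big[addb/false]_(i < N) h i 0%N (+) \big[addb/false]_(i < N) h i N
  = \big[addb/false]_(j < N) v 0%N j (+) \big[addb/false]_(j < N) v N j.
Proof.
move=> hv; rewrite -(xsum_telescope (fun j => \big[addb/false]_(i < N) h i j)).
rewrite -big_split /=; apply: eq_bigr => j _.
rewrite -big_split /= -(xsum_telescope (fun i => v i j)).
by apply: eq_bigr => i _; exact: hv.
Qed.

(** * Crossing parities with a half-axis *)

Section Crossing.
Variable R : realType.
Implicit Types u v : R * R.

(** The half-plane contains one of its two boundary rays, so that exactly one of [u] and [- u] is
    upper for nonzero [u]; this makes [lt] asymmetric. *)
Definition upper u := (0 < u.2) || (u.2 == 0) && (0 < u.1).

(* Meaningful only for [v] close to [u] compared with the distance to [0]: then it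
   tells whether the segment from [u] to [v] crosses the negative half-axis. *)
Definition cross_ray u v := (upper u (+) upper v) && (u.1 < 0).

Lemma upperN u : u != 0 -> upper (- u) = ~~ upper u.
Proof.
case: u => x y; rewrite /upper /= !oppr_gt0 oppr_eq0.
case: (ltrgtP y 0) => //= -> ; case: (ltrgtP x 0) => //= ->.
by rewrite eqxx.
Qed.

Lemma norm_ltP (z : R * R) (e : R) : (`|z| < e) = (`|z.1| < e) && (`|z.2| < e).
Proof. by rewrite prod_normE gt_max. Qed.

(** The norm of the plane is the maximum norm, so an open ball that misses 0 lies in one of four
    coordinate half-planes. *)
Lemma cell_cases u (e : R) : e <= `|u| ->
  [\/ forall v, `|v - u| < e -> 0 < v.1, forall v, `|v - u| < e -> v.1 < 0,
      forall v, `|v - u| < e -> 0 < v.2 | forall v, `|v - u| < e -> v.2 < 0].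
Proof.
rewrite prod_normE le_max => /orP[] he.
  have [u0|u0] := leP 0 u.1; [apply: Or41|apply: Or42] => v;
    rewrite norm_ltP => /andP[]; rewrite ltr_norml /= => /andP[? ?] _; move: he.
    by rewrite ger0_norm //; lra.
  by rewrite ltr0_norm //; lra.
have [u0|u0] := leP 0 u.2; [apply: Or43|apply: Or44] => v;
  rewrite norm_ltP => /andP[_]; rewrite ltr_norml /= => /andP[? ?]; move: he.
  by rewrite ger0_norm //; lra.
by rewrite ltr0_norm //; lra.
Qed.

(** A cell away from 0 does not wind around 0: on each of the four half-planes [cross_ray] is either
    zero or the change of [upper], and both add up to zero around the cell. *)
Lemma cross_ray_cell u v1 v2 v3 (e : R) : 0 < e -> e <= `|u| ->
  `|v1 - u| < e -> `|v2 - u| < e -> `|v3 - u| < e ->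
  cross_ray u v1 (+) cross_ray v2 v3 = cross_ray u v2 (+) cross_ray v1 v3.
Proof.
move=> e0 /cell_cases C h1 h2 h3.
have h0 : `|u - u| < e by rewrite subrr normr0.
rewrite /cross_ray; case: C => C.
- have F v : `|v - u| < e -> (v.1 < 0) = false by move=> /C; case: ltrgtP.
  by rewrite !F // !andbF.
- rewrite !C // !andbT.
  by case: (upper u); case: (upper v1); case: (upper v2); case: (upper v3).
- have F v : `|v - u| < e -> upper v by move=> /C; rewrite /upper => ->.
  by rewrite !F.
- have F v : `|v - u| < e -> upper v = false.
    by move=> /C; rewrite /upper; case: ltrgtP.
  by rewrite !F.
Qed.

(** The point reflection exchanges the two half-axes, and the crossings of both together are the
    changes of [upper]. *)
Lemma cross_rayN u v (e : R) : 0 < e -> e <= `|u| -> `|v - u| < e ->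
  cross_ray (- u) (- v) = cross_ray u v (+) (upper u (+) upper v).
Proof.
move=> e0 eu vu.
have u0 : u != 0 by rewrite -normr_gt0; lra.
have v0 : v != 0.
  apply: contraTneq vu => ->; rewrite sub0r normrN -leNgt //.
rewrite /cross_ray !upperN //= oppr_lt0.
have uu : `|u - u| < e by rewrite subrr normr0.
have [C|C|C|C] := cell_cases eu.
- rewrite (C u uu) andbT; have -> : u.1 < 0 = false by have := C u uu; case: ltrgtP.
  by rewrite andbF; case: (upper u); case: (upper v).
- rewrite (C u uu) andbT; have -> : 0 < u.1 = false by have := C u uu; case: ltrgtP.
  by rewrite andbF; case: (upper u); case: (upper v).
- by rewrite /upper (C u uu) (C v vu).
- have F w : `|w - u| < e -> upper w = false by move=> /C; rewrite /upper; case: ltrgtP.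
  by rewrite !F.
Qed.

(* The equation of the van Kampen obstruction comes from the map
   (s, t) |-> f_ab s - f_cd t, which omits 0 on the unit square. *)
Lemma drawing_vK_planar (V : finType) (e : rel V) (pos : V -> R * R)
    (f : V -> V -> R -> R * R) :
  injective pos ->
  (forall a b, e a b -> [/\ cont01 (f a b), f a b 0 = pos a & f a b 1 = pos b]) ->
  (forall a b c d, e a b -> e c d -> uniq [:: a; b; c; d] ->
     forall s t : R, 0 <= s <= 1 -> 0 <= t <= 1 -> f a b s <> f c d t) ->
  vK_planar (fun a c => upper (pos c - pos a)) e [set: V]%SET.
Proof.
move=> pos_inj fP fD.
pose good (q : V * V * V * V) (d0 : R) := let: (a, b, c, d) := q in
  e a b -> e c d -> uniq [:: a; b; c; d] ->
  exists2 E : R, 0 < E & forall s s' t t' : R, 0 <= s <= 1 -> 0 <= s' <= 1 ->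
    0 <= t <= 1 -> 0 <= t' <= 1 -> `|s' - s| <= d0 -> `|t' - t| <= d0 ->
    E <= `|f a b s - f c d t| /\
    `|(f a b s' - f c d t') - (f a b s - f c d t)| < E.
have [d0 d00 dP] : exists2 d0 : R, 0 < d0 & forall q (d : R), 0 < d -> d <= d0 -> good q d.
  apply: fin_eps => -[[[a b] c] d].
  have [[eab [ecd u]]|no] := pselect (e a b /\ e c d /\ uniq [:: a; b; c; d]); last first.
    by exists 1 => // ? _ _ ? ? ?; case: no.
  have [fab _ _] := fP a b eab; have [fcd _ _] := fP c d ecd.
  have [E E0 hE] := cont01_apart fab fcd (fD a b c d eab ecd u).
  have [|d1 d10 h1] := cont01_unif fab (e := E / 2); first by lra.
  have [|d2 d20 h2] := cont01_unif fcd (e := E / 2); first by lra.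
  exists (Num.min d1 d2 / 2) => [|d' d'0]; first by rewrite divr_gt0 // lt_min d10.
  move=> le_d' _ _ _; exists E => // s s' t t' s0 s1 t0 t1 ss tt.
  have m1 : Num.min d1 d2 <= d1 by rewrite ge_min lexx.
  have m2 : Num.min d1 d2 <= d2 by rewrite ge_min lexx orbT.
  split; first exact: hE.
  have -> : f a b s' - f c d t' - (f a b s - f c d t)
     = (f a b s' - f a b s) - (f c d t' - f c d t).
    by rewrite !opprB addrACA [RHS]addrACA; congr (_ + _); rewrite addrC.
  apply: le_lt_trans (ler_normB _ _) _.
  have : `|f a b s' - f a b s| < E / 2 by apply: h1 => //; lra.
  have : `|f c d t' - f c d t| < E / 2 by apply: h2 => //; lra.
  lra.
(* One number of subdivisions for all pairs of edges is necessary, because [w a b c] may depend on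
   one edge and one vertex only. *)
pose N := (Num.truncn d0^-1).+1.
have N0 : 0 < N%:R :> R by rewrite ltr0n.
have Nd : N%:R^-1 <= d0.
  rewrite -[leRHS]invrK lef_pV2 ?posrE ?invr_gt0 //.
  by apply/ltW; rewrite /N; apply: truncnS_gt.
pose tt (i : nat) : R := i%:R / N%:R.
have tt0 : tt 0%N = 0 by rewrite /tt mul0r.
have ttN : tt N = 1 by rewrite /tt divff // gt_eqF.
have tt01 i : (i <= N)%N -> 0 <= tt i <= 1.
  move=> iN; rewrite /tt divr_ge0 ?ler0n //= ler_pdivrMr // mul1r ler_nat //.
have ttS i : `|tt i.+1 - tt i| <= d0.
  rewrite /tt -mulrBl -natrB // subSnn mul1r ger0_norm //.
have tti i : `|tt i - tt i| <= d0 by rewrite subrr normr0 ltW.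
exists (fun a b c => \big[addb/false]_(i < N)
   cross_ray (f a b (tt i) - pos c) (f a b (tt i.+1) - pos c)).
move=> a b c d _ _ _ _ u eab ecd.
have [_ fa fb] := fP a b eab; have [_ gc gd] := fP c d ecd.
have [E E0 hE] := dP (a, b, c, d) d0 d00 (lexx _) eab ecd u.
pose U i j := f a b (tt i) - f c d (tt j).
have -> : \big[addb/false]_(i < N) cross_ray (f a b (tt i) - pos c) (f a b (tt i.+1) - pos c)
   = \big[addb/false]_(i < N) cross_ray (U i 0%N) (U i.+1 0%N).
  by apply: eq_bigr => i _; rewrite /U tt0 gc.
have -> : \big[addb/false]_(i < N) cross_ray (f a b (tt i) - pos d) (f a b (tt i.+1) - pos d)
   = \big[addb/false]_(i < N) cross_ray (U i N) (U i.+1 N).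
  by apply: eq_bigr => i _; rewrite /U ttN gd.
rewrite (@xsum_grid (fun i j => cross_ray (U i j) (U i.+1 j))
  (fun i j => cross_ray (U i j) (U i j.+1))); last first.
  move=> i j iN jN; have H := hE (tt i) _ (tt j) _ (tt01 _ (ltnW iN)) _ (tt01 _ (ltnW jN)) _.
  apply: (@cross_ray_cell _ _ _ _ E) => //.
  - by have [] := H _ _ (tt01 _ (ltnW iN)) (tt01 _ (ltnW jN)) (tti i) (tti j).
  - by have [] := H _ _ (tt01 _ iN) (tt01 _ (ltnW jN)) (ttS i) (tti j).
  - by have [] := H _ _ (tt01 _ (ltnW iN)) (tt01 _ jN) (tti i) (ttS j).
  - by have [] := H _ _ (tt01 _ iN) (tt01 _ jN) (ttS i) (ttS j).
(* On the sides [s = 0] and [s = 1] the map is the negative of the path counted by [w c d x];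
   [cross_rayN] and telescoping turn the difference into the [lt] terms. *)
have side i x : (i <= N)%N -> f a b (tt i) = pos x ->
    \big[addb/false]_(j < N) cross_ray (U i j) (U i j.+1)
    = \big[addb/false]_(j < N) cross_ray (f c d (tt j) - pos x) (f c d (tt j.+1) - pos x)
      (+) (upper (pos c - pos x) (+) upper (pos d - pos x)).
  move=> iN fx; rewrite -gc -gd -[in upper (f c d 0 - _)]tt0 -[in upper (f c d 1 - _)]ttN.
  rewrite -(xsum_telescope (fun j => upper (f c d (tt j) - pos x))) -big_split /=.
  apply: eq_bigr => j _; rewrite /U fx.
  have H := hE (tt i) (tt i) (tt j) (tt j.+1) (tt01 _ iN) (tt01 _ iN)
    (tt01 _ (ltnW (ltn_ord j))) (tt01 _ (ltn_ord j)) (tti i) (ttS j).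
  rewrite -[pos x - _]opprB -[pos x - f c d (tt j.+1)]opprB.
  apply: (@cross_rayN _ _ E) => //; rewrite -fx.
    by rewrite -normrN opprB; exact: H.1.
  have -> : f c d (tt j.+1) - f a b (tt i) - (f c d (tt j) - f a b (tt i))
      = - (f a b (tt i) - f c d (tt j.+1) - (f a b (tt i) - f c d (tt j))).
    by rewrite !opprB [RHS]addrC.
  by rewrite normrN; exact: H.2.
rewrite (side 0%N a) ?(side N b) ?tt0 ?ttN //.
set A := \big[_/_]_(_ < _) _; set B := \big[_/_]_(_ < _) _.
by case: A; case: B; case: (upper (pos c - pos a)); case: (upper (pos d - pos a));
   case: (upper (pos c - pos b)); case: (upper (pos d - pos b)).
Qed.
End Crossing.

(** * Polygonal arcs *)

Section PL.
Variable R : realType.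
Local Notation pt := (R * R)%type.
Implicit Types (f g : R -> pt) (p q y z a b : pt) (X K : set pt).

Lemma scaleE (h : R) a : h *: a = (h * a.1, h * a.2). Proof. by []. Qed.
Lemma addE a b : a + b = (a.1 + b.1, a.2 + b.2). Proof. by []. Qed.
Lemma oppE a : - a = (- a.1, - a.2). Proof. by []. Qed.

Definition seg p q (t : R) : pt := p + t *: (q - p).

Lemma segE p q t : seg p q t = (p.1 + t * (q.1 - p.1), p.2 + t * (q.2 - p.2)).
Proof. by []. Qed.

Lemma seg0 p q : seg p q 0 = p.
Proof. by rewrite /seg scale0r addr0. Qed.

Lemma seg1 p q : seg p q 1 = q.
Proof. by rewrite /seg scale1r addrC subrK. Qed.

Lemma seg_seg p q (s t : R) : seg p (seg p q s) t = seg p q (t * s).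
Proof. by rewrite !segE /=; congr (_, _); ring. Qed.

Lemma segC p q (t : R) : seg p q t = seg q p (1 - t).
Proof. by rewrite !segE; congr (_, _); ring. Qed.

Lemma seg_add y p q t : seg (y + p) (y + q) t = y + seg p q t.
Proof. by rewrite !segE !addE /=; congr (_, _); ring. Qed.

Lemma seg_ball p q y (r : R) (t : R) : `|p - y| < r -> `|q - y| < r ->
  0 <= t <= 1 -> `|seg p q t - y| < r.
Proof.
move=> pr qr /andP[t0 t1].
have -> : seg p q t - y = (1 - t) *: (p - y) + t *: (q - y).
  by rewrite segE !scaleE !addE !oppE /=; congr (_, _); ring.
apply: le_lt_trans (ler_normD _ _) _; rewrite !normrZ !ger0_norm ?subr_ge0 //.
have mr : Num.max `|p - y| `|q - y| < r by rewrite gt_max pr.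
have pm : `|p - y| <= Num.max `|p - y| `|q - y| by rewrite le_max lexx.
have qm : `|q - y| <= Num.max `|p - y| `|q - y| by rewrite le_max lexx orbT.
apply: le_lt_trans mr; nra.
Qed.

Definition inj01 f := forall s t : R, 0 <= s <= 1 -> 0 <= t <= 1 -> f s = f t -> s = t.

(** Piecewise linear without a list of breakpoints: [a] is the forward and [b] the backward
    direction at [t]. *)
Definition loclin f := forall t : R, 0 <= t <= 1 -> exists2 d : R, 0 < d &
  exists a b : pt, forall h : R, 0 <= h -> h <= d ->
    (t + h <= 1 -> f (t + h) = f t + h *: a) /\
    (0 <= t - h -> f (t - h) = f t + h *: b).

Definition trace f : set pt := [set z | exists2 t : R, 0 <= t <= 1 & z = f t].

Lemma traceT f t : 0 <= t <= 1 -> trace f (f t).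
Proof. by exists t. Qed.

Lemma loclin_cont f : loclin f -> cont01 f.
Proof.
move=> fl t t01 e e0; have [d d0 [a [b ab]]] := fl t t01.
pose M := `|a| + `|b| + 1.
have M0 : 0 < M by rewrite /M; have := normr_ge0 a; have := normr_ge0 b; lra.
exists (Num.min d (e / M)); first by rewrite lt_min d0 divr_gt0.
move=> s s01; rewrite lt_min => /andP[sd]; rewrite ltr_pdivlMr // => sM.
have aux (c : pt) : `|c| <= M -> `|f s - f t| <= `|s - t| * `|c| -> `|f s - f t| < e.
  move=> cM le; apply: le_lt_trans le _; apply: le_lt_trans sM.
  by rewrite ler_wpM2l.
have [st|st] := leP t s.
  have [+ _] := ab (s - t) ltac:(lra) ltac:(by move: sd; rewrite ger0_norm; lra).
  rewrite addrC subrK => /(_ ltac:(lra)) E; apply: (aux a).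
    by rewrite /M; have := normr_ge0 b; lra.
  by rewrite E addrC addKr normrZ.
have [_ +] := ab (t - s) ltac:(lra) ltac:(by move: sd; rewrite ltr0_norm; lra).
have -> : t - (t - s) = s by ring.
move=> /(_ ltac:(lra)) E; apply: (aux b).
  by rewrite /M; have := normr_ge0 a; lra.
by rewrite E addrC addKr normrZ distrC.
Qed.

Lemma seg_loclin p q : loclin (seg p q).
Proof.
move=> t _; exists 1 => //; exists (q - p), (p - q) => h h0 _.
by split=> _; rewrite !segE !scaleE !addE !oppE /=; congr (_, _); ring.
Qed.

Lemma seg_inj p q : p <> q -> inj01 (seg p q).
Proof.
move=> pq s t _ _; rewrite !segE => -[e1 e2]; apply/eqP; rewrite -subr_eq0.
apply: contra_notT pq => st; case: p q e1 e2 => [p1 p2] [q1 q2] /= e1 e2.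
have k (x : R) : (s - t) * x = 0 -> x = 0.
  by move/eqP; rewrite mulf_eq0 (negbTE st) => /eqP.
by congr (_, _); apply/esym/eqP; rewrite -subr_eq0; apply/eqP/k; lra.
Qed.

Lemma in01_affine (a b t : R) : 0 <= a <= 1 -> 0 <= b <= 1 -> 0 <= t <= 1 ->
  0 <= a + t * (b - a) <= 1.
Proof. by move=> /andP[a0 a1] /andP[b0 b1] /andP[t0 t1]; nra. Qed.

Lemma loclin_sub f (u v : R) : loclin f -> 0 <= u <= 1 -> 0 <= v <= 1 ->
  loclin (fun t => f (u + t * (v - u))).
Proof.
move=> fl u01 v01 t t01.
have [d d0 [a [b ab]]] := fl _ (in01_affine u01 v01 t01).
have [uv|vu|->] := ltrgtP u v.
- have c0 : 0 < v - u by lra.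
  exists (d / (v - u)); first by rewrite divr_gt0.
  exists ((v - u) *: a), ((v - u) *: b) => h h0; rewrite ler_pdivlMr // => hd.
  have [h1 h2] := ab (h * (v - u)) ltac:(nra) hd; rewrite !scalerA.
  split=> th.
    have -> : u + (t + h) * (v - u) = u + t * (v - u) + h * (v - u) by ring.
    by apply: h1; nra.
  have -> : u + (t - h) * (v - u) = u + t * (v - u) - h * (v - u) by ring.
  by apply: h2; nra.
- have c0 : 0 < u - v by lra.
  exists (d / (u - v)); first by rewrite divr_gt0.
  exists ((u - v) *: b), ((u - v) *: a) => h h0; rewrite ler_pdivlMr // => hd.
  have [h1 h2] := ab (h * (u - v)) ltac:(nra) hd; rewrite !scalerA.
  split=> th.
    have -> : u + (t + h) * (v - u) = u + t * (v - u) - h * (u - v) by ring.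
    by apply: h2; nra.
  have -> : u + (t - h) * (v - u) = u + t * (v - u) + h * (u - v) by ring.
  by apply: h1; nra.
- exists 1 => //; exists 0, 0 => h h0 _; rewrite subrr !mulr0 !scaler0 !addr0.
  by split.
Qed.

Lemma inj01_sub f (u v : R) : inj01 f -> 0 <= u <= 1 -> 0 <= v <= 1 -> u != v ->
  inj01 (fun t => f (u + t * (v - u))).
Proof.
move=> fi u01 v01 uv s t s01 t01 /fi - /(_ (in01_affine u01 v01 s01)
  (in01_affine u01 v01 t01)) E.
have : (s - t) * (v - u) = 0 by lra.
by move/eqP; rewrite mulf_eq0 !subr_eq0 [v == u]eq_sym (negbTE uv) orbF => /eqP.
Qed.

Lemma trace_sub f (u v : R) : 0 <= u <= 1 -> 0 <= v <= 1 ->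
  trace (fun t => f (u + t * (v - u))) `<=` trace f.
Proof.
by move=> u01 v01 _ [t t01 ->]; apply: traceT; exact: in01_affine.
Qed.

Definition acat f g (t : R) : pt := if t <= 1 / 2 then f (2 * t) else g (2 * t - 1).

Lemma acat0 f g : acat f g 0 = f 0.
Proof. by rewrite /acat divr_ge0 // mulr0. Qed.

Lemma acat1 f g : acat f g 1 = g 1.
Proof. by rewrite /acat ifF; [congr g; ring|apply/negbTE; rewrite -ltNge; lra]. Qed.

Lemma trace_acat f g : f 1 = g 0 -> trace (acat f g) = trace f `|` trace g.
Proof.
move=> fg; apply/seteqP; split=> z.
  case=> t /andP[t0 t1] ->; rewrite /acat; case: leP => ht.
    by left; apply: traceT; lra.
  by right; apply: traceT; lra.
case=> -[t /andP[t0 t1] ->].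
  exists (t / 2); first by lra.
  by rewrite /acat ifT; [congr f; field|lra].
have [->|tn0] := eqVneq t 0.
  by exists (1 / 2); [lra|rewrite /acat lexx -fg; congr f; field].
have tp : 0 < t by rewrite lt_neqAle eq_sym tn0.
exists ((1 + t) / 2); first by lra.
by rewrite /acat ifF; [congr g; field|apply/negbTE; rewrite -ltNge; lra].
Qed.

Lemma inj01_acat f g : inj01 f -> inj01 g -> f 1 = g 0 ->
  (forall z, trace f z -> trace g z -> z = f 1) -> inj01 (acat f g).
Proof.
move=> fi gi fg fgI s t /andP[s0 s1] /andP[t0 t1]; rewrite /acat.
have mix (x y : R) : 0 <= x <= 1 / 2 -> 1 / 2 < y <= 1 -> f (2 * x) = g (2 * y - 1) -> False.
  move=> /andP[x0 x1] /andP[y0 y1] E.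
  have E1 : f (2 * x) = f 1.
    by apply: fgI; [apply: traceT; lra|rewrite E; apply: traceT; lra].
  have E2 : 2 * y - 1 = 0 by apply: gi; [lra|lra|rewrite -fg -E1 E].
  suff : (1 : R) < 0 by rewrite ltr10.
  by lra.
case: (leP s (1 / 2)) => hs; case: (leP t (1 / 2)) => ht E.
- have E2 : 2 * s = 2 * t by apply: fi E; lra.
  by lra.
- by exfalso; apply: mix E; lra.
- by exfalso; apply: mix (esym E); lra.
- have E2 : 2 * s - 1 = 2 * t - 1 by apply: gi E; lra.
  by lra.
Qed.

Lemma loclin_acat f g : loclin f -> loclin g -> f 1 = g 0 -> loclin (acat f g).
Proof.
move=> fl gl fg t /andP[t0 t1].
have [ht|ht|ht] := ltrgtP t (1 / 2).
- have [|d d0 [a [b ab]]] := fl (2 * t); first by lra.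
  exists (Num.min (d / 2) (1 / 2 - t)); first by rewrite lt_min; lra.
  exists (2 *: a), (2 *: b) => h h0; rewrite le_min => /andP[hd ht'].
  have [h1 h2] := ab (2 * h) ltac:(lra) ltac:(lra).
  have E x : x <= 1 / 2 -> acat f g x = f (2 * x) by rewrite /acat => ->.
  rewrite !scalerA [h * 2]mulrC (E t (ltW ht)).
  split=> ?; (rewrite E; last by lra).
    by rewrite mulrDr; apply: h1; lra.
  by rewrite mulrBr; apply: h2; lra.
- have [|d d0 [a [b ab]]] := gl (2 * t - 1); first by lra.
  exists (Num.min (d / 2) (t - 1 / 2)); first by rewrite lt_min; lra.
  exists (2 *: a), (2 *: b) => h h0; rewrite le_min => /andP[hd ht'].
  have [h1 h2] := ab (2 * h) ltac:(lra) ltac:(lra).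
  have E x : 1 / 2 <= x -> acat f g x = g (2 * x - 1).
    move=> hx; rewrite /acat; case: leP => // xh.
    have -> : x = 1 / 2 by lra.
    have -> : 2 * (1 / 2) = 1 :> R by field.
    by rewrite subrr.
  rewrite !scalerA [h * 2]mulrC (E t (ltW ht)).
  split=> ?; (rewrite E; last by lra).
    by rewrite (_ : _ - 1 = 2 * t - 1 + 2 * h); [apply: h1; lra|ring].
  by rewrite (_ : _ - 1 = 2 * t - 1 - 2 * h); [apply: h2; lra|ring].
- have [|d d0 [a [b ab]]] := fl 1; first by lra.
  have [|d' d'0 [a' [b' ab']]] := gl 0; first by lra.
  exists (Num.min (Num.min (d / 2) (d' / 2)) (1 / 2)); first by rewrite !lt_min; lra.
  exists (2 *: a'), (2 *: b) => h h0; rewrite !le_min => /andP[/andP[hd hd'] hh].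
  have [_ h2] := ab (2 * h) ltac:(lra) ltac:(lra).
  have [h1 _] := ab' (2 * h) ltac:(lra) ltac:(lra).
  have E1 : acat f g t = f 1 by rewrite /acat ht lexx; congr f; field.
  rewrite E1 !scalerA [h * 2]mulrC; split=> _.
    have [->|hn0] := eqVneq h 0; first by rewrite addr0 mulr0 scale0r addr0.
    have hp : 0 < h by rewrite lt_neqAle eq_sym hn0.
    rewrite /acat ifF; last by apply/negbTE; rewrite -ltNge; lra.
    rewrite fg -h1 ?add0r; last by lra.
    by congr g; rewrite ht; field.
  rewrite /acat ifT; last by lra.
  rewrite -h2; last by lra.
  by congr f; rewrite ht; field.
Qed.

Definition closedE K := forall z, ~ K z ->
  exists2 e : R, 0 < e & forall z', `|z' - z| < e -> ~ K z'.

Lemma trace_closedE f : cont01 f -> closedE (trace f).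
Proof.
move=> fc z nz; have [|e e0 he] := @cont01_away _ f z fc.
  by move=> t t01 E; apply: nz; exists t.
exists e => // z' z'e [t t01 E]; have := he t t01; rewrite -E; lra.
Qed.

Lemma first_hit g K : cont01 g -> closedE K -> K (g 1) ->
  exists s : R, [/\ 0 <= s <= 1, K (g s) & forall t, 0 <= t < s -> ~ K (g t)].
Proof.
move=> gc Kc K1.
have [//|no] := pselect (exists s : R, [/\ 0 <= s <= 1, K (g s) &
  forall t, 0 <= t < s -> ~ K (g t)]).
exfalso.
suff : (forall t : R, 0 <= t <= 0 -> ~ K (g t)) -> forall t : R, 0 <= t <= 1 -> ~ K (g t).
  move=> /(_ _ 1); rewrite ler01 lexx; apply=> // t t0 Kt; apply: no.
  have t00 : t = 0 by lra.
  by exists t; rewrite t00 in Kt *; split=> //; [rewrite lexx ler01|move=> u; lra].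
move=> h0.
pose Q (x y : R) := (forall t, 0 <= t <= x -> ~ K (g t)) -> forall t, 0 <= t <= y -> ~ K (g t).
apply: (@cousin _ Q 0 1 ler01) h0; last by move=> x y z _ _ _ _ h1 h2 /h1/h2.
move=> u u01; have [Ku|nKu] := pselect (K (g u)).
  have [t [/andP[t0 tu] Kt]] : exists t, 0 <= t < u /\ K (g t).
    apply: contrapT => nt; apply: no; exists u; split=> // t tu Kt.
    by apply: nt; exists t.
  exists (u - t); first by lra.
  by move=> x y x0 xu uy y1 yx hx; exfalso; apply: (hx t) Kt; lra.
have [e e0 he] := Kc _ nKu; have [d d0 hd] := gc u u01 e e0.
exists d => // x y x0 xu uy y1 yx hx t /andP[t0 ty].
have [tx|tx] := leP t x; first by apply: hx; rewrite t0.
by apply: he; apply: hd; [lra|rewrite ltr_norml; lra].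
Qed.

(** Reachability along finitely many segments inside [X]. For the complement of a drawing the
    classes of this relation are the faces. *)
Inductive pconn X : pt -> pt -> Prop :=
| pconn0 p : X p -> pconn X p p
| pconnS p q r : (forall t : R, 0 <= t <= 1 -> X (seg p q t)) -> pconn X q r ->
    pconn X p r.

Lemma pconn_in X p q : pconn X p q -> X p /\ X q.
Proof.
elim=> [//|p' q' r h _ [_ Xr]]; split=> //.
by have := h 0; rewrite seg0 lexx ler01; apply.
Qed.

Lemma pconn_trans X p q r : pconn X p q -> pconn X q r -> pconn X p r.
Proof. by elim=> // p' q' r' h _ IH /IH; exact: pconnS. Qed.

Lemma pconn1 X p q : (forall t : R, 0 <= t <= 1 -> X (seg p q t)) -> pconn X p q.
Proof.
move=> h; apply: (pconnS h); apply: pconn0.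
by have := h 1; rewrite seg1 lexx ler01; apply.
Qed.

Lemma pconn_sym X p q : pconn X p q -> pconn X q p.
Proof.
elim=> [p' Xp|p' q' r h _ IH]; first exact: pconn0.
apply: pconn_trans IH _; apply: pconn1 => t t01; rewrite segC; apply: h; lra.
Qed.

Lemma pconn_sub X X' p q : X `<=` X' -> pconn X p q -> pconn X' p q.
Proof.
move=> XX'; elim=> [p' Xp|p' q' r h _ IH]; first by apply: pconn0; exact: XX'.
by apply: pconnS IH => t /h/XX'.
Qed.

Lemma pconn_shift X X' y p q : (forall w, X w -> X' (y + w)) ->
  pconn X p q -> pconn X' (y + p) (y + q).
Proof.
move=> XX'; elim=> [p' Xp|p' q' r h _ IH]; first by apply: pconn0; exact: XX'.
by apply: pconnS IH => t /h/XX'; rewrite seg_add.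
Qed.

(** For targets on the drawing itself, which a path in the complement can approach but not reach. *)
Lemma pconn_arrive X p q : (forall t : R, 0 <= t < 1 -> X (seg p q t)) ->
  forall e : R, 0 < e -> exists2 z, `|z - q| < e & pconn X p z.
Proof.
move=> h e e0.
have M0 : 0 < `|p - q| + 1 by have := normr_ge0 (p - q); lra.
pose c : R := Num.min (1 / 2) (e / (`|p - q| + 1)).
have c0 : 0 < c by rewrite lt_min divr_gt0 // divr_gt0.
have c1 : c <= 1 / 2 by rewrite ge_min lexx.
have ce : c * (`|p - q| + 1) <= e.
  by rewrite -ler_pdivlMr // ge_min lexx orbT.
exists (seg p q (1 - c)).
  rewrite segC (_ : 1 - (1 - c) = c); last by ring.
  by rewrite /seg addrC addKr normrZ gtr0_norm //; lra.
by apply: pconn1 => t /andP[t0 t1]; rewrite seg_seg; apply: h; nra.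
Qed.

(** Loops are erased while the chain is built up from its end: a new first segment is cut where it
    first meets the arc already built, and the rest of that arc is followed. *)
Lemma pconn_plarc X p q : pconn X p q -> p <> q ->
  exists f, [/\ loclin f, inj01 f, f 0 = p, f 1 = q & trace f `<=` X].
Proof.
elim=> [//|{}p q' r h _ IH pr].
have [qr|qr] := pselect (q' = r).
  exists (seg p r); split; rewrite ?seg0 ?seg1 //; first exact: seg_loclin.
    exact: seg_inj.
  by move=> _ [t t01 ->]; rewrite -qr; exact: h.
have [f [fl fi f0 f1 fX]] := IH qr.
have [[t0 t01 E]|np] := pselect (trace f p).
  have o01 : 0 <= (1 : R) <= 1 by lra.
  have t1 : t0 != 1 by apply/eqP => t1; apply: pr; rewrite E t1.
  exists (fun t => f (t0 + t * (1 - t0))); split.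
  - exact: loclin_sub.
  - exact: inj01_sub.
  - by rewrite mul0r addr0.
  - by rewrite mul1r addrC subrK.
  - by move=> z /(trace_sub t01 o01)/fX.
have [|s [s01 [u u01 E] hs]] := @first_hit (seg p q') (trace f)
    (loclin_cont (seg_loclin _ _)) (trace_closedE (loclin_cont fl)).
  by rewrite seg1 -f0; apply: traceT; lra.
have segX (t : R) : 0 <= t <= 1 -> X (seg p (seg p q' s) t).
  move=> /andP[? ?]; rewrite seg_seg; apply: h; move: s01 => /andP[? ?]; nra.
have py : p <> seg p q' s by move=> py; apply: np; rewrite py E; apply: traceT.
(* If the segment first meets the arc at [r], nothing of the arc remains; gluing a constant piece
   would destroy injectivity. *)
have [u1|u1] := eqVneq u 1.
  have yr : seg p q' s = r by rewrite E u1.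
  exists (seg p r); split; rewrite ?seg0 ?seg1 //; first exact: seg_loclin.
    exact: seg_inj.
  by move=> _ [t t01 ->]; rewrite -yr; exact: segX.
have o01 : 0 <= (1 : R) <= 1 by lra.
have g0 : seg p (seg p q' s) 1 = f (u + 0 * (1 - u)) by rewrite seg1 mul0r addr0.
exists (acat (seg p (seg p q' s)) (fun t => f (u + t * (1 - u)))); split.
- by apply: loclin_acat => //; [exact: seg_loclin|exact: loclin_sub].
- apply: inj01_acat => //; [exact: seg_inj|exact: inj01_sub|].
  move=> _ [t /andP[t0 t1] ->] /(trace_sub u01 o01); rewrite seg_seg => hit.
  have [ts|ts] := leP s (t * s).
    have [s0|s0] := eqVneq s 0; first by rewrite seg1 s0 mulr0.
    have sp : 0 < s by move: s01 => /andP[s00 _]; rewrite lt_neqAle eq_sym s0.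
    have -> : t = 1 by nra.
    by rewrite mul1r seg1.
  by exfalso; apply: (hs (t * s)) hit; move: s01 => /andP[? ?]; nra.
- by rewrite acat0 seg0.
- by rewrite acat1 mul1r addrC subrK.
- rewrite trace_acat // => z [[t t01 ->]|/(trace_sub u01 o01)/fX//].
  exact: segX.
Qed.

End PL.

(** * Rays and the local shape of a polygonal arc *)

Section Rays.
Variable R : realType.
Local Notation pt := (R * R)%type.
Implicit Types (f g : R -> pt) (p q y z a b : pt) (X K : set pt).

Lemma abs10 : (1 : R) < 0 -> False.
Proof. by rewrite ltr10. Qed.

(** The determinant; its sign tells on which side of the line through 0 and [a] the point [b]
    lies. *)
Definition dt a b : R := a.1 * b.2 - a.2 * b.1.

Lemma dt_seg a p q (t : R) : dt a (seg p q t) = (1 - t) * dt a p + t * dt a q.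
Proof. by rewrite /dt segE /=; ring. Qed.

Lemma dtZ a (h : R) b : dt a (h *: b) = h * dt a b.
Proof. by rewrite /dt scaleE /=; ring. Qed.

Lemma dtC a b : dt b a = - dt a b.
Proof. by rewrite /dt; ring. Qed.

Lemma dtaa a : dt a a = 0.
Proof. by rewrite /dt; ring. Qed.

Lemma dt0_scale a z : a <> 0 -> dt a z = 0 -> exists k : R, z = k *: a.
Proof.
case: a z => [a1 a2] [z1 z2]; rewrite /dt /= => a0 E.
have [a10|a10] := eqVneq a1 0.
  have a20 : a2 != 0 by apply: contra_not_neq a0 => ->; rewrite a10.
  exists (z2 / a2); rewrite scaleE /= a10 mulr0 divfK //; congr (_, _).
  have : a2 * z1 = 0 by rewrite a10 in E; lra.
  by move/eqP; rewrite mulf_eq0 (negbTE a20) => /eqP.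
exists (z1 / a1); rewrite scaleE /= divfK //; congr (_, _).
by apply: (mulfI a10); rewrite mulrA mulrCA divff // mulr1; lra.
Qed.

Definition off a : set pt := [set z | forall h : R, 0 <= h -> z <> h *: a].

Lemma off_dt a z : dt a z != 0 -> off a z.
Proof. by move=> d h _ E; move: d; rewrite E dtZ dtaa mulr0 eqxx. Qed.

Lemma off_scale a z (k : R) : 0 < k -> off a z -> off a (k *: z).
Proof.
move=> k0 oz h h0 E; apply: (oz (h / k)); first by rewrite divr_ge0 // ltW.
by rewrite mulrC -scalerA -E scalerA mulVf ?scale1r // gt_eqF.
Qed.

Lemma small_scale a (r : R) : 0 < r -> exists2 k : R, 0 < k & `|k *: a| < r.
Proof.
move=> r0; have M0 : 0 < `|a| + 1 by have := normr_ge0 a; lra.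
exists (r / (`|a| + 1)); first by rewrite divr_gt0.
rewrite normrZ gtr0_norm ?divr_gt0 // -mulrA gtr_pMr // mulrC ltr_pdivrMr //.
lra.
Qed.

Lemma ball_seg p q (r t : R) : `|p| < r -> `|q| < r -> 0 <= t <= 1 -> `|seg p q t| < r.
Proof. by move=> pr qr t01; have := @seg_ball _ p q 0 r t; rewrite !subr0; apply. Qed.

Lemma two_rays a b z (s r e : R) :
  (forall k : R, 0 <= k -> b <> k *: a) -> (forall k : R, 0 <= k -> a <> k *: b) ->
  off a z -> off b z -> `|z| < r -> 0 < s -> `|s *: a| < r -> 0 < e ->
  exists2 z' : pt, `|z' - s *: a| < e &
    pconn [set w : pt | [/\ `|w| < r, off a w & off b w]] z z'.
Proof.
move=> ba ab za zb zr s0 sr e0; set X := [set w : pt | _].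
have a0 : a <> 0 by have := ab 0 (lexx _); rewrite scale0r.
have b0 : b <> 0 by have := ba 0 (lexx _); rewrite scale0r.
have direct (w : pt) : `|w| < r -> (forall t : R, 0 <= t < 1 ->
    off a (seg w (s *: a) t) /\ off b (seg w (s *: a) t)) ->
    exists2 z' : pt, `|z' - s *: a| < e & pconn X w z'.
  move=> wr h; apply: pconn_arrive e0 => t t01; have [oa ob] := h t t01.
  by split=> //; apply: ball_seg => //; lra.
(* When [w] and [b] are not strictly on the same side of the line of [a], the segment to [s *: a]
   stays strictly on the side of [w] before its end and meets neither ray. *)
have case1 (w : pt) : `|w| < r -> dt a w != 0 -> dt a w * dt a b <= 0 ->
    exists2 z' : pt, `|z' - s *: a| < e & pconn X w z'.
  move=> wr w0 wb; apply: direct => // t /andP[t0 t1].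
  have w2 : 0 < dt a w * dt a w by rewrite -expr2 exprn_even_gt0.
  have T0 : dt a (seg w (s *: a) t) = (1 - t) * dt a w.
    by rewrite dt_seg dtZ dtaa !mulr0 addr0.
  split; first by apply: off_dt; rewrite T0 mulf_neq0 // subr_eq0 gt_eqF.
  move=> h h0 E; move: T0; rewrite E dtZ => T0.
  have : (1 - t) * (dt a w * dt a w) = h * (dt a w * dt a b) by transitivity ((1 - t) * dt a w * dt a w); [ring|rewrite -T0; ring].
  have : 0 < (1 - t) * (dt a w * dt a w) by rewrite mulr_gt0 ?subr_gt0.
  have : h * (dt a w * dt a b) <= 0 by rewrite mulr_ge0_le0.
  by move=> h1 h2 h3; apply: abs10; lra.
(* Here [z] is on the ray opposite to [a], and [b] is off this line. A small step in the direction
   [- b] leads to the side without [b]. *)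
have [z0|z0] := eqVneq (dt a z) 0.
  have [k zk] := dt0_scale a0 z0.
  have k0 : k < 0 by rewrite ltNge; apply/negP => k0; exact: (za k k0).
  have ab0 : dt a b != 0.
    apply/eqP => /(dt0_scale a0)[m bm].
    have m0 : m < 0 by rewrite ltNge; apply/negP => m0; exact: (ba m m0).
    apply: (zb (k / m)); first by rewrite -mulrNN -invrN divr_ge0; lra.
    by rewrite bm scalerA divfK // lt_eqF.
  have [d d0 dr] := @small_scale b (r - `|z|) ltac:(by rewrite subr_gt0).
  pose z1 := z - d *: b.
  have z1r : `|z1| < r.
    by apply: le_lt_trans (ler_normB _ _) _; lra.
  have bz : dt b z != 0 by rewrite zk dtZ dtC mulf_neq0 ?oppr_eq0 // lt_eqF.
  have E1 (t : R) : seg z z1 t = z - (t * d) *: b.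
    by rewrite segE /z1 !scaleE !addE !oppE /=; congr (_, _); ring.
  have st : pconn X z z1.
    apply: pconn1 => t t01; split; first exact: ball_seg.
      have [->|t0] := eqVneq t 0; first by rewrite seg0.
      apply: off_dt; rewrite E1.
      have -> : dt a (z - (t * d) *: b) = dt a z - t * d * dt a b.
        by rewrite /dt !scaleE !addE !oppE /=; ring.
      by rewrite z0 sub0r oppr_eq0 !mulf_neq0 // gt_eqF.
    apply: off_dt; rewrite E1.
    have -> : dt b (z - (t * d) *: b) = dt b z.
      by rewrite /dt !scaleE !addE !oppE /=; ring.
    by [].
  have az1 : dt a z1 = - (d * dt a b).
    transitivity (dt a z - d * dt a b); last by rewrite z0 sub0r.
    by rewrite /dt /z1 !scaleE !addE !oppE /=; ring.
  have [||z' z'e zz'] := case1 z1 z1r.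
  - by rewrite az1 oppr_eq0 mulf_neq0 // gt_eqF.
  - rewrite az1 mulNr oppr_le0 -mulrA mulr_ge0 // ?ltW // -expr2 exprn_even_gt0 //.
  - by exists z' => //; exact: pconn_trans st zz'.
have [le0|gt0] := leP (dt a z * dt a b) 0; first exact: case1.
have ab0 : dt a b != 0 by apply: contraTneq gt0 => ->; rewrite mulr0 ltxx.
have ba0 : dt b a != 0 by rewrite dtC oppr_eq0.
have ba2 : 0 < dt b a * dt b a by rewrite -expr2 exprn_even_gt0.
(* Now [z] and [b] are on the same side of the line of [a]. If the line of [b] separates [z] from
   [a], a detour over the ray opposite to [b] works; if it does not, the straight segment does. On
   the line of [b], the point [z] would be on the ray of [b]. *)
have [D0|D0|D0] := ltrgtP (dt b z * dt b a) 0.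
- have [d d0 dr] := @small_scale (- b) r ltac:(by apply: le_lt_trans zr).
  pose m := d *: - b.
  have Dn : dt b z != 0 by apply: contraTneq D0 => ->; rewrite mul0r ltxx.
  have bm : dt b m = 0 by rewrite /m scalerN -scaleNr dtZ dtaa mulr0.
  have am : dt a m = - (d * dt a b) by rewrite /m scalerN -scaleNr dtZ mulNr.
  have ombm : off b m.
    move=> h h0; rewrite /m scalerN -scaleNr => /eqP.
    rewrite -subr_eq0 -scalerBl scaler_eq0 => /orP[|/eqP//].
    by move/eqP => E; apply: abs10; lra.
  have st : pconn X z m.
    apply: pconn1 => t t01; split; first exact: ball_seg.
      have [->|t1] := eqVneq t 1.
        by rewrite seg1; apply: off_dt; rewrite am oppr_eq0 mulf_neq0 // gt_eqF.
      move=> h h0 E; have := congr1 (dt b) E; rewrite dt_seg bm mulr0 addr0 dtZ => E2.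
      have t1' : t < 1 by rewrite lt_neqAle t1; lra.
      have : (1 - t) * (dt b z * dt b a) = h * (dt b a * dt b a) by transitivity ((1 - t) * dt b z * dt b a); [ring|rewrite E2; ring].
      have : 0 <= h * (dt b a * dt b a) by rewrite mulr_ge0 // ltW.
      have : (1 - t) * (dt b z * dt b a) < 0 by rewrite pmulr_rlt0 // subr_gt0.
      by move=> h1 h2 h3; apply: abs10; lra.
    have [->|t1] := eqVneq t 1; first by rewrite seg1.
    apply: off_dt; rewrite dt_seg bm mulr0 addr0 mulf_neq0 // subr_eq0 eq_sym //.
  have [|z' z'e zz'] := direct m dr; last by exists z' => //; exact: pconn_trans st zz'.
  move=> t /andP[t0 t1]; split.
    apply: off_dt; rewrite dt_seg dtZ dtaa !mulr0 addr0 am mulf_neq0 //.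
      by rewrite subr_eq0 gt_eqF.
    by rewrite oppr_eq0 mulf_neq0 // gt_eqF.
  have [->|tn0] := eqVneq t 0; first by rewrite seg0.
  apply: off_dt; rewrite dt_seg bm mulr0 add0r dtZ !mulf_neq0 //.
  by rewrite gt_eqF.
- apply: direct => // t /andP[t0 t1]; split.
    apply: off_dt; rewrite dt_seg dtZ dtaa !mulr0 addr0 mulf_neq0 //.
    by rewrite subr_eq0 gt_eqF.
  apply: off_dt; rewrite dt_seg dtZ; apply/eqP => E.
  have : (1 - t) * (dt b z * dt b a) + t * (s * (dt b a * dt b a)) = 0.
    by rewrite -[RHS](mul0r (dt b a)) -E; ring.
  have : 0 <= t * (s * (dt b a * dt b a)) by apply: mulr_ge0 => //; apply: mulr_ge0; exact: ltW.
  have : 0 < (1 - t) * (dt b z * dt b a) by rewrite mulr_gt0 // subr_gt0.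
  by move=> h1 h2 h3; apply: abs10; lra.
- exfalso; move/eqP: D0; rewrite mulf_eq0 (negbTE ba0) orbF => /eqP D0.
  have [k zk] := dt0_scale b0 D0; apply: (zb k) => //.
  have : 0 < k * (dt a b * dt a b) by move: gt0; rewrite zk dtZ mulrA.
  by rewrite pmulr_lgt0 => [/ltW//|]; rewrite -expr2 exprn_even_gt0.
Qed.

Lemma perp_dt a : a <> 0 -> dt a (- a.2, a.1) != 0.
Proof.
move=> a0; rewrite /dt /=; apply/eqP => E; apply: a0; case: a E => [x y] /= E.
have x0 : x = 0 by nra.
have y0 : y = 0 by nra.
by rewrite x0 y0.
Qed.

(** Follows from the case of two rays: an auxiliary ray that misses [z] only restricts the paths
    further. *)
Lemma one_ray a z (s r e : R) : a <> 0 ->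
  off a z -> `|z| < r -> 0 < s -> `|s *: a| < r -> 0 < e ->
  exists2 z' : pt, `|z' - s *: a| < e & pconn [set w : pt | `|w| < r /\ off a w] z z'.
Proof.
move=> a0 za zr s0 sr e0.
suff [b [ba ab zb]] : exists b, [/\ forall k : R, 0 <= k -> b <> k *: a,
    forall k : R, 0 <= k -> a <> k *: b & off b z].
  have [z' z'e zz'] := two_rays ba ab za zb zr s0 sr e0; exists z' => //.
  by apply: pconn_sub zz' => w [].
have [z0|z0] := eqVneq (dt a z) 0; last first.
  exists (- a); split=> [k k0 E|k k0 E|h h0 E].
  - have : (1 + k) *: a = 0 by rewrite scalerDl scale1r -E subrr.
    by move/eqP; rewrite scaler_eq0 => /orP[/eqP k1|/eqP//]; apply: abs10; lra.
  - have : (1 + k) *: a = 0 by rewrite scalerDl scale1r {1}E scalerN addrC subrr.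
    by move/eqP; rewrite scaler_eq0 => /orP[/eqP k1|/eqP//]; apply: abs10; lra.
  - by move: z0; rewrite E scalerN -scaleNr dtZ dtaa mulr0 eqxx.
have pa := perp_dt a0; exists (- a.2, a.1); split=> [k k0 E|k k0 E|].
- by move: pa; rewrite E dtZ dtaa mulr0 eqxx.
- have E0 : dt (- a.2, a.1) a = 0.
    by apply: etrans (congr1 (dt _) E) _; rewrite dtZ dtaa mulr0.
  by move: pa; rewrite dtC E0 oppr0 eqxx.
have [k zk] := dt0_scale a0 z0; have [k0|k0] := eqVneq k 0.
  by exfalso; apply: (za 0) => //; rewrite zk k0.
by apply: off_dt; rewrite zk dtZ mulf_neq0 // dtC oppr_eq0.
Qed.

(** A ball without one ray from its centre is star-shaped with respect to the points of the opposite
    ray. *)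
Lemma one_ray_connected a z z' (r : R) : a <> 0 ->
  off a z -> `|z| < r -> off a z' -> `|z'| < r ->
  pconn [set w : pt | `|w| < r /\ off a w] z z'.
Proof.
move=> a0 oz zr oz' z'r.
have [d d0 dr] := @small_scale (- a) r ltac:(by apply: le_lt_trans zr).
have go (w : pt) : off a w -> `|w| < r -> pconn [set w : pt | `|w| < r /\ off a w] w (d *: - a).
  move=> ow wr; apply: pconn1 => t t01; split; first exact: ball_seg.
  move=> h h0 E.
  have E2 : (1 - t) *: w = (h + t * d) *: a.
    rewrite [RHS]scalerDl -E segE !scaleE !addE !oppE /=; congr (_, _); ring.
  have [t1|t1] := eqVneq t 1.
    move/esym/eqP: E2; rewrite t1 subrr scale0r mul1r scaler_eq0 => /orP[/eqP|/eqP//].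
    by move=> E3; apply: abs10; lra.
  have t1' : 0 < 1 - t by rewrite subr_gt0 lt_neqAle t1; lra.
  apply: (ow ((1 - t)^-1 * (h + t * d))).
    have td : 0 <= t * d by apply: mulr_ge0; lra.
    by apply: mulr_ge0; [rewrite invr_ge0 ltW|lra].
  by rewrite -scalerA -E2 scalerA mulVf ?scale1r // gt_eqF.
by apply: pconn_trans (go z oz zr) _; apply: pconn_sym; exact: go.
Qed.

Lemma off_two a b : a <> 0 -> (forall k : R, 0 <= k -> b <> k *: a) ->
  exists w, off a w /\ off b w.
Proof.
move=> a0 ba; have b0 : b <> 0 by have := ba 0 (lexx _); rewrite scale0r.
have [ab|ab] := eqVneq (dt a b) 0.
  have [k bk] := dt0_scale a0 ab; have pa := perp_dt a0.
  exists (- a.2, a.1); split; apply: off_dt => //.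
  have -> : dt b (- a.2, a.1) = k * dt a (- a.2, a.1).
    by rewrite bk /dt scaleE /=; ring.
  by rewrite mulf_neq0 //; apply: contra_not_neq b0 => k0; rewrite bk k0 scale0r.
exists (- (a + b)); split; apply: off_dt.
  suff -> : dt a (- (a + b)) = - dt a b by rewrite oppr_eq0.
  by rewrite /dt addE oppE /=; ring.
suff -> : dt b (- (a + b)) = dt a b by [].
by rewrite /dt addE oppE /=; ring.
Qed.

Lemma away_from f (t d : R) : cont01 f -> inj01 f -> 0 <= t <= 1 -> 0 < d ->
  exists2 r : R, 0 < r & forall s : R, 0 <= s <= 1 -> d <= `|s - t| -> r <= `|f s - f t|.
Proof.
move=> fc fi /andP[t0 t1] d0.
have [r1 r10 h1] : exists2 r : R, 0 < r & forall s : R, 0 <= s <= t - d -> r <= `|f s - f t|.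
  have [td|td] := leP 0 (t - d); last first.
    by exists 1 => // s /andP[? ?]; exfalso; apply: abs10; lra.
  have o0 : 0 <= (0 : R) <= 1 by lra.
  have o1 : 0 <= t - d <= 1 by lra.
  have [|r r0 h] := cont01_away (z := f t) (cont01_sub fc o0 o1).
    move=> s s01 /fi - /(_ (in01_affine o0 o1 s01)); rewrite t0 t1 => /(_ isT).
    by move: s01 => /andP[? ?] ?; apply: abs10; nra.
  exists r => // s /andP[s0 sd].
  have [td0|td0] := eqVneq (t - d) 0.
    have := h 0; rewrite mul0r addr0 lexx ler01 => /(_ isT).
    by have -> : s = 0 by lra.
  have tdp : 0 < t - d by rewrite lt_neqAle eq_sym td0.
  have := h (s / (t - d)); rewrite subr0 add0r divfK //; apply.
  by rewrite divr_ge0 //= ler_pdivrMr // mul1r.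
have [r2 r20 h2] : exists2 r : R, 0 < r & forall s : R, t + d <= s <= 1 -> r <= `|f s - f t|.
  have [td|td] := leP (t + d) 1; last first.
    by exists 1 => // s /andP[? ?]; exfalso; apply: abs10; lra.
  have o0 : 0 <= (1 : R) <= 1 by lra.
  have o1 : 0 <= t + d <= 1 by lra.
  have [|r r0 h] := cont01_away (z := f t) (cont01_sub fc o1 o0).
    move=> s s01 /fi - /(_ (in01_affine o1 o0 s01)); rewrite t0 t1 => /(_ isT).
    by move: s01 => /andP[? ?] ?; apply: abs10; nra.
  exists r => // s /andP[s0 sd].
  have [td0|td0] := eqVneq (t + d) 1.
    have := h 0; rewrite mul0r addr0 lexx ler01 => /(_ isT).
    by have -> : s = t + d by lra.
  have tdp : 0 < 1 - (t + d) by rewrite subr_gt0 lt_neqAle td0.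
  have := h ((s - (t + d)) / (1 - (t + d))); rewrite divfK ?gt_eqF // [_ + (s - _)]addrC subrK.
  by apply; rewrite divr_ge0 ?subr_ge0 //= ?ler_pdivrMr ?mul1r //; lra.
exists (Num.min r1 r2); first by rewrite lt_min r10.
move=> s /andP[s0 s1]; rewrite ge_min ler_normr => /orP[?|?]; apply/orP.
  by right; apply: h2; lra.
by left; apply: h1; lra.
Qed.

(** For parameters within [d] of [t] the arc runs on at most two segments, and [away_from] keeps the
    rest of it at a distance. The radius [r] is shorter than these segments too, so inside the ball
    they are indistinguishable from full rays. At an end of the arc one ray is missing. *)
Lemma plarc_local f (t : R) : loclin f -> inj01 f -> 0 <= t <= 1 ->
  exists a b (r d : R), [/\ 0 < r, 0 < d,
    (t < 1 -> a <> 0) /\ (0 < t -> b <> 0) /\ (t < 1 -> 0 < t -> forall k : R, 0 <= k ->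
       b <> k *: a /\ a <> k *: b),
    (forall s : R, 0 <= s <= 1 -> `|s - t| <= d ->
       (t <= s -> f s = f t + (s - t) *: a) /\ (s <= t -> f s = f t + (t - s) *: b)) &
    forall z, `|z| < r -> (trace f (f t + z) <->
      (t < 1 /\ exists2 h : R, 0 <= h & z = h *: a) \/
      (0 < t /\ exists2 h : R, 0 <= h & z = h *: b))].
Proof.
move=> fl fi t01; have /andP[t0 t1] := t01.
have [d0 d00 [a [b ab]]] := fl t t01.
pose d := Num.min d0 (Num.min (if t < 1 then 1 - t else 1) (if 0 < t then t else 1)).
have dp : 0 < d by rewrite !lt_min d00 /=; case: ifP => [?|_]; case: ifP => [?|_]; rewrite ?subr_gt0 ?ltr01 //= ; lra.
have dd0 : d <= d0 by rewrite ge_min lexx.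
have dt1 : t < 1 -> t + d <= 1.
  move=> h; have : d <= 1 - t by rewrite /d h !ge_min lexx orbT.
  lra.
have dt0 : 0 < t -> 0 <= t - d.
  move=> h; have : d <= t by rewrite /d h !ge_min lexx !orbT.
  lra.
have loc (s : R) : 0 <= s <= 1 -> `|s - t| <= d ->
    (t <= s -> f s = f t + (s - t) *: a) /\ (s <= t -> f s = f t + (t - s) *: b).
  move=> /andP[s0 s1]; rewrite ler_norml => /andP[sd1 sd2]; split=> st.
    have [+ _] := ab (s - t) ltac:(lra) ltac:(lra).
    by rewrite addrC subrK; apply.
  have [_ +] := ab (t - s) ltac:(lra) ltac:(lra).
  by rewrite (_ : t - (t - s) = s); [apply|ring].
have fwd (h : R) : t < 1 -> 0 <= h <= d -> f (t + h) = f t + h *: a.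
  move=> /dt1 ? /andP[? ?]; have [] := loc (t + h) ltac:(lra) ltac:(rewrite ler_norml; lra).
  by move=> + _; rewrite (_ : t + h - t = h); [apply; lra|ring].
have bwd (h : R) : 0 < t -> 0 <= h <= d -> f (t - h) = f t + h *: b.
  move=> /dt0 ? /andP[? ?]; have [] := loc (t - h) ltac:(lra) ltac:(rewrite ler_norml; lra).
  by move=> _; rewrite (_ : t - (t - h) = h); [apply; lra|ring].
have an0 : t < 1 -> a <> 0.
  move=> h a0; have /fi : f (t + d) = f t.
    by rewrite fwd ?lexx ?(ltW dp) // a0 scaler0 addr0.
  by move=> /(_ ltac:(have := dt1 h; lra) t01) E; apply: abs10; lra.
have bn0 : 0 < t -> b <> 0.
  move=> h b0; have /fi : f (t - d) = f t.
    by rewrite bwd ?lexx ?(ltW dp) // b0 scaler0 addr0.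
  by move=> /(_ ltac:(have := dt0 h; lra) t01) E; apply: abs10; lra.
(* If both rays had the same direction, [f] would take a common value on the two sides of [t]. *)
have dir (k h1 h2 : R) : t < 1 -> 0 < t -> 0 < h1 <= d -> 0 <= h2 <= d -> h1 *: b = h2 *: a -> False.
  move=> p1 p2 /andP[h10 h1d] /andP[h20 h2d] E.
  have /fi : f (t - h1) = f (t + h2) by rewrite (bwd h1 p2 ltac:(lra)) (fwd h2 p1 ltac:(lra)) E.
  by move=> /(_ ltac:(have := dt0 p2; lra) ltac:(have := dt1 p1; lra)) E2; apply: abs10; lra.
have nk : t < 1 -> 0 < t -> forall k : R, 0 <= k -> b <> k *: a /\ a <> k *: b.
  move=> p1 p2 k k0; have k1 : 0 < 1 + k by lra.
  have dk : 0 < d / (1 + k) <= d.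
    have kd : 0 <= d * k by apply: mulr_ge0 => //; exact: ltW.
    by rewrite divr_gt0 //= ler_pdivrMr // mulrDr mulr1; lra.
  have dk2 : 0 <= d / (1 + k) * k <= d.
    have -> : d / (1 + k) * k = d - d / (1 + k) by field; lra.
    by lra.
  split=> E.
    by apply: (dir k (d / (1 + k)) (d / (1 + k) * k)) => //; rewrite E scalerA.
  have [k00|k00] := eqVneq k 0; first by apply: an0 => //; rewrite E k00 scale0r.
  apply: (dir k (d / (1 + k) * k) (d / (1 + k))) => //; last by rewrite [in RHS]E scalerA.
    move/andP: dk2 => [dk20 ->]; rewrite andbT lt_neqAle eq_sym dk20 andbT mulf_neq0 // gt_eqF //.
    by case/andP: dk.
  by case/andP: dk => /ltW -> ->.
have [r0 r00 far] := away_from (loclin_cont fl) fi t01 dp.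
pose r := Num.min r0 (Num.min (if t < 1 then d * `|a| else 1) (if 0 < t then d * `|b| else 1)).
have rp : 0 < r.
  rewrite !lt_min r00 /=; case: ifP => [/an0 ?|_]; case: ifP => [/bn0 ?|_];
    by rewrite ?ltr01 ?mulr_gt0 ?normr_gt0 ?andbT //; apply/eqP.
exists a, b, r, d; split=> // z zr; split=> [[s s01 E]|].
  have sd : `|s - t| < d.
    rewrite ltNge; apply/negP => /(far s s01).
    by rewrite -E addrC addKr leNgt (lt_le_trans zr) // ge_min lexx.
  have [l1 l2] := loc s s01 (ltW sd).
  have zE : z = f s - f t by rewrite -E addrC addKr.
  have [st|ts|st] := ltrgtP s t.
  - right; split; first by move: s01 => /andP[? ?]; lra.
    by exists (t - s); [lra|rewrite zE l2 ?ltW // addrC addKr].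
  - left; split; first by move: s01 => /andP[? ?]; lra.
    by exists (s - t); [lra|rewrite zE l1 ?ltW // addrC addKr].
  - have z0 : z = 0 by rewrite zE st subrr.
    have [tl|tg] := ltP t 1; first by left; split=> //; exists 0; rewrite ?scale0r.
    by right; split; [lra|exists 0; rewrite ?scale0r].
case=> -[p1 [h h0 zE]].
  exists (t + h); last by rewrite fwd ?h0 ?zE //;
    move: zr; rewrite /r p1 !lt_min zE normrZ (ger0_norm h0) => /and3P[_ + _];
    by rewrite ltr_pM2r ?normr_gt0; [move/ltW|apply/eqP/an0].
  have hd : h <= d.
    move: zr; rewrite /r p1 !lt_min zE normrZ (ger0_norm h0) => /and3P[_ + _].
    by rewrite ltr_pM2r ?normr_gt0; [move/ltW|apply/eqP/an0].
  by have := dt1 p1; lra.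
have hd : h <= d.
  move: zr; rewrite /r p1 !lt_min zE normrZ (ger0_norm h0) => /and3P[_ _].
  by rewrite ltr_pM2r ?normr_gt0; [move/ltW|apply/eqP/bn0].
exists (t - h); first by have := dt0 p1; lra.
by rewrite bwd ?h0 ?zE.
Qed.

(* Near [f t] the arc consists of one or two rays; hence every point close to
   [f t] reaches, off the arc, every nearby point of the arc. *)
Lemma plarc_reach f (t r0 : R) K : loclin f -> inj01 f -> 0 <= t <= 1 -> 0 < r0 ->
  (forall z, `|z - f t| < r0 -> (K z <-> trace f z)) ->
  exists2 r : R, 0 < r & [/\ r <= r0,
    exists2 d : R, 0 < d & forall s : R, 0 <= s <= 1 -> `|s - t| < d ->
      forall z, `|z - f t| < r -> ~ K z -> forall e : R, 0 < e ->
      exists2 z' : pt, `|z' - f s| < e & pconn (~` K) z z',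
    forall e : R, 0 < e -> exists2 z : pt, `|z - f t| < e & ~ K z &
    t = 0 \/ t = 1 -> forall z z', `|z - f t| < r -> `|z' - f t| < r ->
      ~ K z -> ~ K z' -> pconn (~` K) z z'].
Proof.
move=> fl fi t01 r00 KE.
have [a [b [r1 [d [r10 d0 [an0 [bn0 nk]] loc trE]]]]] := plarc_local fl fi t01.
have /andP[t0 t1] := t01.
pose r := Num.min r0 r1.
have rp : 0 < r by rewrite lt_min r00.
have KE' (w : pt) : `|w| < r -> (K (f t + w) <->
      (t < 1 /\ exists2 h : R, 0 <= h & w = h *: a) \/
      (0 < t /\ exists2 h : R, 0 <= h & w = h *: b)).
  rewrite lt_min => /andP[w0 w1]; rewrite KE ?trE //.
  by rewrite addrC addKr.
have offK (w : pt) : `|w| < r -> (t < 1 -> off a w) -> (0 < t -> off b w) -> ~ K (f t + w).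
  move=> wr oa ob /(KE' _ wr)[[p1 [h h0 E]]|[p1 [h h0 E]]].
    exact: (oa p1 h h0).
  exact: (ob p1 h h0).
have Koff (w : pt) : `|w| < r -> ~ K (f t + w) -> (t < 1 -> off a w) /\ (0 < t -> off b w).
  move=> wr nK; split=> p1 h h0 E; apply: nK; apply/(KE' _ wr); [left|right];
    by split=> //; exists h.
have zE z : z = f t + (z - f t) by rewrite addrC subrK.
have both (w : pt) (s : R) (c c' : pt) (e : R) : t < 1 -> 0 < t -> (c = a /\ c' = b \/ c = b /\ c' = a) ->
    `|w| < r -> ~ K (f t + w) -> 0 < s -> `|s *: c| < r -> 0 < e ->
    exists2 z' : pt, `|z' - (f t + s *: c)| < e & pconn (~` K) (f t + w) z'.
  move=> p1 p2 cc wr nK s0 sr e0; have [/(_ p1) oa /(_ p2) ob] := Koff w wr nK.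
  have cc1 (k : R) : 0 <= k -> c' <> k *: c /\ c <> k *: c'.
    by move=> k0; have [? ?] := nk p1 p2 k k0; case: cc => -[-> ->].
  have [||||z' z'e zz'] := @two_rays c c' w s r e _ _ _ _ wr s0 sr e0.
  - by move=> k /cc1[].
  - by move=> k /cc1[].
  - by case: cc => -[-> _].
  - by case: cc => -[_ ->].
  exists (f t + z'); first by rewrite opprD addrACA subrr add0r.
  apply: pconn_shift zz' => u [ur ou ou'].
  by apply: offK => // _; case: cc => -[? ?]; subst.
have single (w : pt) (s : R) (c : pt) (e : R) : c <> 0 -> (t < 1 -> off c `<=` off a) -> (0 < t -> off c `<=` off b) ->
    off c w ->
    `|w| < r -> 0 < s -> `|s *: c| < r -> 0 < e ->
    exists2 z' : pt, `|z' - (f t + s *: c)| < e & pconn (~` K) (f t + w) z'.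
  move=> c0 ca cb ow wr s0 sr e0.
  have [z' z'e zz'] := one_ray c0 ow wr s0 sr e0.
  exists (f t + z'); first by rewrite opprD addrACA subrr add0r.
  apply: pconn_shift zz' => u [ur ou]; apply: offK => // p1.
    exact: ca.
  exact: cb.
have M0 : 0 < `|a| + `|b| + 1 by have := normr_ge0 a; have := normr_ge0 b; lra.
exists r => //; split.
- by rewrite ge_min lexx.
- exists (Num.min d (r / (`|a| + `|b| + 1))); first by rewrite lt_min d0 divr_gt0.
  move=> s s01; rewrite lt_min => /andP[sd]; rewrite ltr_pdivlMr // => sM z zr nK e e0.
  have [l1 l2] := loc s s01 (ltW sd).
  have sc (c : pt) : `|c| <= `|a| + `|b| + 1 -> `|s - t| * `|c| < r.
    by move=> cM; apply: le_lt_trans sM; rewrite ler_wpM2l.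
  have saM : `|a| <= `|a| + `|b| + 1 by have := normr_ge0 b; lra.
  have sbM : `|b| <= `|a| + `|b| + 1 by have := normr_ge0 a; lra.
  rewrite (zE z) in nK *; have [st|ts|st] := ltrgtP s t.
  + have p2 : 0 < t by move: s01 => /andP[? ?]; lra.
    have ts0 : 0 < t - s by lra.
    have tsr : `|(t - s) *: b| < r by rewrite normrZ distrC sc.
    rewrite (l2 (ltW st)); have [p1|p1] := ltP t 1.
      by apply: (both (z - f t) (t - s) b a e) => //; right.
    apply: (single (z - f t) (t - s) b e) => //; first exact: bn0.
      by move=> h; exfalso; apply: abs10; lra.
      by move=> _ ?.
    by have [_ /(_ p2)] := Koff _ zr nK.
  + have p1 : t < 1 by move: s01 => /andP[? ?]; lra.
    have ts0 : 0 < s - t by lra.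
    have tsr : `|(s - t) *: a| < r by rewrite normrZ sc.
    rewrite (l1 (ltW ts)); have [p2|p2] := ltP 0 t.
      by apply: (both (z - f t) (s - t) a b e) => //; left.
    apply: (single (z - f t) (s - t) a e) => //; first exact: an0.
      by move=> _ ?.
      by move=> h; exfalso; apply: abs10; lra.
    by have [/(_ p1)] := Koff _ zr nK.
  + rewrite st; have [oa ob] := Koff _ zr nK.
    apply: pconn_arrive e0 => u u01.
    have -> : seg (f t + (z - f t)) (f t) u = f t + (1 - u) *: (z - f t).
      by rewrite segE !scaleE !addE !oppE /=; congr (_, _); ring.
    apply: offK => [|p1|p2].
    * rewrite normrZ ger0_norm; last by lra.
      by apply: le_lt_trans zr; rewrite ler_piMl //; lra.
    * by apply: off_scale; [lra|exact: oa].
    * by apply: off_scale; [lra|exact: ob].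
- move=> e e0.
  have [w [oa ob]] : exists w : pt, (t < 1 -> off a w) /\ (0 < t -> off b w).
    have [p1|p1] := ltP t 1; have [p2|p2] := ltP 0 t.
    + by have [w [? ?]] := off_two (an0 p1) (fun k k0 => (nk p1 p2 k k0).1); exists w.
    + exists (- a); split=> // _ h h0 E; apply: (an0 p1).
      have : (1 + h) *: a = 0 by rewrite scalerDl scale1r -E subrr.
      by move/eqP; rewrite scaler_eq0 => /orP[/eqP ?|/eqP//]; exfalso; apply: abs10; lra.
    + exists (- b); split=> // _ h h0 E; apply: (bn0 p2).
      have : (1 + h) *: b = 0 by rewrite scalerDl scale1r -E subrr.
      by move/eqP; rewrite scaler_eq0 => /orP[/eqP ?|/eqP//]; exfalso; apply: abs10; lra.
    + by exfalso; apply: abs10; lra.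
  have [k k0 kr] := @small_scale w (Num.min e r) ltac:(by rewrite lt_min e0).
  move: kr; rewrite lt_min => /andP[ke kr].
  exists (f t + k *: w); first by rewrite addrC addKr.
  by apply: offK => // p; apply: off_scale => //; [exact: oa|exact: ob].
- move=> tt z z' zr z'r nK nK'; rewrite (zE z) (zE z') in nK nK' *.
  have [oa ob] := Koff _ zr nK; have [oa' ob'] := Koff _ z'r nK'.
  have [p1|p1] := ltP t 1.
    have p2 : ~ 0 < t by case: tt => tt; rewrite tt ?ltxx // in p1 *.
    have := one_ray_connected (an0 p1) (oa p1) zr (oa' p1) z'r.
    by apply: pconn_shift => w [wr ow]; apply: offK.
  have p2 : 0 < t by lra.
  have := one_ray_connected (bn0 p2) (ob p2) zr (ob' p2) z'r.
  by apply: pconn_shift => w [wr ow]; apply: offK => // h; exfalso; apply: abs10; lra.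
Qed.

End Rays.

(** * Arcs as point sets, and separation of the plane *)

Section Arcs.
Variable R : realType.
Local Notation pt := (R * R)%type.
Implicit Types (f g : R -> pt) (p q y z : pt) (A X Y K S O : set pt).

(** Only the point set and its ends are kept, so that reversal and concatenation are operations on
    sets. *)
Definition plarc S p q :=
  exists f, [/\ loclin f, inj01 f, f 0 = p, f 1 = q & S = trace f].

Definition tarc S p q :=
  exists f, [/\ cont01 f, inj01 f, f 0 = p, f 1 = q & S = trace f].

Lemma plarc_tarc S p q : plarc S p q -> tarc S p q.
Proof. by case=> f [fl ? ? ? ?]; exists f; split=> //; exact: loclin_cont. Qed.

Lemma in00 : 0 <= (0 : R) <= 1. Proof. by rewrite lexx ler01. Qed.
Lemma in11 : 0 <= (1 : R) <= 1. Proof. by rewrite lexx ler01. Qed.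

Lemma trace_rev f : trace (fun t => f (1 + t * (0 - 1))) = trace f.
Proof.
apply/seteqP; split=> z; first exact: (trace_sub in11 in00).
by case=> t t01 ->; exists (1 - t); [lra|congr f; ring].
Qed.

Lemma plarc_rev S p q : plarc S p q -> plarc S q p.
Proof.
case=> f [fl fi f0 f1 SE]; exists (fun t => f (1 + t * (0 - 1))); split.
- exact: loclin_sub in11 in00.
- by apply: inj01_sub in11 in00 _ => //; rewrite oner_eq0.
- by rewrite mul0r addr0.
- by rewrite mul1r addrC subrK.
- by rewrite trace_rev.
Qed.

Lemma plarc_cat S T p q r : plarc S p q -> plarc T q r ->
  (forall z, S z -> T z -> z = q) -> plarc (S `|` T) p r.
Proof.
case=> f [fl fi f0 f1 ->] [g [gl gi g0 g1 ->]] ST; exists (acat f g).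
have fg : f 1 = g 0 by rewrite f1.
split; rewrite ?acat0 ?acat1 ?trace_acat //; first exact: loclin_acat.
by apply: inj01_acat => // z zf zg; rewrite f1; exact: ST.
Qed.

Lemma tarc_closedE S p q : tarc S p q -> closedE S.
Proof. by case=> f [fc _ _ _ ->]; exact: trace_closedE. Qed.

Lemma tarc_ends S p q : tarc S p q -> S p /\ S q.
Proof.
by case=> f [_ _ <- <- ->]; split; apply: traceT; [exact: in00|exact: in11].
Qed.

Definition cl Y y := forall e : R, 0 < e -> exists2 z, `|z - y| < e & Y z.

Lemma cl_closed Y y : (forall e : R, 0 < e -> exists2 z, `|z - y| < e & cl Y z) -> cl Y y.
Proof.
move=> h e e0; have [|z ze cz] := h (e / 2); first by lra.
have [|w we Yw] := cz (e / 2); first by lra.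
exists w => //; have -> : w - y = (w - z) + (z - y) by rewrite addrA subrK.
by apply: le_lt_trans (ler_normD _ _) _; lra.
Qed.

(** Touching is locally constant in the parameter: from points of [Y] close to one point of the arc,
    [plarc_reach] leads to all nearby points of the arc. *)
Lemma touch_arc f K Y (a b : R) : loclin f -> inj01 f -> 0 <= a -> b <= 1 ->
  (forall z z', Y z -> pconn (~` K) z z' -> Y z') -> Y `<=` ~` K ->
  (forall u : R, a <= u <= b -> exists2 r0 : R, 0 < r0 &
     forall z, `|z - f u| < r0 -> (K z <-> trace f z)) ->
  forall s t : R, a <= s <= b -> a <= t <= b -> cl Y (f s) -> cl Y (f t).
Proof.
move=> fl fi a0 b1 Ysat YK loc; apply: locally_const => u uab.
have u01 : 0 <= u <= 1 by lra.
have [clu|nclu] := pselect (cl Y (f u)).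
  have [r0 r00 KE] := loc u uab.
  have [r r1 [_ [d d0 reach] _ _]] := plarc_reach fl fi u01 r00 KE.
  exists d => // s sab sd; split=> // _ e e0.
  have [z zr Yz] := clu r r1.
  have s01 : 0 <= s <= 1 by lra.
  have [z' z'e zz'] := reach s s01 sd z zr (YK _ Yz) e e0.
  by exists z' => //; exact: Ysat Yz zz'.
have [e e0 he] : exists2 e : R, 0 < e & forall z, `|z - f u| < e -> ~ Y z.
  apply: contrapT => no; apply: nclu => e e0; apply: contrapT => nz.
  by apply: no; exists e => // z ze Yz; apply: nz; exists z.
have [|d d0 hd] := loclin_cont fl u01 (e := e / 2); first by lra.
exists d => // s sab sd; split=> // cls; exfalso.
have [|z ze Yz] := cls (e / 2); first by lra.
apply: he Yz; have -> : z - f u = (z - f s) + (f s - f u) by rewrite addrA subrK.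
apply: le_lt_trans (ler_normD _ _) _.
by have := hd s ltac:(lra) sd; lra.
Qed.

Lemma pconn_const O K z z' :
  (forall y, ~ K y -> exists2 r : R, 0 < r & forall w, `|w - y| < r -> (O w <-> O y)) ->
  pconn (~` K) z z' -> O z -> O z'.
Proof.
move=> loc; elim=> // p q r h _ IH Op; apply: IH.
have := @locally_const _ (fun t => O (seg p q t)) 0 1 _ 0 1 in00 in11.
rewrite seg0 seg1; apply=> // t t01; have [r0 r00 hr] := loc _ (h t t01).
have [d d0 hd] := loclin_cont (seg_loclin p q) t01 r00.
by exists d => // s s01 sd; apply: hr; exact: hd.
Qed.

(* A polygonal arc does not separate the plane: a region touching it touches its
   first end, hence surrounds that end, hence surrounds every point of it. *)
Lemma plarc_nonsep A p q O : plarc A p q ->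
  (forall y, ~ A y -> exists2 r : R, 0 < r & forall w, `|w - y| < r -> (O w <-> O y)) ->
  forall z1 z2, ~ A z1 -> ~ A z2 -> O z1 -> O z2.
Proof.
move=> pA loc z1 z2 nA1 nA2 O1; apply: contrapT => nO2.
have Acl := tarc_closedE (plarc_tarc pA).
have [f [fl fi f0 f1 AE]] := pA.
pose Y := [set z | O z /\ ~ A z].
have Ysat (z z' : pt) : Y z -> pconn (~` A) z z' -> Y z'.
  by move=> [Oz nA] zz'; split; [exact: pconn_const loc zz' Oz|exact: (pconn_in zz').2].
have YA : Y `<=` ~` A by move=> z [].
have Yopen y : Y y -> exists2 r : R, 0 < r & forall w, `|w - y| < r -> Y w.
  move=> [Oy nA]; have [r1 r10 h1] := loc y nA; have [r2 r20 h2] := Acl y nA.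
  exists (Num.min r1 r2); first by rewrite lt_min r10.
  by move=> w; rewrite lt_min => /andP[/h1 w1 /h2 w2]; split=> //; apply/w1.
have same (u : R) : 0 <= u <= 1 -> exists2 r0 : R, 0 < r0 &
    forall z, `|z - f u| < r0 -> (A z <-> trace f z).
  by move=> _; exists 1 => // z _; rewrite AE.
have segc := loclin_cont (seg_loclin z1 z2).
(* On the way from [z1] to [z2] the set [Y] can be left only at a point of the arc. *)
have [t t01 clt] : exists2 t : R, 0 <= t <= 1 & cl Y (f t).
  have [||s [s01 nYs hs]] := @first_hit _ (seg z1 z2) (~` Y) segc.
  - by move=> z /contrapT/Yopen[r r0 h]; exists r => // w /h Yw; apply.
  - by rewrite seg1 => -[].
  have cls : cl Y (seg z1 z2 s).
    have s0 : 0 < s.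
      rewrite lt_neqAle eq_sym; apply/andP; split; last by case/andP: s01.
      by apply/eqP => s0; apply: nYs; rewrite s0 seg0.
    move=> e e0; have [d d0 hd] := segc s s01 e e0.
    pose s' := Num.max 0 (s - d / 2).
    have s'0 : 0 <= s' by rewrite le_max lexx.
    have s's : s' < s by rewrite gt_max s0; lra.
    have s'd : s - d / 2 <= s' by rewrite le_max lexx orbT.
    exists (seg z1 z2 s'); first by apply: hd; [lra|rewrite ltr_norml; lra].
    by apply: contrapT; apply: hs; rewrite s'0.
  have As : A (seg z1 z2 s).
    apply: contrapT => nA; have [r r0 h] := loc _ nA.
    have [w wr [Ow _]] := cls r r0.
    by apply: nYs; split=> //; apply/(h w).
  by move: As cls; rewrite AE => -[t t01 ->]; exists t.
have cl0 : cl Y (f 0).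
  exact: (touch_arc fl fi (lexx _) (lexx _) Ysat YA same t01 in00).
pose Q u := exists2 r : R, 0 < r & forall z, `|z - f u| < r -> ~ A z -> Y z.
(* Around an end the complement of the arc is connected, so touching the end implies surrounding
   it. *)
have Q0 : Q 0.
  have [r0 r00 KE] := same 0 in00.
  have [r rp [_ _ _ /(_ (or_introl erefl)) conn]] := plarc_reach fl fi in00 r00 KE.
  have [w wr Yw] := cl0 r rp.
  by exists r => // z zr nA; apply: (Ysat w z Yw); exact: (conn w z wr zr (YA _ Yw) nA).
have Qall (u : R) : 0 <= u <= 1 -> Q u.
  move=> u01; apply: (locally_const _ in00 u01 Q0) => {}u {}u01.
  have [r0 r00 KE] := same u u01.
  have [r rp [_ [d d0 reach] _ _]] := plarc_reach fl fi u01 r00 KE.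
  have [[r' r'0 hQ]|nQ] := pselect (Q u).
    have [|d' d'0 hd'] := loclin_cont fl u01 (e := r' / 2); first by lra.
    exists d' => // s s01 sd; split=> _; first by exists r'.
    exists (r' / 2); first by lra.
    move=> z zs nA; apply: hQ => //.
    have -> : z - f u = (z - f s) + (f s - f u) by rewrite addrA subrK.
    by apply: le_lt_trans (ler_normD _ _) _; have := hd' s s01 sd; lra.
  exists d => // s s01 sd; split=> // -[r' r'0 hQ]; exfalso; apply: nQ.
  exists r => // z zr nA; have [z' z'e zz'] := reach s s01 sd z zr nA r' r'0.
  by apply: (Ysat z'); [apply: hQ => //; exact: (pconn_in zz').2|exact: pconn_sym].
(* Replaces membership in [Y] along the segment by a property that makes sense on the arc too and is
   locally constant. *)
pose T s := exists2 r : R, 0 < r & forall z, `|z - seg z1 z2 s| < r -> ~ A z -> Y z.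
suff [r r0 h] : T 1.
  by have [] : Y z2 by apply: h => //; rewrite seg1 subrr normr0.
have T0 : T 0 by rewrite /T seg0; have [r r0 h] := Yopen z1 (conj O1 nA1); exists r => // z /h.
apply: (locally_const _ in00 in11 T0) => u u01.
have [Au|nAu] := pselect (A (seg z1 z2 u)).
  have [r r0 h] : T u.
    by move: Au; rewrite {1}AE => -[v v01 E]; have [r r0 h] := Qall v v01; exists r => //; rewrite E.
  have [|d d0 hd] := segc u u01 (r / 2); first by lra.
  exists d => // s s01 sd; split=> _; first by exists r.
  exists (r / 2); first by lra.
  move=> z zs nA; apply: h => //.
  have -> : z - seg z1 z2 u = (z - seg z1 z2 s) + (seg z1 z2 s - seg z1 z2 u).
    by rewrite addrA subrK.
  by apply: le_lt_trans (ler_normD _ _) _; have := hd s s01 sd; lra.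
have [r1 r10 h1] := loc _ nAu; have [r2 r20 h2] := Acl _ nAu.
pose r := Num.min r1 r2.
have r0 : 0 < r by rewrite lt_min r10.
have hr w : `|w - seg z1 z2 u| < r -> (Y w <-> O (seg z1 z2 u)).
  by rewrite lt_min => /andP[/h1 w1 /h2 w2]; split=> [[/w1]//|/w1]; split.
have TE (s : R) : `|seg z1 z2 s - seg z1 z2 u| < r / 2 -> (T s <-> O (seg z1 z2 u)).
  move=> su; split=> [[r' r'0 h]|Ou].
    apply/(hr (seg z1 z2 s)); first by lra.
    apply: h; first by rewrite subrr normr0.
    have rr2 : r <= r2 by rewrite ge_min lexx orbT.
    by apply: h2; lra.
  exists (r / 2); first by lra.
  move=> z zs _; apply/hr => //.
  have -> : z - seg z1 z2 u = (z - seg z1 z2 s) + (seg z1 z2 s - seg z1 z2 u).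
    by rewrite addrA subrK.
  by apply: le_lt_trans (ler_normD _ _) _; lra.
have [|d d0 hd] := segc u u01 (r / 2); first by lra.
exists d => // s s01 sd; rewrite (TE s); last exact: hd.
by rewrite (TE u) // subrr normr0; lra.
Qed.

(** Locally a cone: a point near [y] and off [K] sees [y] along a segment that avoids [K] except
    perhaps at [y]. This is the gain from polygonal arcs over continuous ones. *)
Definition conic K := forall y, exists2 r : R, 0 < r &
  forall z (u : R), `|z - y| < r -> 0 < u <= 1 -> K (seg y z u) -> K z.

Lemma conic_point p : conic [set p].
Proof.
move=> y; have [->|yp] := pselect (y = p).
  exists 1 => // z u _ /andP[u0 _]; rewrite /= /seg => /eqP.
  rewrite -subr_eq0 addrC addKr scaler_eq0 gt_eqF //= subr_eq0 => /eqP //.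
have r0 : 0 < `|p - y| by rewrite normr_gt0 subr_eq0; apply/eqP/nesym.
exists `|p - y| => // z u zr /andP[u0 u1] /= E; exfalso.
have : `|p - y| < `|p - y|; last by rewrite ltxx.
by rewrite -{1}E /seg addrC addKr normrZ gtr0_norm //; apply: le_lt_trans zr; rewrite ler_piMl.
Qed.

Lemma conic_plarc S p q : plarc S p q -> conic S.
Proof.
move=> pS y; have [Sy|nSy] := pselect (S y); last first.
  have [r r0 h] := tarc_closedE (plarc_tarc pS) nSy.
  exists r => // z u zr /andP[u0 u1] Ss; exfalso; apply: h Ss.
  by apply: seg_ball => //; [rewrite subrr normr0|rewrite (ltW u0)].
case: pS => f [fl fi _ _ SE]; move: Sy; rewrite SE => -[t t01 ->].
have [a [b [r [d [r0 _ _ _ trE]]]]] := plarc_local fl fi t01.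
exists r => // z u zr /andP[u0 u1].
have -> : seg (f t) z u = f t + u *: (z - f t) by [].
have ur : `|u *: (z - f t)| < r.
  by rewrite normrZ gtr0_norm //; apply: le_lt_trans zr; rewrite ler_piMl.
move/(trE _ ur) => h; rewrite (_ : z = f t + (z - f t)); last by rewrite addrC subrK.
have unz : u != 0 by rewrite gt_eqF.
have inv c (h0 : R) : u *: (z - f t) = h0 *: c -> z - f t = (u^-1 * h0) *: c.
  by rewrite -scalerA => <-; rewrite scalerA mulVf // scale1r.
apply/(trE _ zr); case: h => -[p1 [h0 h00 /inv E]]; [left|right]; split=> //;
  by exists (u^-1 * h0) => //; rewrite mulr_ge0 // invr_ge0 ltW.
Qed.

Lemma conic_fin (T : finType) (K : T -> set pt) : (forall x, conic (K x)) ->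
  conic [set z | exists x, K x z].
Proof.
move=> Kc y.
have [|e e0 he] := @fin_eps _ T (fun x r => forall z (u : R), `|z - y| < r ->
    0 < u <= 1 -> K x (seg y z u) -> K x z).
  move=> x; have [r r0 h] := Kc x y; exists r => // r' r'0 r'r z u zr.
  by apply: h; exact: lt_le_trans zr r'r.
exists e => // z u zr u01 [x Kx]; exists x; exact: (he x e e0 (lexx _) z u).
Qed.

Lemma closedE_fin (T : finType) (K : T -> set pt) : (forall x, closedE (K x)) ->
  closedE [set z | exists x, K x z].
Proof.
move=> Kc y nK.
have [|e e0 he] := @fin_eps _ T (fun x r => forall z, `|z - y| < r -> ~ K x z).
  move=> x; have [|r r0 h] := Kc x y; first by move=> Kxy; apply: nK; exists x.
  by exists r => // r' r'0 r'r z zr; apply: h; exact: lt_le_trans zr r'r.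
by exists e => // z zr [x Kx]; exact: (he x e e0 (lexx _) z zr).
Qed.

End Arcs.

Arguments plarc {R}.
Arguments tarc {R}.

(** * Plane drawings and their faces *)

Lemma set2_eq (T : finType) (x y x' y' : T) : ([set x; y] = [set x'; y'])%SET ->
  (x = x' /\ y = y') \/ (x = y' /\ y = x').
Proof.
move=> E.
have : x' \in [set x; y]%SET by rewrite E finset.set21.
have : y' \in [set x; y]%SET by rewrite E finset.set22.
have : x \in [set x'; y']%SET by rewrite -E finset.set21.
have : y \in [set x'; y']%SET by rewrite -E finset.set22.
by rewrite !finset.in_set2 => /orP[]/eqP ? /orP[]/eqP ? /orP[]/eqP ? /orP[]/eqP ?;
   subst; auto.
Qed.

Section Drawing.
Variable R : realType.
Local Notation pt := (R * R)%type.
Implicit Types (p q z w : pt) (A X Y K S O : set pt).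

(** The kind of arc is a parameter: [tarc] for an arbitrary drawing, [plarc] for its polygonal
    replacement. *)
Definition drawing (arc : set pt -> pt -> pt -> Prop) (V : finType) (e : rel V)
    (pos : V -> pt) (E : V -> V -> set pt) : Prop :=
  [/\ injective pos,
      forall x y, e x y -> arc (E x y) (pos x) (pos y),
      forall x y, e x y -> E x y = E y x,
      forall x y v, e x y -> E x y (pos v) -> v = x \/ v = y &
      forall x y x' y' z, e x y -> e x' y' -> E x y z -> E x' y' z ->
        ([set x; y] = [set x'; y'])%SET \/ exists v, z = pos v].

Definition drawn (V : finType) (e : rel V) (pos : V -> pt) (E : V -> V -> set pt) :
    set pt :=
  [set z | (exists v, z = pos v) \/ exists x y, e x y /\ E x y z].

(** Presents the drawing as a finite union, to which [fin_eps] applies. *)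
Definition piece (V : finType) (e : rel V) (pos : V -> pt) (E : V -> V -> set pt)
    (k : V + V * V) : set pt :=
  match k with inl v => [set pos v] | inr (x, y) => [set z | e x y /\ E x y z] end.

Lemma drawnE (V : finType) (e : rel V) pos E :
  drawn e pos E = [set z | exists k, piece e pos E k z].
Proof.
apply/seteqP; split=> z.
  by case=> [[v ->]|[x [y exy]]]; [exists (inl v)|exists (inr (x, y))].
by case=> -[v|[x y]] h; [left; exists v|right; exists x, y].
Qed.

Lemma drawing_pl_t (V : finType) (e : rel V) pos E :
  drawing plarc e pos E -> drawing tarc e pos E.
Proof. by case=> h1 h2 h3 h4 h5; split=> // x y /h2/plarc_tarc. Qed.

Lemma piece_closed (V : finType) (e : rel V) pos E k : drawing tarc e pos E ->
  closedE (piece e pos E k).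
Proof.
case=> _ arcE _ _ _; case: k => [v|[x y]] z nz.
  exists `|z - pos v|; first by rewrite normr_gt0 subr_eq0; apply/eqP.
  by move=> w h /= E'; move: h; rewrite E' distrC ltxx.
have [exy|nexy] := boolP (e x y); last first.
  by exists 1 => // w _ [exy]; rewrite exy in nexy.
have [|r r0 h] := tarc_closedE (arcE _ _ exy) (z := z); first by move=> ?; apply: nz.
by exists r => // w /h ? [].
Qed.

Lemma drawn_closed (V : finType) (e : rel V) pos E : drawing tarc e pos E ->
  closedE (drawn e pos E).
Proof. by move=> D; rewrite drawnE; apply: closedE_fin => k; exact: piece_closed. Qed.

Lemma set0_conic (P : Prop) (S : set pt) : (P -> conic S) -> conic [set z | P /\ S z].
Proof.
move=> h; have [p|np] := pselect P; last by move=> y; exists 1 => // z u _ _ [].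
by move=> y; have [r r0 hr] := h p y; exists r => // z u zr u01 [_ Su]; split=> //; exact: hr Su.
Qed.

Section PLDrawing.
Variables (V : finType) (e : rel V) (pos : V -> pt) (E : V -> V -> set pt).
Hypotheses (se : symmetric e) (ie : irreflexive e) (dr : drawing plarc e pos E).
Local Notation D := (drawn e pos E).

Let drt := drawing_pl_t dr.

Lemma pos_drawn v : D (pos v). Proof. by left; exists v. Qed.

Lemma edge_drawn x y : e x y -> E x y `<=` D.
Proof. by move=> exy z Ez; right; exists x, y. Qed.

Lemma edge_ends x y : e x y -> E x y (pos x) /\ E x y (pos y).
Proof. by case: drt => _ arcE _ _ _ /arcE; exact: tarc_ends. Qed.

Lemma edge_set_eq x y x' y' : e x y -> e x' y' ->
  ([set x; y] = [set x'; y'])%SET -> E x y = E x' y'.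
Proof.
case: dr => _ _ symE _ _ exy exy' /set2_eq[[-> ->]//|[-> ->]].
by rewrite symE // se.
Qed.

Lemma drawn_conic : conic D.
Proof.
case: dr => _ arcE _ _ _; rewrite drawnE; apply: conic_fin => -[v|[x y]].
  exact: conic_point.
by apply: set0_conic => /arcE; exact: conic_plarc.
Qed.

Definition inner z := forall v, z <> pos v.

Lemma near_edge x y z : e x y -> E x y z -> inner z ->
  exists2 r : R, 0 < r & forall w, `|w - z| < r -> (D w <-> E x y w).
Proof.
move=> exy Ez iz.
have [|r r0 h] := @fin_eps _ (V + V * V)%type (fun k r => forall w, `|w - z| < r ->
    piece e pos E k w -> E x y w).
  move=> k; have [kz|nkz] := pselect (piece e pos E k z); last first.
    have [r r0 h] := piece_closed drt nkz; exists r => // r' _ r'r w wr kw.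
    by exfalso; apply: h kw; exact: lt_le_trans wr r'r.
  exists 1 => // r' _ _ w _; case: k kz => [v /iz//|[x' y'] [exy' Ez'] [_]].
  case: (dr) => _ _ _ _ /(_ x' y' x y z exy' exy Ez' Ez)[/edge_set_eq->//|[v /iz//]].
exists r => // w wr; split; last by move=> Ew; right; exists x, y.
by rewrite drawnE => -[k kw]; exact: (h k r r0 (lexx _) w wr).
Qed.

Definition face z0 : set pt := [set z | pconn (~` D) z0 z].
Definition touch z0 (y : pt) := cl (face z0) y.

Lemma touch_pconn z z' y : pconn (~` D) z z' -> touch z y -> touch z' y.
Proof.
move=> zz' h r r0; have [w wr zw] := h r r0; exists w => //.
by apply: pconn_trans zw; exact: pconn_sym.
Qed.

Lemma near_touch y : exists2 r : R, 0 < r & forall z, `|z - y| < r -> ~ D z -> touch z y.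
Proof.
have [r r0 h] := drawn_conic y; exists r => // z zr nD.
apply: pconn_arrive => t /andP[t0 t1]; rewrite segC => Ds; apply: nD.
by apply: h zr _ Ds; lra.
Qed.

Lemma edge_param x y : e x y -> exists f, [/\ loclin f, inj01 f, f 0 = pos x /\ f 1 = pos y,
  E x y = trace f & forall t : R, 0 <= t <= 1 -> (inner (f t) <-> 0 < t < 1)].
Proof.
move=> exy; case: (dr) => pi arcE _ ver _; have [f [fl fi f0 f1 EE]] := arcE x y exy.
exists f; split=> // t t01; split=> [it|/andP[t0 t1] v Ev].
  have t0 : t != 0 by apply/eqP => t0; apply: (it x); rewrite t0.
  have t1 : t != 1 by apply/eqP => t1; apply: (it y); rewrite t1.
  by rewrite !lt_neqAle eq_sym t0 t1.
have : E x y (pos v) by rewrite EE -Ev; exact: traceT.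
case/(ver _ _ _ exy) => vE; move: Ev; rewrite vE.
  by rewrite -f0 => /(fi _ _ t01 (in00 R)) tt; rewrite tt ltxx in t0.
by rewrite -f1 => /(fi _ _ t01 (in11 R)) tt; rewrite tt ltxx in t1.
Qed.

(** Along the open edge [touch_arc] applies, because no other edge is near its points. The ends,
    where other edges arrive, are reached as limits. *)
Lemma edge_touch x y z z0 : e x y -> E x y z -> inner z -> touch z0 z ->
  touch z0 (pos x) /\ touch z0 (pos y).
Proof.
move=> exy Ez iz tz; have [f [fl fi [f0 f1] EE inn]] := edge_param exy.
move: Ez iz tz; rewrite {1}EE => -[t t01 ->] it tt.
have /andP[t0 t1] : 0 < t < 1 by apply/inn.
have all_t (s : R) : 0 < s < 1 -> touch z0 (f s).
  move=> /andP[s0 s1].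
  apply: (@touch_arc _ f D (face z0) (Num.min s t) (Num.max s t)) tt => //.
  - by rewrite le_min !ltW.
  - by rewrite ge_max !ltW.
  - by move=> z1 z2 h1 h2; exact: pconn_trans h1 h2.
  - by move=> z1 h; have [] := pconn_in h.
  - move=> u /andP[u1 u2].
    have u0 : 0 < u by apply: lt_le_trans u1; rewrite lt_min s0.
    have u11 : u < 1 by apply: le_lt_trans u2 _; rewrite gt_max s1.
    have u01 : 0 <= u <= 1 by lra.
    have [||r r0 h] := near_edge (z := f u) exy.
    + by rewrite EE; exact: traceT.
    + by apply/inn => //; rewrite u0.
    by exists r => // w /h; rewrite EE.
  - by rewrite ge_min le_max lexx !orbT.
  - by rewrite ge_min le_max lexx.
have fc := loclin_cont fl.
split; apply: cl_closed => r r0.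
  have [d d0 hd] := fc 0 (in00 R) r r0.
  pose s := Num.min (1 / 2) (d / 2).
  have s0 : 0 < s by rewrite lt_min; lra.
  have s1 : s <= 1 / 2 by rewrite ge_min lexx.
  have sd : s <= d / 2 by rewrite ge_min lexx orbT.
  exists (f s); last by apply: all_t; lra.
  by rewrite -f0; apply: hd; [lra|rewrite subr0 gtr0_norm //; lra].
have [d d0 hd] := fc 1 (in11 R) r r0.
pose s := Num.min (1 / 2) (d / 2).
have s0 : 0 < s by rewrite lt_min; lra.
have s1 : s <= 1 / 2 by rewrite ge_min lexx.
have sd : s <= d / 2 by rewrite ge_min lexx orbT.
exists (f (1 - s)); last by apply: all_t; lra.
by rewrite -f1; apply: hd; [lra|rewrite ltr_norml; lra].
Qed.

Lemma edge_offD x y z : e x y -> E x y z -> inner z ->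
  forall r : R, 0 < r -> exists2 w, `|w - z| < r & ~ D w.
Proof.
move=> exy Ez iz; have [f [fl fi [f0 f1] EE inn]] := edge_param exy.
have [r0 r00 h] := near_edge exy Ez iz.
move: Ez h; rewrite EE => -[t t01 ->] h.
by have [r rp [_ _ off _]] := plarc_reach fl fi t01 r00 h.
Qed.

Lemma edge_mid x y : e x y -> exists2 z, E x y z & inner z.
Proof.
move=> exy; have [f [fl fi [f0 f1] EE inn]] := edge_param exy.
have h01 : 0 <= (1 / 2 : R) <= 1 by lra.
by exists (f (1 / 2)); [rewrite EE; exact: traceT|apply/inn => //; lra].
Qed.

(* The core is a union of vertices and open edges; if the faces around it meet
   the rest of the drawing inside an arc, they fill the complement of that arc. *)
Lemma core_region (CV : pred V) (CE : rel V) A p q : plarc A p q ->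
  symmetric CE -> subrel CE e -> (forall x y, CV x -> e x y -> CE x y) ->
  (forall z x y, ~ D z ->
     (exists2 x0, CV x0 & touch z (pos x0)) \/
     (exists x0 y0 w, [/\ CE x0 y0, E x0 y0 w, inner w & touch z w]) ->
     (touch z (pos x) -> CV x \/ A (pos x)) /\
     (e x y -> touch z (pos x) -> touch z (pos y) -> CE x y \/ E x y `<=` A)) ->
  forall z1 x1 y1 c, CE x1 y1 -> E x1 y1 z1 -> inner z1 ->
    A `<=` D -> ~~ CV c -> ~ A (pos c) -> False.
Proof.
move=> pA sCE CEe CVe H z1 x1 y1 c Cxy Ez1 iz1 AD nCc nAc.
pose tc z := (exists2 x0, CV x0 & touch z (pos x0)) \/
     (exists x0 y0 w, [/\ CE x0 y0, E x0 y0 w, inner w & touch z w]).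
pose core z := (exists2 x0, CV x0 & z = pos x0) \/
     (exists x0 y0, [/\ CE x0 y0, E x0 y0 z & inner z]).
pose O := [set z | (~ D z /\ tc z) \/ core z].
have coreD z : core z -> D z.
  case=> [[x0 _ ->]|[x0 [y0 [/CEe e0 E0 _]]]]; first exact: pos_drawn.
  exact: edge_drawn E0.
have tc_pconn z z' : pconn (~` D) z z' -> tc z -> tc z'.
  move=> zz' [[x0 C0 t0]|[x0 [y0 [w [C0 E0 i0 t0]]]]].
    by left; exists x0 => //; exact: touch_pconn zz' t0.
  by right; exists x0, y0, w; split=> //; exact: touch_pconn zz' t0.
have core_tc z y : core y -> touch z y -> tc z.
  case=> [[x0 C0 ->]|[x0 [y0 [C0 E0 i0]]]] t0; first by left; exists x0.
  by right; exists x0, y0, y.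
have Dcl := drawn_closed drt.
(* The hypothesis only speaks of touched vertices, but every open edge of the core is touched by
   some face, which then touches its ends. *)
have ends_ok x y : CE x y -> CV x \/ A (pos x).
  move=> Cxy'; have exy := CEe _ _ Cxy'; have [z Ez iz] := edge_mid exy.
  have [r r0 hr] := near_touch z; have [w wr nDw] := edge_offD exy Ez iz r0.
  have tw := hr w wr nDw; have [tx _] := edge_touch exy Ez iz tw.
  have [|h _] := H w x y nDw; last exact: h.
  by right; exists x, y, z.
(* Around a core point everything is in the core or in a face that touches it. Around any other
   point of the drawing off [A], the hypothesis on faces and [ends_ok] exclude points of [O]. *)
have Oloc y : ~ A y -> exists2 r : R, 0 < r & forall w, `|w - y| < r -> (O w <-> O y).
  move=> nAy; have [Dy|nDy] := pselect (D y); last first.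
    have [r r0 hr] := Dcl y nDy; exists r => // w wr.
    have yw : pconn (~` D) y w.
      by apply: pconn1 => t t01; apply: hr; apply: seg_ball => //; rewrite subrr normr0.
    have nDw := hr w wr.
    split; case=> [[_ t0]|/coreD//]; left; split=> //.
      by apply: tc_pconn t0; exact: pconn_sym.
    exact: tc_pconn yw t0.
  have [r1 r10 h1] := near_touch y.
  have [|r2 r20 h2'] := @fin_eps _ (V + V * V)%type (fun k r => forall w, `|w - y| < r ->
      piece e pos E k w -> piece e pos E k y).
    move=> k; have [ky|nky] := pselect (piece e pos E k y); first by exists 1.
    have [r r0 h] := piece_closed drt nky; exists r => // r' _ r'r w wr kw.
    by exfalso; apply: h kw; exact: lt_le_trans wr r'r.
  have h2 k w := h2' k r2 r20 (lexx _) w.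
  exists (Num.min r1 r2); first by rewrite lt_min r10.
  move=> w; rewrite lt_min => /andP[w1 w2].
  have posw v : w = pos v -> w = y by move=> wv; rewrite wv; apply/esym; exact: (h2 (inl v) w w2).
  have edgew x x' : e x x' -> E x x' w -> E x x' y.
    by move=> exx Ew; have [] := h2 (inr (x, x')) w w2 (conj exx Ew).
  have [cy|ncy] := pselect (core y).
    split=> _; first by right.
    have [Dw|nDw] := pselect (D w); last by left; split=> //; apply: core_tc cy _; exact: h1.
    right; have [->//|wy] := pselect (w = y).
    have iw : inner w by move=> v /posw.
    case: Dw => [[v /posw]//|[x [x' [exx Ew]]]].
    right; exists x, x'; split=> //; have Ey := edgew x x' exx Ew.
    case: cy => [[v Cv yv]|[a [b [Cab Eab iy]]]].
      case: (dr) => _ _ _ /(_ x x' v exx); rewrite -yv => /(_ Ey) + _.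
      by case=> vE; rewrite vE in Cv; [exact: CVe|rewrite sCE; apply: CVe => //; rewrite se].
    case: (dr) => _ _ _ _ /(_ _ _ _ _ _ exx (CEe _ _ Cab) Ey Eab)[|[v /iy//]].
    by case/set2_eq=> -[-> ->] //; rewrite sCE.
  have nOw : ~ O w.
    case=> [[nDw tw]|cw].
      have twy := h1 w w1 nDw.
      case: Dy => [[v yv]|[x [x' [exx Ey]]]].
        have [+ _] := H w v v nDw tw; rewrite -yv => /(_ twy)[Cv|//].
        by apply: ncy; left; exists v.
      have [iy|/existsNP[v /contrapT yv]] := pselect (inner y); last first.
        have [+ _] := H w v v nDw tw; rewrite -yv => /(_ twy)[Cv|//].
        by apply: ncy; left; exists v.
      have [tx tx'] := edge_touch exx Ey iy twy.
      have [_ /(_ exx tx tx')[Cxx|/(_ _ Ey)//]] := H w x x' nDw tw.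
      by apply: ncy; right; exists x, x'.
    case: cw => [[v Cv wv]|[x [x' [Cxx Ew iw]]]].
      by apply: ncy; left; exists v => //; rewrite -(posw _ wv).
    have exx := CEe _ _ Cxx; have Ey := edgew x x' exx Ew.
    have [iy|/existsNP[v /contrapT yv]] := pselect (inner y).
      by apply: ncy; right; exists x, x'.
    have : CV v \/ A (pos v).
      case: (dr) => _ _ _ /(_ x x' v exx); rewrite -yv => /(_ Ey) + _.
      case=> vE; rewrite vE in yv *; first by rewrite yv; exact: ends_ok Cxx.
      by rewrite yv; apply: (ends_ok x' x); rewrite sCE.
    by rewrite -yv => -[Cv|//]; apply: ncy; left; exists v.
  split=> // -[[nDy _]//|//].
have [r r0 hr] := near_touch z1.
have [w wr nDw] := edge_offD (CEe _ _ Cxy) Ez1 iz1 r0.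
have Ow : O w by left; split=> //; right; exists x1, y1, z1; split=> //; exact: hr.
(* Since [O] meets the complement of [A], it contains all of it, and in particular the vertex [c],
   which is neither in the core nor in a face. *)
have : O (pos c).
  by apply: (plarc_nonsep pA Oloc) Ow => // /AD.
case=> [[+ _]|[[x0 C0 cx]|[x0 [y0 [_ _ ic]]]]]; first by apply; exact: pos_drawn.
  case: (dr) => pi _ _ _ _; move: nCc; rewrite (pi _ _ cx) C0 //.
exact: (ic c).
Qed.

Hypothesis face_clique : forall z x y, touch z (pos x) -> touch z (pos y) -> x != y -> e x y.

Lemma edge_pos_ends x y c : e x y -> c != x -> c != y -> ~ E x y (pos c).
Proof. by case: dr => _ _ _ ver _ exy cx cy /(ver _ _ _ exy)[/eqP|/eqP]; apply/negP. Qed.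

(** A face along the open edge [uv] touches only [u], [v] and common neighbours of them. The core is
    the open edge; the arc is the path [u a v], or the edge [uv] itself if [a] is not a common
    neighbour. This leaves no place for [c]. *)
Lemma clique_edge_le1 u v a c : e u v -> c != u -> c != v -> c != a ->
  (forall x, e u x -> e v x -> x = a) -> False.
Proof.
move=> euv cu cv ca com.
pose CE : rel V := fun x y => e x y && ([set x; y] == [set u; v])%SET.
have sCE : symmetric CE by move=> x y; rewrite /CE se finset.setUC.
have [z Ez iz] := edge_mid euv.
have uv : u != v by apply: contraTneq euv => ->; rewrite ie.
have tuv w : (exists2 x0, pred0 x0 & touch w (pos x0)) \/
   (exists x0 y0 y, [/\ CE x0 y0, E x0 y0 y, inner y & touch w y]) ->
   touch w (pos u) /\ touch w (pos v).
  case=> [[x0]//|[x0 [y0 [y [/andP[e0 /eqP/set2_eq s0] E0 i0 t0]]]]].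
  by have [? ?] := edge_touch e0 E0 i0 t0; case: s0 => -[<- <-].
have tri w x : touch w (pos u) -> touch w (pos v) -> touch w (pos x) ->
    [\/ x = u, x = v | [/\ x = a, e u x & e v x]].
  move=> tu tv tx; have [->|xu] := eqVneq x u; first exact: Or31.
  have [->|xv] := eqVneq x v; first exact: Or32.
  have ux : e u x by rewrite se; apply: face_clique tx tu xu.
  have vx : e v x by rewrite se; apply: face_clique tx tv xv.
  by apply: Or33; split=> //; exact: com.
have CEuv : CE u v by rewrite /CE euv eqxx.
case: (boolP (e u a && e v a)) => [/andP[ua va]|nua].
  have Eua := (let: And5 _ h _ _ _ := dr in h) u a ua.
  have Eav := (let: And5 _ h _ _ _ := dr in h) a v ltac:(by rewrite se).
  have pA : plarc (E u a `|` E a v) (pos u) (pos v).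
    apply: plarc_cat Eua Eav _ => y y1 y2.
    have av : e a v by rewrite se.
    case: (dr) => _ _ _ ver /(_ u a a v y ua av y1 y2)[/set2_eq|[w yw]].
      by case=> -[h1 h2]; [move: uv; rewrite h1 h2 eqxx|move: uv; rewrite h1 eqxx].
    rewrite yw in y1 y2 *; case: (ver _ _ _ ua y1) => [wu|->//].
    case: (ver _ _ _ av y2) => [->//|wv]; move: uv; rewrite -wu wv eqxx //.
  have avE : E a v = E v a by case: (dr) => _ _ h _ _; apply: h; rewrite se.
  apply: (@core_region pred0 CE _ _ _ pA sCE _ _ _ z u v c CEuv Ez iz) => //.
  - by move=> x y /andP[].
  - move=> w x y nDw /tuv[tu tv]; split=> [tx|exy tx ty].
      right; case: (tri w x tu tv tx) => [->|->|[-> _ _]].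
      + by left; exact: (edge_ends ua).1.
      + by right; rewrite avE; exact: (edge_ends va).1.
      + by left; exact: (edge_ends ua).2.
    have sym1 x' y' : e x' y' -> E x' y' = E y' x' by case: (dr) => _ _ h _ _; exact: h.
    have [xy|xy] := eqVneq x y; first by rewrite xy ie in exy.
    case: (tri w x tu tv tx) (tri w y tu tv ty) => [xE|xE|[xE _ _]] [yE|yE|[yE _ _]];
      subst; rewrite ?eqxx // in xy exy *.
    + by left.
    + by right=> ? ?; left.
    + by left; rewrite sCE.
    + by right=> ? ?; right; rewrite avE.
    + by right=> ? ?; left; rewrite sym1.
    + by right=> ? ?; right.
  - by move=> y [|] /edge_drawn; apply; rewrite // se.
  - by case; apply: edge_pos_ends; rewrite // se.
have Euv := (let: And5 _ h _ _ _ := dr in h) u v euv.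
apply: (@core_region pred0 CE _ _ _ Euv sCE _ _ _ z u v c CEuv Ez iz) => //.
- by move=> x y /andP[].
- move=> w x y nDw /tuv[tu tv].
  have tri' x' : touch w (pos x') -> x' = u \/ x' = v.
    move=> /(tri w x' tu tv)[->|->|[-> ua va]]; [by left|by right|].
    by move: nua; rewrite ua va.
  split=> [/tri'[->|->]|exy /tri' xE /tri' yE].
  - by right; exact: (edge_ends euv).1.
  - by right; exact: (edge_ends euv).2.
  left; rewrite /CE exy /=; have [xy|xy] := eqVneq x y; first by rewrite xy ie in exy.
  by case: xE yE xy => -> [->|->]; rewrite ?eqxx // finset.setUC.
- exact: edge_drawn.
- exact: edge_pos_ends.
Qed.

(** The core consists of [u], [v] and the open edges at them. Faces around it touch no vertex but
    [u], [v], [a], [b], and the arc is the edge [ab]. *)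
Lemma clique_no_deg3_pair u v a b c : e u v -> e a b ->
  (forall x, e u x -> [\/ x = v, x = a | x = b]) ->
  (forall x, e v x -> [\/ x = u, x = a | x = b]) ->
  uniq [:: u; v; a; b; c] -> False.
Proof.
move=> euv eab nu nv; rewrite /= !inE !negb_or -!andbA.
case/and5P=> uv ua ub uc /and5P[va vb vc ab /and3P[ac bc _]].
pose CV : pred V := fun x => (x == u) || (x == v).
pose CE : rel V := fun x y => e x y && (CV x || CV y).
have sCE : symmetric CE by move=> x y; rewrite /CE se orbC.
have [z Ez iz] := edge_mid euv.
have pA := (let: And5 _ h _ _ _ := dr in h) a b eab.
have CEuv : CE u v by rewrite /CE euv /CV eqxx.
have t4 w x : ~ D w -> (exists2 x0, CV x0 & touch w (pos x0)) \/
   (exists x0 y0 y, [/\ CE x0 y0, E x0 y0 y, inner y & touch w y]) ->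
   touch w (pos x) -> CV x \/ (x = a \/ x = b).
  move=> nDw h tx.
  have [x0 C0 t0] : exists2 x0, CV x0 & touch w (pos x0).
    case: h => [//|[x0 [y0 [y [/andP[e0 C0] E0 i0 t0]]]]].
    have [? ?] := edge_touch e0 E0 i0 t0.
    by case/orP: C0 => ?; [exists x0|exists y0].
  have [->|xx0] := eqVneq x x0; first by left.
  have e0 : e x0 x by rewrite se; exact: face_clique tx t0 xx0.
  case/orP: C0 => /eqP x0E; rewrite x0E in e0.
    by case: (nu _ e0) => ->; [left; rewrite /CV eqxx orbT|right; left|right; right].
  by case: (nv _ e0) => ->; [left; rewrite /CV eqxx|right; left|right; right].
apply: (@core_region CV CE _ _ _ pA sCE _ _ _ z u v c CEuv Ez iz).
- by move=> x y /andP[].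
- by move=> x y Cx exy; rewrite /CE exy Cx.
- move=> w x y nDw h; split=> [/(t4 w x nDw h)[->|[->|->]]|exy tx ty].
  + by left.
  + by right; exact: (edge_ends eab).1.
  + by right; exact: (edge_ends eab).2.
  case: (t4 w x nDw h tx) => [Cx|xE]; first by left; rewrite /CE exy Cx.
  case: (t4 w y nDw h ty) => [Cy|yE]; first by left; rewrite /CE exy Cy orbT.
  right; rewrite (@edge_set_eq x y a b) //.
  have [xy|xy] := eqVneq x y; first by rewrite xy ie in exy.
  by case: xE yE xy => -> [->|->]; rewrite ?eqxx // finset.setUC.
- exact: edge_drawn.
- by rewrite /CV negb_or eq_sym uc eq_sym vc.
- by apply: edge_pos_ends; rewrite // eq_sym.
Qed.

End PLDrawing.
End Drawing.

Lemma pconn_self (R : realType) (X : set (R * R)) z0 p q :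
  pconn X z0 p -> pconn X p q -> pconn [set z | pconn X z0 z] p q.
Proof.
move=> + pq; elim: pq => [p' Xp|p' q' r h _ IH] zp; first exact: pconn0.
have go t : 0 <= t <= 1 -> pconn X z0 (seg p' q' t).
  move=> /andP[t0 t1]; apply: pconn_trans zp _; apply: pconn1 => u /andP[u0 u1].
  by rewrite seg_seg; apply: h; nra.
by apply: pconnS (IH _) => //; rewrite -(seg1 p' q'); apply: go; exact: in11.
Qed.

(** * Drawing a new edge inside a face *)

Section AddEdge.
Variable R : realType.
Local Notation pt := (R * R)%type.
Variables (V : finType) (e : rel V) (pos : V -> pt) (E : V -> V -> set pt).
Hypotheses (se : symmetric e) (dr : drawing plarc e pos E).
Local Notation D := (drawn e pos E).

(** As the drawing is conic, both vertices see points of the face close to them; these are joined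
    inside the face, and the chain is made simple. *)
Lemma face_arc z0 p q : p != q -> touch e pos E z0 (pos p) -> touch e pos E z0 (pos q) ->
  exists2 N, plarc N (pos p) (pos q) &
    forall z, N z -> [\/ z = pos p, z = pos q | face e pos E z0 z].
Proof.
move=> pq tp tq.
pose X := [set z | [\/ z = pos p, z = pos q | face e pos E z0 z]].
have reach v : X (pos v) -> touch e pos E z0 (pos v) ->
    exists2 z, face e pos E z0 z & pconn X (pos v) z.
  move=> Xv tv; have [r r0 h] := drawn_conic dr (pos v).
  have [z zr fz] := tv r r0; exists z => //.
  have nDz := (pconn_in fz).2.
  apply: pconn1 => u /andP[u0 u1].
  have [->|un0] := eqVneq u 0; first by rewrite seg0.
  have up : 0 < u by rewrite lt_neqAle eq_sym un0.
  apply: Or33; apply: pconn_trans fz _; apply: pconn1 => t /andP[t0 t1].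
  have -> : seg z (seg (pos v) z u) t = seg (pos v) z (1 - t * (1 - u)).
    by rewrite !segE /=; congr (_, _); ring.
  move=> Ds; apply: nDz; apply: h zr _ Ds; nra.
have [zp fp cp] := reach p (Or31 _ _ erefl) tp.
have [zq fq cq] := reach q (Or32 _ _ erefl) tq.
have cpq : pconn X (pos p) (pos q).
  apply: pconn_trans cp _; apply: pconn_trans (pconn_sym cq).
  have fpq := pconn_self fp (pconn_trans (pconn_sym fp) fq).
  by apply: pconn_sub fpq => z; exact: Or33.
have [|f [fl fi f0 f1 fX]] := pconn_plarc cpq.
  by case: dr => pi _ _ _ _ /pi/eqP; apply/negP.
by exists (trace f) => //; exists f.
Qed.

Definition add_rel p q : rel V := fun x y => e x y || ([set x; y] == [set p; q])%SET.
Definition add_arc p q N x y : set pt := if ([set x; y] == [set p; q])%SET then N else E x y.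

Lemma add_rel_sym p q : symmetric (add_rel p q).
Proof. by move=> x y; rewrite /add_rel se finset.setUC. Qed.

Lemma add_rel_irr p q : irreflexive e -> p != q -> irreflexive (add_rel p q).
Proof.
move=> ie pq x; rewrite /add_rel ie /=; apply/eqP => /set2_eq[[h1 h2]|[h1 h2]];
  by move: pq; rewrite -h1 -h2 eqxx.
Qed.

Lemma drawing_add p q N : ~~ e p q -> plarc N (pos p) (pos q) ->
  (forall z, N z -> [\/ z = pos p, z = pos q | ~ D z]) ->
  drawing plarc (add_rel p q) pos (add_arc p q N) /\
  drawn (add_rel p q) pos (add_arc p q N) = D `|` N.
Proof.
move=> npq pN ND; have [pi arcE symE ver dis] := dr.
have old x y : e x y -> ([set x; y] == [set p; q])%SET = false.
  move=> exy; apply/eqP => /set2_eq[[h1 h2]|[h1 h2]]; move: npq; rewrite -h1 -h2 ?exy //.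
  by rewrite se exy.
have caseE x y : add_rel p q x y -> (e x y /\ add_arc p q N x y = E x y) \/
    (([set x; y] = [set p; q])%SET /\ add_arc p q N x y = N).
  rewrite /add_rel /add_arc; have [/eqP E0|_] := ifPn; first by right.
  by rewrite orbF; left.
have posN v : N (pos v) -> v = p \/ v = q.
  by case/ND => [/pi->|/pi->|nD]; [left|right|exfalso; apply: nD; exact: pos_drawn].
have mix x y z : e x y -> E x y z -> N z -> exists v, z = pos v.
  move=> exy Ez /ND[->|->|nD]; [by exists p|by exists q|].
  by exfalso; apply: nD; right; exists x, y.
split; last first.
  apply/seteqP; split=> z.
    case=> [[v ->]|[x [y [/caseE[[exy ->]|[_ ->]] Ez]]]].
    - by left; exact: pos_drawn.
    - by left; right; exists x, y.
    - by right.
  case=> [[[v ->]|[x [y [exy Ez]]]]|Nz]; first exact: pos_drawn.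
    by right; exists x, y; rewrite /add_rel exy /add_arc old.
  by right; exists p, q; rewrite /add_rel /add_arc eqxx orbT.
split=> //.
- move=> x y /caseE[[exy ->]|[/set2_eq h ->]]; first exact: arcE.
  by case: h => -[-> ->] //; exact: plarc_rev.
- move=> x y; rewrite /add_arc [([set y; x])%SET]finset.setUC.
  by case/caseE=> [[exy _]|[-> _]]; rewrite ?eqxx // old // symE.
- move=> x y v /caseE[[exy ->]|[/set2_eq h ->]]; first exact: ver.
  by move/posN; case: h => -[-> ->]; tauto.
- move=> x y x' y' z /caseE[[exy ->]|[h ->]] /caseE[[exy' ->]|[h' ->]].
  + exact: dis.
  + by move=> Ez Nz; right; exact: mix exy Ez Nz.
  + by move=> Nz Ez; right; exact: mix exy' Ez Nz.
  + by move=> _ _; left; rewrite h h'.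
Qed.

End AddEdge.

(** * Polygonal approximation of a drawing *)

Section Approximation.
Variable R : realType.
Local Notation pt := (R * R)%type.

Lemma ball_closedE (a : pt) (r : R) : closedE [set z | `|z - a| <= r].
Proof.
move=> z /negP; rewrite -ltNge => zr; exists (`|z - a| - r); first by rewrite subr_gt0.
move=> w wz; apply/negP; rewrite -ltNge.
have : `|z - a| <= `|w - z| + `|w - a|.
  have -> : z - a = - (w - z) + (w - a) by rewrite opprB addrA subrK.
  by apply: le_trans (ler_normD _ _) _; rewrite normrN.
lra.
Qed.

Lemma first_entry (g : R -> pt) (a : pt) (r : R) : cont01 g -> `|g 1 - a| <= r ->
  r < `|g 0 - a| -> exists s : R, [/\ 0 < s <= 1, `|g s - a| = r &
    forall t : R, 0 <= t <= s -> r <= `|g t - a|].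
Proof.
move=> gc g1 g0.
have [s [/andP[s0 s1] sr hs]] := first_hit gc (@ball_closedE a r) g1.
have sp : 0 < s.
  rewrite lt_neqAle eq_sym s0 andbT; apply/eqP => sE; move: sr; rewrite sE /=.
  by rewrite leNgt g0.
have le (t : R) : 0 <= t < s -> r < `|g t - a|.
  by move=> /hs /negP; rewrite -ltNge.
have ge : r <= `|g s - a|.
  rewrite leNgt; apply/negP => lt.
  have [||d d0 hd] := gc s _ (r - `|g s - a|); [by rewrite s0|by rewrite subr_gt0|].
  pose t := Num.max 0 (s - d / 2).
  have t0 : 0 <= t by rewrite le_max lexx.
  have ts : t < s by rewrite gt_max sp; lra.
  have td : s - d / 2 <= t by rewrite le_max lexx orbT.
  have h1 := le t ltac:(by rewrite t0).
  have h2 : `|g t - g s| < r - `|g s - a| by apply: hd; [lra|rewrite ltr_norml; lra].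
  have : `|g t - a| <= `|g t - g s| + `|g s - a|.
    have -> : g t - a = (g t - g s) + (g s - a) by rewrite addrA subrK.
    exact: ler_normD.
  lra.
exists s; split; first by rewrite sp.
  by apply/le_anti; rewrite ge andbT.
move=> t /andP[t0]; rewrite le_eqVlt => /orP[/eqP->//|ts].
by apply/ltW/le; rewrite t0.
Qed.

(** Stop at the first entry into the ball around [b], then go back from there until the first entry
    into the ball around [a]. *)
Lemma middle_arc (f : R -> pt) (a b : pt) (r : R) : cont01 f -> f 0 = a -> f 1 = b ->
  0 < r -> 4 * r <= `|a - b| -> exists s t : R, [/\ 0 <= s <= 1, 0 <= t <= 1,
    `|f s - a| = r, `|f t - b| = r & forall u : R, 0 <= u <= 1 ->
      r <= `|f (s + u * (t - s)) - a| /\ r <= `|f (s + u * (t - s)) - b|].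
Proof.
move=> fc f0 f1 r0 ab.
have [||t [/andP[t0 t1] tb tge]] := @first_entry f b r fc.
- by rewrite f1 subrr normr0 ltW.
- by rewrite f0; lra.
have t01 : 0 <= t <= 1 by rewrite ltW.
pose g u := f (t + u * (0 - t)).
have gc : cont01 g by apply: cont01_sub => //; exact: in00.
have g0 : g 0 = f t by rewrite /g mul0r addr0.
have g1 : g 1 = a by rewrite /g mul1r addrC subrK.
have [||u [/andP[u0 u1] ua uge]] := @first_entry g a r gc.
- by rewrite g1 subrr normr0 ltW.
- rewrite g0; have : `|a - b| <= `|f t - a| + `|f t - b|.
    have -> : a - b = - (f t - a) + (f t - b) by rewrite opprB addrA subrK.
    by apply: le_trans (ler_normD _ _) _; rewrite normrN.
  lra.
have gE v : g v = f (t - v * t) by rewrite /g sub0r mulrN.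
exists (t - u * t), t; split=> //; first by nra.
  by rewrite -gE.
move=> v /andP[v0 v1].
have -> : t - u * t + v * (t - (t - u * t)) = t - (u * (1 - v)) * t by ring.
have /andP[k0 k1] : 0 <= u * (1 - v) <= u by nra.
by split; [rewrite -gE; apply: uge; rewrite k0|apply: tge; nra].
Qed.

(* In a small ball around each vertex the new arcs are radii; between two balls
   they follow the old arc closely, the old arcs being at positive distance from
   each other there. *)
Lemma pl_approx (V : finType) (e : rel V) (pos : V -> pt) (E : V -> V -> set pt) (eta : R) :
  symmetric e -> irreflexive e -> drawing tarc e pos E -> 0 < eta ->
  exists2 E', drawing plarc e pos E' &
    forall x y z, e x y -> E' x y z -> exists2 w, E x y w & `|z - w| < eta.
Proof.
move=> se ie [pi arcE symE ver dis] eta0.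
(* Balls of radius [rho] around the vertices are disjoint and meet no edge except those at their
   centre; [rho < eta] keeps the radii close to the old edges. *)
have [rho rho0 [rho_eta rhoV rhoE]] : exists2 rho : R, 0 < rho & [/\ rho < eta,
    forall x y, x != y -> 4 * rho <= `|pos x - pos y| &
    forall x y v w, e x y -> v != x -> v != y -> E x y w -> 4 * rho <= `|w - pos v|].
  have [|r r0 hr] := @fin_eps _ (V * V * V)%type (fun q r => let: (x, y, v) := q in
     (x != y -> 4 * r <= `|pos x - pos y|) /\
     (e x y -> v != x -> v != y -> forall w, E x y w -> 4 * r <= `|w - pos v|)).
    move=> [[x y] v].
    have [r1 r10 h1] : exists2 r1 : R, 0 < r1 & (x != y -> 4 * r1 <= `|pos x - pos y|).
      have [xy|xy] := eqVneq x y; first by exists 1.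
      have n0 : 0 < `|pos x - pos y| by rewrite normr_gt0 subr_eq0 (inj_eq pi).
      by exists (`|pos x - pos y| / 4); lra.
    have [r2 r20 h2] : exists2 r2 : R, 0 < r2 &
        (e x y -> v != x -> v != y -> forall w, E x y w -> 4 * r2 <= `|w - pos v|).
      have [[exy [vx vy]]|no] := pselect (e x y /\ v != x /\ v != y); last first.
        by exists 1 => // ? ? ?; case: no.
      have [|r r0 h] := tarc_closedE (arcE x y exy) (z := pos v).
        by move/(ver _ _ _ exy) => [/eqP|/eqP]; apply/negP.
      exists (r / 4); first by lra.
      move=> _ _ _ w Ew; rewrite leNgt; apply/negP => lt.
      by apply: (h w) Ew; lra.
    exists (Num.min r1 r2); first by rewrite lt_min r10.
    move=> r' r'0; rewrite le_min => /andP[l1 l2]; split.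
      by move=> /h1; lra.
    by move=> a1 a2 a3 w /(h2 a1 a2 a3); lra.
  exists (Num.min r (eta / 2)); first by rewrite lt_min r0; lra.
  have m0 : 0 < Num.min r (eta / 2) by rewrite lt_min r0; lra.
  have mr : Num.min r (eta / 2) <= r by rewrite ge_min lexx.
  have me : Num.min r (eta / 2) <= eta / 2 by rewrite ge_min lexx orbT.
  split; first by lra.
    by move=> x y xy; have [h _] := hr (x, y, x) _ m0 mr; exact: h.
  by move=> x y v w exy vx vy; have [_ h] := hr (x, y, v) _ m0 mr; exact: h.
have [M MP] : exists M : V * V -> R -> pt, forall q, e q.1 q.2 ->
    [/\ cont01 (M q), `|M q 0 - pos q.1| = rho, `|M q 1 - pos q.2| = rho &
      forall u : R, 0 <= u <= 1 -> E q.1 q.2 (M q u) /\ forall v, rho <= `|M q u - pos v|].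
  have /choice[M MP] : forall q : V * V, exists m : R -> pt, e q.1 q.2 ->
    [/\ cont01 m, `|m 0 - pos q.1| = rho, `|m 1 - pos q.2| = rho &
      forall u : R, 0 <= u <= 1 -> E q.1 q.2 (m u) /\ forall v, rho <= `|m u - pos v|].
    move=> [x y] /=; have [exy|] := boolP (e x y); last by exists (fun _ => pos x).
    have [f [fc fi f0 f1 EE]] := arcE x y exy.
    have xy : x != y by apply: contraTneq exy => ->; rewrite ie.
    have [s [t [s01 t01 fs ft fm]]] := middle_arc fc f0 f1 rho0 (rhoV x y xy).
    exists (fun u => f (s + u * (t - s))) => _; split.
    - exact: cont01_sub.
    - by rewrite mul0r addr0.
    - by rewrite mul1r [s + _]addrC subrK.
    - move=> u u01; have Eu : E x y (f (s + u * (t - s))).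
        by rewrite EE; apply: traceT; exact: in01_affine.
      split=> // v; have [h1 h2] := fm u u01.
      have [->//|vx] := eqVneq v x; have [->//|vy] := eqVneq v y.
      by have := rhoE x y v _ exy vx vy Eu; lra.
  by exists M.
(* Middle parts of different edges are at least [del] apart, so tubes of radius [del / 3] around
   them are disjoint. *)
have [del del0 [del_rho delM]] : exists2 del : R, 0 < del & del <= rho /\
    forall q q', e q.1 q.2 -> e q'.1 q'.2 -> ([set q.1; q.2] != [set q'.1; q'.2])%SET ->
    forall u u' : R, 0 <= u <= 1 -> 0 <= u' <= 1 -> del <= `|M q u - M q' u'|.
  have [|d d0 hd] := @fin_eps _ ((V * V) * (V * V))%type (fun k d =>
     e k.1.1 k.1.2 -> e k.2.1 k.2.2 -> ([set k.1.1; k.1.2] != [set k.2.1; k.2.2])%SET ->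
     forall u u' : R, 0 <= u <= 1 -> 0 <= u' <= 1 -> d <= `|M k.1 u - M k.2 u'|).
    move=> [q q'] /=; have [[eq1 [eq2 nq]]|no] := pselect (e q.1 q.2 /\ e q'.1 q'.2 /\
       ([set q.1; q.2] != [set q'.1; q'.2])%SET); last by exists 1 => // ? _ _ ? ? ?; case: no.
    have [Mc _ _ Min] := MP q eq1; have [Mc' _ _ Min'] := MP q' eq2.
    have [|d d0 h] := cont01_apart Mc Mc'.
      move=> s t s01 t01 eqM; have [E1 far] := Min s s01; have [E2 _] := Min' t t01.
      rewrite -eqM in E2; case: (dis _ _ _ _ _ eq1 eq2 E1 E2) => [/eqP|[v vE]].
        by apply/negP.
      by have := far v; rewrite vE subrr normr0; lra.
    by exists d => // d' _ d'd _ _ _ u u' u01 u'01; apply: le_trans d'd _; exact: h.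
  exists (Num.min d rho); first by rewrite lt_min d0.
  split; first by rewrite ge_min lexx orbT.
  move=> q q' e1 e2 ne u u' u01 u'01; apply: le_trans (hd (q, q') d d0 (lexx _) e1 e2 ne u u' u01 u'01).
  by rewrite ge_min lexx.
pose rad (a b z : pt) := exists2 u : R, 0 <= u <= 1 & z = seg a b u.
pose X (q : V * V) := [set z | [\/ rad (pos q.1) (M q 0) z, rad (pos q.2) (M q 1) z |
   exists2 u : R, 0 <= u <= 1 & `|z - M q u| < del / 3]].
have [N NP] : exists N : V * V -> set pt, forall q, e q.1 q.2 ->
    plarc (N q) (pos q.1) (pos q.2) /\ N q `<=` X q.
  have /choice[N NP] : forall q : V * V, exists N, e q.1 q.2 ->
    plarc N (pos q.1) (pos q.2) /\ N `<=` X q.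
    move=> q; have [eq1|] := boolP (e q.1 q.2); last by exists set0.
    have [Mc _ _ Min] := MP q eq1.
    have c1 : pconn (X q) (pos q.1) (M q 0).
      by apply: pconn1 => t t01; apply: Or31; exists t.
    have c3 : pconn (X q) (M q 1) (pos q.2).
      by apply: pconn_sym; apply: pconn1 => t t01; apply: Or32; exists t.
    have c2 : pconn (X q) (M q 0) (M q 1).
      apply: (@cousin _ (fun a b => pconn (X q) (M q a) (M q b)) 0 1 ler01); last first.
        by move=> x y z _ _ _ _; exact: pconn_trans.
      move=> t t01; have [|d d0 hd] := Mc t t01 (del / 3); first by lra.
      exists d => // x y x0 xt ty y1 yx; apply: pconn1 => u u01.
      apply: Or33; exists t => //; apply: seg_ball => //; apply: hd; try lra.
        by rewrite ltr_norml; lra.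
      by rewrite ltr_norml; lra.
    have [|f [fl fi f0 f1 fX]] := pconn_plarc (pconn_trans c1 (pconn_trans c2 c3)).
      by move/pi => h; move: eq1; rewrite h ie.
    by exists (trace f) => _; split=> //; exists f.
  by exists N.
have radE v (q0 z : pt) : `|q0 - pos v| = rho -> rad (pos v) q0 z ->
    exists2 u : R, 0 <= u <= 1 & [/\ z = seg (pos v) q0 u, `|z - pos v| = u * rho &
      `|q0 - z| = (1 - u) * rho].
  move=> qr [u u01 zE]; exists u => //; move: u01 => /andP[u0 u1]; split=> //.
    by rewrite zE /seg addrC addKr normrZ ger0_norm // qr.
  have -> : q0 - z = (1 - u) *: (q0 - pos v).
    by rewrite zE segE !scaleE !addE !oppE /=; congr (_, _); ring.
  by rewrite normrZ ger0_norm ?qr // subr_ge0.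
have tri (a b c : pt) : `|a - b| <= `|c - a| + `|c - b|.
  have -> : a - b = - (c - a) + (c - b) by rewrite opprB addrA subrK.
  by apply: le_trans (ler_normD _ _) _; rewrite normrN.
have XE q z : e q.1 q.2 -> X q z ->
    (exists v m u, [/\ v = q.1 \/ v = q.2, 0 <= m <= 1, `|M q m - pos v| = rho, 0 <= u <= 1 &
       [/\ z = seg (pos v) (M q m) u, `|z - pos v| = u * rho & `|M q m - z| = (1 - u) * rho]]) \/
    (exists2 u : R, 0 <= u <= 1 & `|z - M q u| < del / 3).
  move=> eq1; have [_ M0 M1 _] := MP q eq1.
  case=> [/(radE _ _ _ M0)[u u01 h]|/(radE _ _ _ M1)[u u01 h]|]; last by right.
    by left; exists q.1, 0, u; split=> //; [left|exact: in00].
  by left; exists q.2, 1, u; split=> //; [right|exact: in11].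
have Xver q v : e q.1 q.2 -> X q (pos v) -> v = q.1 \/ v = q.2.
  move=> eq1 /(XE q _ eq1)[[v' [m [u [v'q m01 _ /andP[u0 u1] [_ d1 _]]]]]|[u u01 d1]].
    have [->//|vv'] := eqVneq v v'; exfalso.
    by have := rhoV v v' vv'; rewrite d1 => h; apply: (@abs10 R); nra.
  have [_ _ _ Min] := MP q eq1; have [_ far] := Min u u01.
  by exfalso; apply: (@abs10 R); have := far v; rewrite distrC; lra.
have Xdis q q' z : e q.1 q.2 -> e q'.1 q'.2 -> ([set q.1; q.2] != [set q'.1; q'.2])%SET ->
    X q z -> X q' z -> exists v, z = pos v.
  move=> e1 e2 ne.
  (* The middle part of [k'] stays outside the ball around [v]. A point of the radius within
     [del / 3] of it is therefore also that close to the outer end of the radius, which belongs to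
     the middle part of [k]. *)
  have radtube k k' v m u u' : e k.1 k.2 -> e k'.1 k'.2 ->
      ([set k.1; k.2] != [set k'.1; k'.2])%SET ->
      0 <= m <= 1 -> 0 <= u <= 1 -> `|z - pos v| = u * rho -> `|M k m - z| = (1 - u) * rho ->
      0 <= u' <= 1 -> `|z - M k' u'| < del / 3 -> False.
    move=> ek ek' nek m01 /andP[u0 u1] d1 d2 u'01 d3.
    have [_ _ _ Min] := MP k' ek'; have [_ /(_ v) far] := Min u' u'01.
    have h1 := delM k k' ek ek' nek m u' m01 u'01.
    have h2 := tri (M k' u') (pos v) z.
    have h3 := tri (M k m) (M k' u') z.
    by apply: (@abs10 R); rewrite [`|z - M k m|]distrC in h3; lra.
  case/(XE q _ e1) => [[v [m [u [vq m01 mr u01 [zE d1 d2]]]]]|[u u01 d1]];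
  case/(XE q' _ e2) => [[v' [m' [u' [vq' m'01 mr' u'01 [zE' d1' d2']]]]]|[u' u'01 d1']].
  - have [vv'|vv'] := eqVneq v v'; last first.
      exfalso; apply: (@abs10 R); have := rhoV v v' vv'; have := tri (pos v) (pos v') z.
      by move: u01 u'01 => /andP[? ?] /andP[? ?]; rewrite d1 d1'; nra.
    subst v'; exists v.
    have uu : u = u' by apply: (mulIf (lt0r_neq0 rho0)); rewrite -d1 -d1'.
    have [u0|u0] := eqVneq u 0; first by rewrite zE u0 seg0.
    exfalso; apply: (@abs10 R); have := delM q q' e1 e2 ne m m' m01 m'01.
    suff -> : M q m = M q' m' by rewrite subrr normr0; lra.
    move: zE; rewrite zE' -uu /seg => /(addrI _)/(scalerI u0)/(addIr _) //.
  - by exfalso; exact: (radtube q q' v m u u').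
  - by exfalso; apply: (radtube q' q v' m' u' u) => //; rewrite eq_sym.
  - exfalso; apply: (@abs10 R); have := delM q q' e1 e2 ne u u' u01 u'01.
    by have := tri (M q u) (M q' u') z; lra.
(* The arcs chosen for [(x, y)] and [(y, x)] are unrelated; the order of [enum_rank] selects one of
   them for both. *)
pose o (x y : V) : V * V := if (enum_rank x < enum_rank y)%N then (x, y) else (y, x).
have oC x y : e x y -> o x y = o y x.
  move=> exy; rewrite /o; case: ltngtP => // h.
  have xy : x = y by apply/enum_rank_inj/val_inj.
  by rewrite xy.
have oE x y : (o x y = (x, y)) \/ (o x y = (y, x)) by rewrite /o; case: ifP; [left|right].
have oe x y : e x y -> e (o x y).1 (o x y).2 by move=> exy; case: (oE x y) => -> //=; rewrite se.
have oS x y : ([set (o x y).1; (o x y).2] = [set x; y])%SET.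
  by case: (oE x y) => -> //=; rewrite finset.setUC.
exists (fun x y => N (o x y)); first split=> //.
- move=> x y exy; have [pN _] := NP _ (oe x y exy).
  by case: (oE x y) pN => -> //=; exact: plarc_rev.
- by move=> x y exy; rewrite oC.
- move=> x y v exy Nv; have [_ /(_ _ Nv)/(Xver _ _ (oe x y exy))] := NP _ (oe x y exy).
  by case: (oE x y) => -> /=; tauto.
- move=> x y x' y' z exy exy' Nz Nz'.
  have [_ /(_ _ Nz) Xz] := NP _ (oe x y exy); have [_ /(_ _ Nz') Xz'] := NP _ (oe x' y' exy').
  have [->|ne] := eqVneq [set x; y]%SET [set x'; y']%SET; first by left.
  by right; apply: (Xdis (o x y) (o x' y')) => //; rewrite ?oe // !oS.
- move=> x y z exy Nz; have eo := oe x y exy.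
  have [_ /(_ _ Nz)/(XE _ _ eo) Xz] := NP _ eo.
  have Eo : E (o x y).1 (o x y).2 = E x y by case: (oE x y) => -> //=; rewrite symE // se.
  have [_ _ _ Min] := MP _ eo.
  case: Xz => [[v [m [u [vq m01 mr /andP[u0 u1] [_ d1 _]]]]]|[u u01 d1]].
    exists (pos v); last by rewrite d1; apply: le_lt_trans rho_eta; rewrite ler_piMl // ltW.
    rewrite -Eo; have [? ?] := tarc_ends (arcE _ _ eo).
    by case: vq => ->.
  exists (M (o x y) u); last by lra.
  by rewrite -Eo; exact: (Min u u01).1.
Qed.

End Approximation.

(** * Planar graphs and triangulations *)

Section Planar.
Variable R : realType.
Local Notation pt := (R * R)%type.

Lemma edge_of (G : sgraph) (x y : G) : adj x y -> exists a : edge G, val a = [set x; y]%SET.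
Proof.
move=> xy; have h : [set x; y]%SET \in edge_set G by apply/edge_setP; exists x, y.
by exists (exist (fun A : {set G} => A \in edge_set G) _ h).
Qed.

Definition arc_set (G : sgraph) (D : plane_drawing R G) (x y : G) : set pt :=
  [set z | exists2 a : edge G, val a = [set x; y]%SET & trace (edge_arc D a) z].

Lemma arc_setE (G : sgraph) (D : plane_drawing R G) (x y : G) (a : edge G) :
  val a = [set x; y]%SET -> arc_set D x y = trace (edge_arc D a).
Proof.
move=> aE; apply/seteqP; split=> z; last by exists a.
by case=> b bE; have -> : b = a by apply: val_inj; rewrite bE.
Qed.

Lemma edge_arc_cont (G : sgraph) (D : plane_drawing R G) a : cont01 (edge_arc D a).
Proof. by apply/within_cont01; exact: arc_cont. Qed.

Lemma edge_arc_inj (G : sgraph) (D : plane_drawing R G) a : inj01 (edge_arc D a).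
Proof.
by move=> s t s01 t01; apply: (@arc_inj _ _ D a); rewrite inE /= in_itv.
Qed.

Lemma tarc_rev (S : set pt) p q : tarc S p q -> tarc S q p.
Proof.
case=> f [fc fi f0 f1 SE]; exists (fun t => f (1 + t * (0 - 1))); split.
- exact: cont01_sub (in11 R) (in00 R).
- by apply: inj01_sub (in11 R) (in00 R) _ => //; rewrite oner_eq0.
- by rewrite mul0r addr0.
- by rewrite mul1r addrC subrK.
- by rewrite trace_rev.
Qed.

Lemma plane_drawing_drawing (G : sgraph) (D : plane_drawing R G) :
  drawing tarc (@adj G) (pos D) (arc_set D).
Proof.
have ends (a : edge G) (t : R) : 0 <= t <= 1 -> (exists2 v, v \in val a & edge_arc D a t = pos D v) \/ 0 < t < 1.
  move=> /andP[t0 t1]; have [x [y [aE a0 a1]]] := arc_ends D a.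
  have [->|tn0] := eqVneq t 0; first by left; exists x; rewrite ?aE ?finset.set21.
  have [->|tn1] := eqVneq t 1; first by left; exists y; rewrite ?aE ?finset.set22.
  by right; rewrite !lt_neqAle eq_sym tn0 tn1 t0.
split.
- exact: pos_inj.
- move=> x y xy; have [a aE] := edge_of xy; rewrite (arc_setE D aE).
  have [x' [y' [aE' a0 a1]]] := arc_ends D a.
  have ta : tarc (trace (edge_arc D a)) (pos D x') (pos D y').
    by exists (edge_arc D a); split=> //; [exact: edge_arc_cont|exact: edge_arc_inj].
  by move: aE'; rewrite aE => /set2_eq[[-> ->]|[-> ->]] //; exact: tarc_rev.
- by move=> x y _; rewrite /arc_set finset.setUC.
- move=> x y v xy [a aE [t t01 vE]]; case: (ends a t t01) => [[w wa aw]|ti].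
    move: vE; rewrite aw => /(@pos_inj _ _ D) vw; move: wa; rewrite aE -vw.
    by rewrite finset.in_set2 => /orP[/eqP->|/eqP->]; [left|right].
  by exfalso; apply: (@arc_vertex _ _ D a v t ti).
- move=> x y x' y' z xy xy' [a aE [t t01 zt]] [b bE [s s01 zs]].
  have [ab|ab] := eqVneq a b; first by left; rewrite -aE ab.
  right; case: (ends a t t01) => [[w _ aw]|ti]; first by exists w; rewrite zt.
  case: (ends b s s01) => [[w _ bw]|si]; first by exists w; rewrite zs.
  by exfalso; apply: (@arc_disjoint _ _ D a b t s ab ti si); rewrite -zt.
Qed.

(** The positions and traces of the resulting drawing are recorded because outerplanarity depends on
    the drawing and not only on its existence. *)
Lemma drawing_planar (G : sgraph) (pos : G -> pt) E : drawing tarc (@adj G) pos E ->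
  exists D : plane_drawing R G, Defs.pos D = pos /\
    forall a, exists x y, [/\ val a = [set x; y]%SET, adj x y & trace (edge_arc D a) = E x y].
Proof.
case=> pi arcE symE ver dis.
have /choice[f fP] : forall a : edge G, exists f : R -> pt, [/\ cont01 f, inj01 f &
    exists x y, [/\ val a = [set x; y]%SET, adj x y, f 0 = pos x, f 1 = pos y & trace f = E x y]].
  move=> a; have /edge_setP[x [y [xy aE]]] := valP a.
  have [f [fc fi f0 f1 EE]] := arcE x y xy.
  by exists f; split=> //; exists x, y.
have inner_f a (t : R) v : 0 < t < 1 -> f a t <> pos v.
  move=> /andP[t0 t1] fv; have [fc fi [x [y [aE xy f0 f1 EE]]]] := fP a.
  have t01 : 0 <= t <= 1 by rewrite !ltW.
  have : E x y (pos v) by rewrite -EE -fv; exact: traceT.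
  case/(ver _ _ _ xy) => vE; move: fv; rewrite vE.
    by rewrite -f0 => /(fi _ _ t01 (in00 R)) t00; rewrite t00 ltxx in t0.
  by rewrite -f1 => /(fi _ _ t01 (in11 R)) t11; rewrite t11 ltxx in t1.
have fcont a : {within `[0%R, 1%R], continuous (f a)}.
  by apply/within_cont01; have [] := fP a.
have finj a : {in `[0%R, 1%R]%classic &, injective (f a)}.
  move=> s t; rewrite !inE /= !in_itv /= => s01 t01; have [_ fi _] := fP a.
  exact: fi.
have fends a : exists x y : G,
    [/\ val a = [set x; y]%SET, f a 0%R = pos x & f a 1%R = pos y].
  by have [_ _ [x [y [? ? ? ? ?]]]] := fP a; exists x, y.
have fdis a b (s t : R) : a != b -> (0 < s < 1)%R -> (0 < t < 1)%R -> f a s <> f b t.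
  move=> ab si ti fst.
  have [_ _ [x [y [aE xy _ _ EE]]]] := fP a; have [_ _ [x' [y' [bE xy' _ _ EE']]]] := fP b.
  have h1 : E x y (f a s) by rewrite -EE; apply: traceT; rewrite !ltW //; case/andP: si.
  have h2 : E x' y' (f a s) by rewrite -EE' fst; apply: traceT; rewrite !ltW //; case/andP: ti.
  case: (dis _ _ _ _ _ xy xy' h1 h2) => [S|[v]]; last exact: inner_f.
  by move: ab => /eqP; apply; apply: val_inj; rewrite aE bE.
exists (PlaneDrawing pi fcont finj fends (fun a x t => @inner_f a t x) fdis); split=> // a.
by have [_ _ [x [y [? ? _ _ ?]]]] := fP a; exists x, y.
Qed.

Lemma planarP (G : sgraph) : planar R G <-> exists (pos : G -> pt) E, drawing tarc (@adj G) pos E.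
Proof.
split=> [[D]|[pos [E /drawing_planar[D _]]]]; last by constructor.
by exists (pos D), (arc_set D); exact: plane_drawing_drawing.
Qed.

Lemma planar_vK (G : sgraph) : planar R G -> exists lt : rel G,
  (forall x y, x != y -> lt x y = ~~ lt y x) /\ vK_planar lt (@adj G) [set: G]%SET.
Proof.
move=> /planarP[pos [E [pi arcE symE ver dis]]].
have /choice[f fP] : forall q : G * G, exists f : R -> pt, adj q.1 q.2 ->
    [/\ cont01 f, f 0 = pos q.1, f 1 = pos q.2 & E q.1 q.2 = trace f].
  move=> [x y] /=; have [xy|] := boolP (adj x y); last by exists (fun _ => pos x).
  by have [f [? ? ? ? ?]] := arcE x y xy; exists f.
exists (fun a c => upper (pos c - pos a)); split.
  move=> x y xy; have n0 : pos x - pos y != 0 by rewrite subr_eq0 (inj_eq pi).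
  by rewrite -opprB upperN.
apply: (@drawing_vK_planar _ _ _ _ (fun x y => f (x, y))) => //.
  by move=> a b ab; have [] := fP (a, b) ab.
move=> a b c d ab cd u s t s01 t01 fst.
have [_ _ _ Eab] := fP (a, b) ab; have [_ _ _ Ecd] := fP (c, d) cd.
have h1 : E a b (f (a, b) s) by rewrite Eab; exact: traceT.
have h2 : E c d (f (a, b) s) by rewrite Ecd fst; exact: traceT.
move: u; rewrite /= !inE !negb_or -!andbA.
case/and5P=> _ ac ad bc /and3P[bd _ _].
case: (dis _ _ _ _ _ ab cd h1 h2) => [/set2_eq[[E1 _]|[E1 _]]|[v vE]].
- by rewrite E1 eqxx in ac.
- by rewrite E1 eqxx in ad.
rewrite vE in h1 h2; case: (ver _ _ _ ab h1) => v1; case: (ver _ _ _ cd h2) => v2.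
- by rewrite -v1 v2 eqxx in ac.
- by rewrite -v1 v2 eqxx in ad.
- by rewrite -v1 v2 eqxx in bc.
- by rewrite -v1 v2 eqxx in bd.
Qed.

Lemma triangulation_clique (G : sgraph) (pos : G -> pt) E : triangulation R G ->
  drawing plarc (@adj G) pos E -> forall z x y, touch (@adj G) pos E z (pos x) ->
  touch (@adj G) pos E z (pos y) -> x != y -> adj x y.
Proof.
move=> [_ maxG] dr z x y tx ty xy; apply: contraT => nxy.
have [N pN NF] := face_arc dr xy tx ty.
have [|drN _] := drawing_add (@adj_sym G) dr nxy pN.
  by move=> w /NF[->|->|h]; [exact: Or31|exact: Or32|apply: Or33; exact: (pconn_in h).2].
have sa := add_rel_sym (@adj_sym G) x y; have ia := add_rel_irr (@adj_irr G) xy.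
have sub : subrel (add_rel (@adj G) x y) (@adj G).
  apply: (maxG _ sa ia); first by move=> a b ab; rewrite /add_rel ab.
  by apply/planarP; exists pos, (add_arc E x y N); exact: drawing_pl_t.
by move: nxy; rewrite (sub x y) // /add_rel eqxx orbT.
Qed.

Lemma triangulation_drawing (G : sgraph) : triangulation R G ->
  exists (pos : G -> pt) E, drawing plarc (@adj G) pos E.
Proof.
case=> /planarP[pos [E dr]] _.
have [E' dr' _] := pl_approx (@adj_sym G) (@adj_irr G) dr ltr01.
by exists pos, E'.
Qed.

Lemma exists_not_in (T : finType) (s : seq T) : (size s < #|T|)%N -> exists c, c \notin s.
Proof.
move=> sT; apply/existsP; rewrite -negb_forall; apply/negP => /forallP h.
have : (#|T| <= #|s|)%N by apply: subset_leq_card; apply/fintype.subsetP => x _; exact: h.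
by rewrite leqNgt (leq_ltn_trans (card_size s) sT).
Qed.

Lemma triangulation_common (G : sgraph) (u v : G) : triangulation R G -> (3 < #|G|)%N ->
  adj u v -> (1 < #|[set x | adj u x && adj v x]%SET|)%N.
Proof.
move=> tG G4 uv; have [pos [E dr]] := triangulation_drawing tG.
rewrite ltnNge; apply/negP => C1.
have [a ha] : exists a, forall x, adj u x -> adj v x -> x = a.
  have [C0|[a aC]] := finset.set_0Vmem [set x | adj u x && adj v x]%SET.
    exists u => x ux vx; have : x \in [set x | adj u x && adj v x]%SET by rewrite inE ux.
    by rewrite C0 inE.
  exists a => x ux vx; apply: (card_le1_eqP C1) => //.
  by rewrite inE ux.
have [c] : exists c, c \notin [:: u; v; a] by exact: exists_not_in.
rewrite !inE !negb_or => /and3P[cu cv ca].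
exact: (clique_edge_le1 (@adj_sym G) (@adj_irr G) dr (triangulation_clique tG dr) uv cu cv ca ha).
Qed.

(** Two common neighbours on each edge make the degrees at least 3. A sum of 6 forces exactly the
    configuration of [clique_no_deg3_pair]; K4 shows that a fifth vertex is necessary. *)
Lemma triangulation_degree_sum (G : sgraph) (u v : G) : triangulation R G -> (4 < #|G|)%N ->
  adj u v -> (6 < degree u + degree v)%N.
Proof.
move=> tG G5 uv; have [pos [E dr]] := triangulation_drawing tG.
have com (x y : G) : adj x y -> (2 < degree x)%N /\
    ((degree x <= 3)%N -> exists a b, [/\ a != b, adj y a, adj y b &
      [set z | adj x z]%SET = [set y; a; b]%SET]).
  move=> xy; have C2 := triangulation_common tG (ltnW G5) xy.
  set C := [set z | _]%SET in C2.
  have yC : y \notin C by rewrite inE adj_irr andbF.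
  have sub : (y |: C)%SET \subset [set z | adj x z]%SET.
    by apply/fintype.subsetP => z; rewrite !inE => /orP[/eqP->//|/andP[]].
  have cs := subset_leq_card sub; rewrite cardsU1 yC /= in cs.
  split=> [|d3]; first exact: leq_trans cs.
  have CE : #|C| = 2 by apply/eqP; rewrite eqn_leq C2 andbT -ltnS -add1n; exact: leq_trans d3.
  have /cards2P[a [b [ab Cab]]] : #|C| == 2 by rewrite CE.
  exists a, b; split=> //.
  - have : a \in C by rewrite Cab finset.set21.
    by rewrite inE => /andP[].
  - have : b \in C by rewrite Cab finset.set22.
    by rewrite inE => /andP[].
  - apply/esym/eqP; rewrite -finset.setUA -Cab eqEcard sub cardsU1 yC CE; exact: d3.
rewrite ltnNge; apply/negP => sum6.
have [du hu] := com u v uv; have [dv hv] := com v u ltac:(by rewrite adj_sym).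
have d3u : (degree u <= 3)%N by lia.
have [a [b [ab va vb Nu]]] := hu d3u.
have d3v : (degree v <= 3)%N by lia.
have nu x : adj u x -> [\/ x = v, x = a | x = b].
  have -> : adj u x = (x \in [set z | adj u z]%SET) by rewrite inE.
  rewrite Nu !inE => /orP[/orP[]|] /eqP->; [exact: Or31|exact: Or32|exact: Or33].
have Nin x : x \in [set v; a; b]%SET -> adj u x by rewrite -Nu inE.
have ua : adj u a by apply: Nin; rewrite !inE eqxx orbT.
have ub : adj u b by apply: Nin; rewrite !inE eqxx orbT.
have ne (x y : G) : adj x y -> x != y by apply: contraTneq => ->; rewrite adj_irr.
have nv x : adj v x -> [\/ x = u, x = a | x = b].
  have [a' [b' [ab' ua' ub' Nv]]] := hv d3v.
  have inN y : (y \in [set z | adj v z]%SET) = (y \in [set u; a; b]%SET).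
    suff -> : [set z | adj v z]%SET = [set u; a; b]%SET by [].
    apply/esym/eqP; rewrite eqEcard; apply/andP; split.
      by apply/fintype.subsetP => z; rewrite !inE => /orP[/orP[]|] /eqP-> //; rewrite adj_sym.
    rewrite -finset.setUA cardsU1 cards2 ab !inE negb_or (ne _ _ ua) (ne _ _ ub).
    exact: d3v.
  have -> : adj v x = (x \in [set z | adj v z]%SET) by rewrite inE.
  rewrite inN !inE => /orP[/orP[]|] /eqP->; [exact: Or31|exact: Or32|exact: Or33].
(* The edge [ua] has two common neighbours, and the only candidates are [v] and [b]. *)
have eab : adj a b.
  have C2 := triangulation_common tG (ltnW G5) ua.
  apply: contraLR C2 => nab; rewrite -leqNgt; apply/card_le1_eqP => x y.
  have only z : z \in [set z | adj u z && adj a z]%SET -> z = v.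
    rewrite inE => /andP[/nu[->//|->|->]]; first by rewrite adj_irr.
    by rewrite (negbTE nab).
  by move=> /only-> /only->.
have [c] : exists c, c \notin [:: u; v; a; b] by exact: exists_not_in.
rewrite !inE !negb_or => /and4P[cu cv ca cb].
apply: (clique_no_deg3_pair (@adj_sym G) (@adj_irr G) dr (triangulation_clique tG dr) uv eab nu nv
  (c := c)).
rewrite /= !inE !negb_or (ne _ _ uv) (ne _ _ ua) (ne _ _ ub) (ne _ _ va) (ne _ _ vb) ab.
by rewrite !(eq_sym _ c) cu cv ca cb.
Qed.

End Planar.

(** * Maximal outerplanar graphs *)

Section Plane.
Variable R : realType.
Local Notation pt := (R * R)%type.

Lemma nbhs_ptP (z : pt) (A : set pt) :
  nbhs z A <-> exists2 r : R, 0 < r & forall w : pt, `|w - z| < r -> A w.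
Proof.
split=> [/nbhs_ballP[r r0 h]|[r r0 h]].
  by exists r => // w wr; apply: h; rewrite -ball_normE /= distrC.
by apply/nbhs_ballP; exists r => // w; rewrite -ball_normE /= distrC; exact: h.
Qed.

Lemma open_ptP (A : set pt) : (forall z, A z -> exists2 r : R, 0 < r &
  forall w : pt, `|w - z| < r -> A w) -> open A.
Proof. by move=> h; rewrite openE => z /h/nbhs_ptP. Qed.

Lemma pconn_ball (X : set pt) (z w : pt) (r : R) : (forall w, `|w - z| < r -> X w) ->
  `|w - z| < r -> pconn X z w.
Proof.
move=> h wr; apply: pconn1 => t t01; apply: h; apply: seg_ball => //.
by rewrite subrr normr0; apply: le_lt_trans wr.
Qed.

(** The polygonally reachable points are open and closed in the component. This links the outer
    face, which is defined by components, with chains. *)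
Lemma component_pconn (K : set pt) (z w : pt) : closedE K ->
  connected_component (~` K) z w -> pconn (~` K) z w.
Proof.
move=> Kc zw; set C := connected_component (~` K) z in zw.
have CK : C `<=` ~` K by exact: connected_component_sub.
have nKz : ~ K z.
  by move=> Kz; move: zw; rewrite /C connected_component_out //=; apply; exact.
have Cz : C z by exact: connected_component_refl.
have Cc : connected C by exact: component_connected.
pose B := [set y | pconn (~` K) z y].
suff CB : C `&` B = C by have [] : (C `&` B) w by rewrite CB.
apply: Cc.
- by exists z; split=> //; exact: pconn0.
- exists B => //; apply: open_ptP => y zy.
  have [r r0 h] := Kc y (pconn_in zy).2; exists r => // v vr.
  by apply: pconn_trans zy _; exact: pconn_ball h vr.
- exists (~` [set y | ~ K y /\ ~ pconn (~` K) z y]).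
    apply: open_closedC; apply: open_ptP => y [nKy nzy].
    have [r r0 h] := Kc y nKy; exists r => // v vr; split; first exact: h.
    by move=> zv; apply: nzy; apply: pconn_trans zv _; apply: pconn_sym; exact: pconn_ball h vr.
  apply/seteqP; split=> y [Cy h]; split=> //; first by case.
  by apply: contrapT => nzy; apply: h; split=> //; exact: CK.
Qed.

Lemma pconn_margin (K : set pt) (a b : pt) : closedE K -> pconn (~` K) a b ->
  exists2 r : R, 0 < r & pconn [set w | forall k, K k -> r <= `|w - k|] a b.
Proof.
move=> Kc; elim=> [p nKp|p q b' h _ [r r0 hr]].
  have [r r0 hr] := Kc p nKp; exists r => //; apply: pconn0 => k Kk /=.
  by rewrite leNgt; apply/negP; rewrite distrC => /hr.
have [r1 r10 h1] : exists2 r1 : R, 0 < r1 & forall t : R, 0 <= t <= 1 -> forall k, K k ->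
    r1 <= `|seg p q t - k|.
  apply: (@cousin _ (fun x y => exists2 r1 : R, 0 < r1 & forall t : R, x <= t <= y ->
    forall k, K k -> r1 <= `|seg p q t - k|) 0 1 ler01).
    move=> t t01; have [r2 r20 h2] := Kc _ (h t t01).
    have [|d d0 hd] := loclin_cont (seg_loclin p q) t01 (e := r2 / 2); first by lra.
    exists d => // x y x0 xt ty y1 yx; exists (r2 / 2); first by lra.
    move=> s /andP[xs sy] k Kk; rewrite leNgt; apply/negP => lt; apply: (h2 k) Kk.
    have -> : k - seg p q t = - (seg p q s - k) + (seg p q s - seg p q t).
      by rewrite opprB addrA subrK.
    apply: le_lt_trans (ler_normD _ _) _; rewrite normrN.
    have : `|seg p q s - seg p q t| < r2 / 2 by apply: hd; [lra|rewrite ltr_norml; lra].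
    lra.
  move=> x y z _ xy yz _ [d1 d10 h1] [d2 d20 h2]; exists (Num.min d1 d2).
    by rewrite lt_min d10.
  move=> t /andP[xt tz] k Kk; rewrite ge_min; apply/orP.
  by case: (leP t y) => ty; [left; apply: h1|right; apply: h2] => //; lra.
exists (Num.min r r1); first by rewrite lt_min r0.
apply: (@pconnS _ _ _ q) => [t t01 k Kk|]; first by rewrite /= ge_min h1 ?orbT.
by apply: pconn_sub hr => w hw k Kk /=; rewrite ge_min hw.
Qed.

Lemma far_pconn (M : R) (z w : pt) : 0 <= M -> M < `|z| -> M < `|w| ->
  pconn [set v : pt | M < `|v|] z w.
Proof.
move=> M0.
have go (v : pt) : M < `|v| -> pconn [set v : pt | M < `|v|] v (0, M + 1).
  have big1 (p q : pt) : M < `|p.1| -> p.1 = q.1 -> pconn [set v : pt | M < `|v|] p q.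
    move=> pM pq; apply: pconn1 => t t01 /=; rewrite prod_normE lt_max segE /= -pq.
    by rewrite subrr mulr0 addr0 pM.
  have big2 (p q : pt) : M < `|p.2| -> p.2 = q.2 -> pconn [set v : pt | M < `|v|] p q.
    move=> pM pq; apply: pconn1 => t t01 /=; rewrite prod_normE lt_max segE /= -pq.
    by rewrite subrr mulr0 addr0 pM orbT.
  have M1 : M < `|M + 1| by rewrite ger0_norm; lra.
  rewrite prod_normE lt_max => /orP[v1|v2].
    by apply: (@pconn_trans _ _ _ (v.1, M + 1)); [exact: big1|exact: big2].
  apply: (@pconn_trans _ _ _ (M + 1, v.2)); first exact: big2.
  by apply: (@pconn_trans _ _ _ (M + 1, M + 1)); [exact: big1|exact: big2].
by move=> zM wM; apply: pconn_trans (go z zM) _; apply: pconn_sym; exact: go.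
Qed.

(** The chain is followed to its first point on [N]; the part before that point also avoids [N]. It
    controls what happens to a face when an arc is added. *)
Lemma pconn_refine (K N : set pt) (a b : pt) : closedE N -> ~ N a -> pconn (~` K) a b ->
  pconn (~` (K `|` N)) a b \/
  exists y, [/\ N y, ~ K y & cl [set z | pconn (~` (K `|` N)) a z] y].
Proof.
move=> Nc + ab; elim: ab => [p nK nN|p q b' h _ IH nNp].
  by left; apply: pconn0 => -[].
have [[t t01 Nt]|no] := pselect (exists2 t : R, 0 <= t <= 1 & N (seg p q t)); last first.
  have st : forall t : R, 0 <= t <= 1 -> (~` (K `|` N)) (seg p q t).
    by move=> t t01 [/(h t t01)//|Nt]; apply: no; exists t.
  have nNq : ~ N q by move=> Nq; apply: no; exists 1; rewrite ?seg1 //; exact: in11.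
  case: (IH nNq) => [c|[y [Ny nKy cy]]]; first by left; exact: pconnS st c.
  right; exists y; split=> // r r0; have [z zr cz] := cy r r0; exists z => //.
  exact: pconnS st cz.
right; pose g (u : R) := seg p q (0 + u * (t - 0)).
have gc : cont01 g by apply: cont01_sub (loclin_cont (seg_loclin p q)) (in00 R) t01.
have [|s [s01 Ns hs]] := first_hit gc Nc; first by rewrite /g mul1r subr0 add0r.
have inK (u : R) : 0 <= u <= 1 -> ~ K (g u).
  by move=> u01; apply: h; exact: in01_affine (in00 R) t01 u01.
exists (g s); split=> //; first exact: inK.
have s0 : 0 < s.
  rewrite lt_neqAle eq_sym; apply/andP; split; last by case/andP: s01.
  by apply/eqP => s0; apply: nNp; move: Ns; rewrite s0 /g mul0r addr0 seg0.
have gE u : g u = seg p (g s) (u / s).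
  rewrite /g !add0r !subr0 seg_seg; congr seg; field.
  by rewrite gt_eqF.
have := @pconn_arrive _ (~` (K `|` N)) p (g s); apply => u /andP[u0 u1].
have <- : g (u * s) = seg p (g s) u by rewrite gE mulfK // gt_eqF.
have us : 0 <= u * s < s by move: s01 => /andP[? ?]; nra.
by case=> [|/(hs _ us)//]; apply: inK; move: s01 us => /andP[? ?] /andP[? ?]; lra.
Qed.

End Plane.

(** * Drawing the edges at the apex *)

Section Apex.
Variable R : realType.
Local Notation pt := (R * R)%type.
Variable T : finType.
Implicit Types (e : rel (option T)) (pos : option T -> pt).

(** The invariant under which the edges at the apex can be drawn one after the other. *)
Definition co_face e pos E (x : T) :=
  exists w, touch e pos E w (pos None) /\ touch e pos E w (pos (Some x)).

(** If the new arc [N] cuts the face near [x], the part of the face at [x] touches [N] at an inner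
    point, hence both ends of [N], and one of these is the apex. *)
Lemma co_face_add e pos (E : option T -> option T -> set pt) (x1 : T) :
  symmetric e -> irreflexive e -> drawing plarc e pos E -> ~~ e None (Some x1) ->
  (forall x, ~~ e None (Some x) -> co_face e pos E x) ->
  exists E', drawing plarc (add_rel e None (Some x1)) pos E' /\
    forall x, ~~ add_rel e None (Some x1) None (Some x) ->
      co_face (add_rel e None (Some x1)) pos E' x.
Proof.
move=> se ie dr n1 inv; set e' := add_rel _ _ _.
have se' : symmetric e' by exact: add_rel_sym.
have [w0 [t0 t1]] := inv x1 n1.
have [N pN NF] := face_arc dr (isT : None != Some x1) t0 t1.
have [|dr' D'E] := drawing_add se dr n1 pN.
  by move=> z /NF[->|->|h]; [exact: Or31|exact: Or32|apply: Or33; exact: (pconn_in h).2].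
exists (add_arc E None (Some x1) N); split=> // x nx.
rewrite -/e' in dr' D'E; set E' := add_arc _ _ _ _ in dr' D'E *.
have [nex xx1] : ~~ e None (Some x) /\ x <> x1.
  move: nx; rewrite /e' /add_rel negb_or => /andP[-> h]; split=> // xE.
  by rewrite xE eqxx in h.
have [w [tn tx]] := inv x nex.
have Nc := tarc_closedE (plarc_tarc pN).
have pi := let: And5 h _ _ _ _ := dr in h.
have nNx : ~ N (pos (Some x)).
  case/NF => [/pi//|/pi[]//|h]; apply: (pconn_in h).2; exact: pos_drawn.
have [r1 r10 h1] := near_touch dr' (pos (Some x)).
have [r2 r20 h2] := Nc _ nNx.
have [|v vr fv] := tx (Num.min r1 r2); first by rewrite lt_min r10.
move: vr; rewrite lt_min => /andP[v1 v2].
have nDv : ~ drawn e pos E v := (pconn_in fv).2.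
exists v; split; last by apply: h1 => //; rewrite D'E => -[//|]; exact: h2.
have fromv b : face e pos E w b -> pconn (~` drawn e pos E) v b.
  by move=> fb; apply: pconn_trans (pconn_sym fv) fb.
have [[b fb nb]|all_b] := pselect (exists2 b, face e pos E w b &
    ~ pconn (~` (drawn e pos E `|` N)) v b); last first.
  move=> r r0; have [b br fb] := tn r r0; exists b => //.
  rewrite /face D'E; apply: contrapT => nb; apply: all_b; exists b => //.
case: (pconn_refine Nc (h2 v v2) (fromv b fb)) => [//|[y [Ny nDy cy]]].
have e1 : e' None (Some x1) by rewrite /e' /add_rel eqxx orbT.
have E1 : E' None (Some x1) = N by rewrite /E' /add_arc eqxx.
have [] // := edge_touch se' dr' (x := None) (y := Some x1) (z := y) (z0 := v) e1.
- by rewrite E1.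
- by move=> u yu; apply: nDy; rewrite yu; exact: pos_drawn.
- by rewrite /touch /face D'E.
Qed.

(** The apex is first placed at [zoo] as an isolated vertex; its edges are then added along a list
    of the vertices. *)
Lemma apex_drawing (f : rel T) (p0 : T -> pt) (E0 : T -> T -> set pt) (zoo : pt) :
  symmetric f -> irreflexive f -> drawing plarc f p0 E0 -> ~ drawn f p0 E0 zoo ->
  (forall x, touch f p0 E0 zoo (p0 x)) ->
  forall e : rel (option T), symmetric e -> irreflexive e ->
  (forall x, e None (Some x)) -> (forall x y, e (Some x) (Some y) = f x y) ->
  exists pos E, drawing plarc e pos E.
Proof.
move=> sf if_ dr nDz tz e se ie eN eS.
pose pos (x : option T) := if x is Some y then p0 y else zoo.
pose base : rel (option T) := fun x y => if x is Some a then if y is Some b then f a b else false else false.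
pose Eb (x y : option T) := if x is Some a then if y is Some b then E0 a b else set0 else set0.
suff [E [e' [drE se' ie' e'S e'N]]] : exists E e', [/\ drawing plarc e' pos E, symmetric e',
    irreflexive e', (forall x y, e' (Some x) (Some y) = f x y) &
    forall x, e' None (Some x)].
  exists pos, E; suff -> : e = e' by [].
  apply/funext => -[x|]; apply/funext => -[y|]; rewrite ?ie ?ie' ?eS ?e'S ?eN ?e'N //.
  by rewrite se eN se' e'N.
suff H (s : seq T) : exists E e', [/\ drawing plarc e' pos E, symmetric e',
    irreflexive e', (forall x y, e' (Some x) (Some y) = f x y) &
    (forall x, x \in s -> e' None (Some x)) /\
    forall x, ~~ e' None (Some x) -> co_face e' pos E x].
  have [E [e' [? ? ? ? [h _]]]] := H (enum T); exists E, e'; split=> // x.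
  by apply: h; rewrite mem_enum.
elim: s => [|x1 s [E [e' [drE se' ie' e'S [e's inv]]]]]; last first.
  have [e1|n1] := boolP (e' None (Some x1)).
    by exists E, e'; split=> //; split=> // x; rewrite inE => /orP[/eqP->|/e's].
  have [E' [dr' inv']] := co_face_add se' ie' drE n1 inv.
  exists E', (add_rel e' None (Some x1)); split=> //.
  - exact: add_rel_sym.
  - exact: add_rel_irr.
  - move=> x y; rewrite /add_rel e'S; case: eqP => [/set2_eq|_]; last by rewrite orbF.
    by case=> -[].
  - split=> // x; rewrite inE => /orP[/eqP->|/e's h]; rewrite /add_rel ?eqxx ?orbT //.
    by rewrite h.
have [pi arcE symE ver dis] := dr.
have sb : symmetric base by move=> [x|] [y|] //=.
have drb : drawing plarc base pos Eb.
  split.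
  - move=> [x|] [y|] //= h; first by rewrite (pi _ _ h).
      by exfalso; apply: nDz; rewrite -h; exact: pos_drawn.
    by exfalso; apply: nDz; rewrite h; exact: pos_drawn.
  - by move=> [x|] [y|] //=; exact: arcE.
  - by move=> [x|] [y|] //=; exact: symE.
  - move=> [x|] [y|] [v|] //= h; first by case/(ver _ _ _ h) => ->; [left|right].
    by move=> Ez; exfalso; apply: nDz; right; exists x, y.
  - move=> [x|] [y|] [x'|] [y'|] //= z h h' h1 h2.
    case: (dis _ _ _ _ _ h h' h1 h2) => [/set2_eq[[-> ->]|[-> ->]]|[v ->]].
    + by left.
    + by left; rewrite finset.setUC.
    + by right; exists (Some v).
have DbE : drawn base pos Eb = drawn f p0 E0 `|` [set zoo].
  apply/seteqP; split=> z.
    case=> [[[v|] ->]|[[x|] [[y|] [//= h Ez]]]].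
    - by left; exact: pos_drawn.
    - by right.
    - by left; right; exists x, y.
  case=> [[[v ->]|[x [y [h Ez]]]]|->].
  - by left; exists (Some v).
  - by right; exists (Some x), (Some y).
  - by left; exists None.
exists Eb, base; split=> //; first by move=> [x|] //=.
split=> // x _.
have Zc : closedE [set zoo].
  move=> z /= zz; exists `|z - zoo|; first by rewrite normr_gt0 subr_eq0; apply/eqP.
  by move=> w h /= wE; move: h; rewrite wE distrC ltxx.
have xz : p0 x <> zoo by move=> h; apply: nDz; rewrite -h; exact: pos_drawn.
have [r1 r10 h1] := near_touch drb (p0 x).
have [r2 r20 h2] := Zc _ xz.
have [|v vr fv] := tz x (Num.min r1 r2); first by rewrite lt_min r10.
move: vr; rewrite lt_min => /andP[v1 v2].
exists v; split.
  case: (pconn_refine Zc (h2 v v2) (pconn_sym fv)) => [h|[y [/= -> _ cy]]].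
    by have [_ []] := pconn_in h; right.
  by rewrite /touch /face DbE.
apply: h1 => //; rewrite DbE => -[Dv|]; last exact: h2.
by have [_] := pconn_in fv.
Qed.

End Apex.

(** * From an outerplanar drawing to a planar drawing with apex *)

Section Outerplanar.
Variable R : realType.
Local Notation pt := (R * R)%type.

Lemma drawn_setE (G : sgraph) (D : plane_drawing R G) :
  drawn_set D = drawn (@adj G) (pos D) (arc_set D).
Proof.
apply/seteqP; split=> z.
  case=> [[v _ <-]|[a _ [t t01 <-]]]; first by left; exists v.
  have /edge_setP[x [y [xy aE]]] := valP a; right; exists x, y; split=> //.
  by exists a => //; exists t => //; move: t01; rewrite /= in_itv.
case=> [[v ->]|[x [y [xy [a aE [t t01 ->]]]]]]; first by left; exists v.
by right; exists a => //; exists t => //; rewrite /= in_itv.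
Qed.

Lemma tarc_bounded (S : set pt) p q : tarc S p q -> exists M : R, forall z, S z -> `|z| <= M.
Proof.
case=> f [fc _ _ _ ->].
suff [M h] : exists M : R, forall t : R, 0 <= t <= 1 -> `|f t| <= M.
  by exists M => _ [t t01 ->]; exact: h.
apply: (@cousin _ (fun x y => exists M : R, forall t : R, x <= t <= y -> `|f t| <= M) 0 1 ler01).
  move=> t t01; have [d d0 hd] := fc t t01 1 ltr01; exists d => // x y x0 xt ty y1 yx.
  exists (`|f t| + 1) => s /andP[xs sy].
  have : `|f s - f t| < 1 by apply: hd; [lra|rewrite ltr_norml; lra].
  have := lerB_dist (f s) (f t); lra.
move=> x y z _ xy yz _ [M1 h1] [M2 h2]; exists (Num.max M1 M2) => t /andP[xt tz].
by rewrite le_max; apply/orP; case: (leP t y) => ty; [left; apply: h1|right; apply: h2]; lra.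
Qed.

Lemma drawn_bounded (V : finType) (e : rel V) pos E : drawing tarc e pos E ->
  exists2 M : R, 0 <= M & forall z, drawn e pos E z -> `|z| <= M.
Proof.
move=> dr; have [_ arcE _ _ _] := dr.
have [|r r0 h] := @fin_eps R (V + V * V)%type (fun k r => forall z, piece e pos E k z -> `|z| <= r^-1).
  move=> k; have [M hM] : exists M : R, forall z, piece e pos E k z -> `|z| <= M.
    case: k => [v|[x y]]; first by exists `|pos v| => z /= ->.
    have [xy|nxy] := boolP (e x y); last by exists 0 => z [xy]; rewrite xy in nxy.
    by have [M hM] := tarc_bounded (arcE x y xy); exists M => z [_ /hM].
  have M0 : 0 < `|M| + 1 by have := normr_ge0 M; lra.
  exists (`|M| + 1)^-1; first by rewrite invr_gt0.
  move=> r r0 rM z /hM zM; apply: le_trans zM _.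
  apply: (@le_trans _ _ (`|M| + 1)); first by have := ler_norm M; lra.
  by rewrite -[leLHS]invrK lef_pV2 ?posrE // invr_gt0.
exists r^-1; first by rewrite invr_ge0 ltW.
by move=> z; rewrite drawnE => -[k kz]; exact: (h k r r0 (lexx _)).
Qed.

Lemma bounded_setP (A : set pt) (M : R) : (forall z, A z -> `|z| <= M) -> bounded_set A.
Proof.
move=> h; exists M; split; first exact: num_real.
by move=> N MN z Az; apply: le_trans (h z Az) _; exact: ltW.
Qed.

Lemma bounded_setE (A : set pt) : bounded_set A -> exists M : R, forall z, A z -> `|z| <= M.
Proof.
case=> M [_ h]; exists (M + 1) => z Az; apply: (h (M + 1)) => //.
by rewrite ltrDl.
Qed.

(** The polygonal replacement has to keep every vertex on the outer face. Close to each vertex there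
    is an outer point with a chain to far away; an approximation finer than the margin of all these
    chains cannot cut them. *)
Lemma outerplanar_apex (G : sgraph) (e : rel (option G)) (es : symmetric e)
    (ei : irreflexive e) : outerplanar R G -> (forall x, e None (Some x)) ->
  (forall x y, e (Some x) (Some y) = adj x y) -> planar R (SGraph es ei).
Proof.
move=> [D outD] eN eS; have drt := plane_drawing_drawing D.
set p0 := pos D in outD drt *; set E := arc_set D in drt.
have DE := drawn_setE D; rewrite -/p0 -/E in DE.
set K := drawn _ _ _ in DE.
have Kc : closedE K by exact: drawn_closed.
have [M M0 KM] := drawn_bounded drt.
have [pi arcE symE ver dis] := drt.
(* Closer than [2 * r0] to a vertex there are no other vertices and only edges at this vertex. *)
have [r0 r00 [r0V r0E]] : exists2 r0 : R, 0 < r0 &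
   (forall x y, x != y -> 2 * r0 <= `|p0 x - p0 y|) /\
   (forall x y v w, adj x y -> v != x -> v != y -> E x y w -> 2 * r0 <= `|w - p0 v|).
  have [|r rp hr] := @fin_eps R (G + G * G)%type (fun k r => forall v,
     ~ piece (@adj G) p0 E k (p0 v) -> forall w, piece (@adj G) p0 E k w -> 2 * r <= `|w - p0 v|).
    move=> k; have [|r rp hr] := @fin_eps R G (fun v r => ~ piece (@adj G) p0 E k (p0 v) ->
       forall w, piece (@adj G) p0 E k w -> 2 * r <= `|w - p0 v|).
      move=> v; have [kv|nkv] := pselect (piece (@adj G) p0 E k (p0 v)); first by exists 1.
      have [r rp h] := piece_closed drt nkv; exists (r / 2); first by lra.
      move=> r' _ r'r _ w kw; rewrite leNgt; apply/negP => lt; apply: (h w) kw; lra.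
    by exists r => // r' r'0 r'r v; exact: hr.
  have hr' k := hr k r rp (lexx _); exists r => //; split.
    move=> x y xy; apply: (hr' (inl x) y) => //= /pi/eqP; rewrite eq_sym; exact/negP.
  move=> x y v w xy vx vy Ew; apply: (hr' (inr (x, y)) v) => //=.
  by case=> _ /(ver _ _ _ xy)[/eqP|/eqP]; apply/negP.
have /choice[x' x'P] : forall x, exists x' : pt, `|x' - p0 x| < r0 /\ exists2 b : pt,
    M + 1 < `|b| & pconn (~` K) x' b.
  move=> x; have [|x' [[nKx unb] x'r]] := outD x [set w | `|w - p0 x| < r0].
    by apply/nbhs_ptP; exists r0.
  exists x'; split=> //; apply: contrapT => nob; apply: unb.
  apply: (@bounded_setP _ (M + 1)) => z; rewrite DE => cz; rewrite leNgt; apply/negP => zM.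
  by apply: nob; exists z => //; apply: component_pconn.
have [eta eta0 etaP] : exists2 eta : R, 0 < eta & forall x (r : R), 0 < r -> r <= eta ->
    exists2 b : pt, M + 1 < `|b| & pconn [set w | forall k, K k -> r <= `|w - k|] (x' x) b.
  apply: fin_eps => x; have [_ [b bM xb]] := x'P x.
  have [r rp h] := pconn_margin Kc xb; exists r => // r' r'0 r'r; exists b => //.
  by apply: pconn_sub h => w hw k Kk /=; apply: le_trans r'r _; exact: hw.
pose eps := Num.min (Num.min eta r0) 1.
have eps0 : 0 < eps by rewrite !lt_min eta0 r00 ltr01.
have [E' dr near] := pl_approx (@adj_sym G) (@adj_irr G) drt eps0.
set K' := drawn (@adj G) p0 E'.
have nearK z : K' z -> exists2 k, K k & `|z - k| < eps.
  case=> [[v ->]|[x [y [xy Ez]]]].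
    by exists (p0 v); [exact: pos_drawn|rewrite subrr normr0].
  by have [w Ew zw] := near x y z xy Ez; exists w => //; right; exists x, y.
have K'M z : K' z -> `|z| < M + 1.
  case/nearK=> k /KM kM zk.
  have e1 : eps <= 1 by rewrite ge_min lexx orbT.
  by have := lerB_dist z k; lra.
(* All points of norm above [M + 1] lie in one face of the new drawing, and [zoo] represents it. *)
pose zoo : pt := (0, M + 2).
have zooM : M + 1 < `|zoo| by rewrite prod_normE lt_max; apply/orP; right; rewrite /= ger0_norm; lra.
have nKzoo : ~ K' zoo by move/K'M; lra.
have farK : [set v : pt | M + 1 < `|v|] `<=` ~` K' by move=> v /= vM /K'M; lra.
have x'zoo x : pconn (~` K') zoo (x' x).
  have e1 : eps <= eta by rewrite !ge_min lexx.
  have [b bM xb] := etaP x eps eps0 e1.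
  apply: (@pconn_trans _ _ _ b).
    by apply: pconn_sub farK _; apply: far_pconn => //; lra.
  apply: pconn_sym; apply: pconn_sub xb => w hw /nearK[k Kk wk].
  by have := hw k Kk; lra.
have K'c : closedE K' by apply: drawn_closed; exact: drawing_pl_t.
(* Going straight from [x' x] to the vertex, the first point of the new drawing is the vertex itself
   or lies on an edge at it; in both cases the face touches the vertex. *)
have tz x : touch (@adj G) p0 E' zoo (p0 x).
  have [x'r _] := x'P x; apply: (touch_pconn (pconn_sym (x'zoo x))).
  have gc := loclin_cont (seg_loclin (x' x) (p0 x)).
  have [|s [s01 Ks hs]] := first_hit gc K'c; first by rewrite seg1; exact: pos_drawn.
  have nKx' : ~ K' (x' x) by have [] := pconn_in (x'zoo x).
  have ts : touch (@adj G) p0 E' (x' x) (seg (x' x) (p0 x) s).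
    apply: pconn_arrive => u /andP[u0 u1]; rewrite seg_seg; apply: hs.
    have s0 : 0 < s.
      rewrite lt_neqAle eq_sym; apply/andP; split; last by case/andP: s01.
      by apply/eqP => s0; apply: nKx'; move: Ks; rewrite s0 seg0.
    by nra.
  have yr : `|seg (x' x) (p0 x) s - p0 x| < r0.
    by apply: seg_ball => //; rewrite subrr normr0.
  set y := seg _ _ _ in Ks ts yr.
  have [iy|/existsNP[v /contrapT yv]] := pselect (inner p0 y); last first.
    have [xv|xv] := eqVneq v x; first by move: ts; rewrite yv xv.
    by exfalso; apply: (@abs10 R); have := r0V v x xv; rewrite -yv; lra.
  case: Ks => [[v /iy//]|[a [b [ab Ey]]]].
  have [w Ew yw] := near a b y ab Ey.
  have er : eps <= r0 by rewrite !ge_min lexx orbT.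
  have wx : `|w - p0 x| < 2 * r0.
    have -> : w - p0 x = - (y - w) + (y - p0 x) by rewrite opprB addrA subrK.
    by apply: le_lt_trans (ler_normD _ _) _; rewrite normrN; lra.
  have [ta tb] := edge_touch (@adj_sym G) dr ab Ey iy ts.
  have [xa|xa] := eqVneq x a; first by move: ta; rewrite -xa.
  have [xb|xb] := eqVneq x b; first by move: tb; rewrite -xb.
  by exfalso; apply: (@abs10 R); have := r0E a b x w ab xa xb Ew; lra.
have [pos [E2 dr2]] := apex_drawing (@adj_sym G) (@adj_irr G) dr nKzoo tz es ei eN eS.
by apply/planarP; exists pos, E2; exact: drawing_pl_t.
Qed.

End Outerplanar.

(** * Inversion and removal of the apex *)

Section Inversion.
Variable R : realType.
Local Notation pt := (R * R)%type.

Definition sqn (w : pt) : R := w.1 * w.1 + w.2 * w.2.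
(** Inversion in the unit circle around [a], followed by the translation of [a] to 0. It needs the
    Euclidean [sqn], the norm of the plane being the maximum norm. *)
Definition inversion (a z : pt) : pt := (sqn (z - a))^-1 *: (z - a).

Lemma sqn_gt0 (w : pt) : w != 0 -> 0 < sqn w.
Proof.
case: w => x y w0; rewrite /sqn /=.
have [x0|x0] := eqVneq x 0.
  have y0 : y != 0 by apply: contra_neq w0 => ->; rewrite x0.
  by rewrite x0 mul0r add0r -expr2 exprn_even_gt0.
have : 0 < x * x by rewrite -expr2 exprn_even_gt0.
have : 0 <= y * y by rewrite -expr2 sqr_ge0.
lra.
Qed.

Lemma sqnZ (k : R) (w : pt) : sqn (k *: w) = k ^+ 2 * sqn w.
Proof. by rewrite /sqn scaleE /=; ring. Qed.

Lemma inversion_inj (a z z' : pt) : z <> a -> z' <> a ->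
  inversion a z = inversion a z' -> z = z'.
Proof.
move=> za za' E.
have w0 : z - a != 0 by rewrite subr_eq0; apply/eqP.
have w0' : z' - a != 0 by rewrite subr_eq0; apply/eqP.
have n0 := sqn_gt0 w0; have n0' := sqn_gt0 w0'.
have nE : sqn (z - a) = sqn (z' - a).
  have := congr1 sqn E; rewrite !sqnZ !exprVn !expr2 !invfM -!mulrA.
  by rewrite !mulVf ?gt_eqF // !mulr1 => /invr_inj.
by move: E; rewrite /inversion nE => /(scalerI (invr_neq0 (lt0r_neq0 n0')))/(addIr _).
Qed.

(** The factor 2 comes from comparing the squared Euclidean norm with the square of the maximum
    norm. *)
Lemma inversion_big (a z : pt) (M : R) : z <> a -> 0 <= M ->
  `|z - a| < (2 * (M + 1))^-1 -> M < `|inversion a z|.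
Proof.
move=> za M0 zM.
have w0 : z - a != 0 by rewrite subr_eq0; apply/eqP.
have n0 := sqn_gt0 w0; have p0 : 0 < `|z - a| by rewrite normr_gt0.
rewrite /inversion normrZ gtr0_norm ?invr_gt0 // mulrC ltr_pdivlMr //.
have nle : sqn (z - a) <= 2 * (`|z - a| * `|z - a|).
  have sq (x b : R) : `|x| <= b -> x * x <= b * b.
    by rewrite ler_norml => /andP[? ?]; nra.
  have h1 : `|(z - a).1| <= `|z - a| by rewrite prod_normE le_max lexx.
  have h2 : `|(z - a).2| <= `|z - a| by rewrite prod_normE le_max lexx orbT.
  by rewrite /sqn; have := sq _ _ h1; have := sq _ _ h2; lra.
have : `|z - a| * (2 * (M + 1)) < 1.
  by rewrite -ltr_pdivlMr ?div1r //; lra.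
by nra.
Qed.

Lemma inversion_cont (a z : pt) : z <> a -> forall r : R, 0 < r -> exists2 d : R, 0 < d &
  forall w : pt, `|w - z| < d -> `|inversion a w - inversion a z| < r.
Proof.
move=> za r r0.
have n0 : sqn (z - a) != 0.
  by rewrite gt_eqF // sqn_gt0 // subr_eq0; apply/eqP.
have c1 : (fun w : pt => (w - a).1) w @[w --> z] --> (z - a).1.
  by apply: cvgB; [exact: cvg_fst|exact: cvg_cst].
have c2 : (fun w : pt => (w - a).2) w @[w --> z] --> (z - a).2.
  by apply: cvgB; [exact: cvg_snd|exact: cvg_cst].
have cs : sqn (w - a) @[w --> z] --> sqn (z - a).
  by apply: cvgD; apply: cvgM.
have cw : (w - a) @[w --> z] --> z - a.
  by apply: cvgB; [exact: cvg_id|exact: cvg_cst].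
have ci : inversion a w @[w --> z] --> inversion a z.
  by apply: cvgZ cw; exact: cvgV.
have /cvgrPdist_lt/(_ r r0) := ci.
by move=> /nbhs_ptP[d d0 h]; exists d => // w /h; rewrite distrC.
Qed.

Lemma inversion_cont01 (a : pt) (f : R -> pt) : cont01 f ->
  (forall t : R, 0 <= t <= 1 -> f t <> a) -> cont01 (fun t => inversion a (f t)).
Proof.
move=> fc fa t t01 r r0; have [d d0 hd] := inversion_cont (fa t t01) r0.
have [d' d'0 hd'] := fc t t01 d d0; exists d' => // s s01 sd.
by apply: hd; exact: hd'.
Qed.

(* The inversion centred at the apex sends the edge from [x] to the apex to a path
   from [x] to infinity. *)
Lemma apex_outerplanar (T : finType) (e : rel (option T)) (es : symmetric e)
    (ei : irreflexive e) (e' : rel T) (es' : symmetric e') (ei' : irreflexive e') :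
  (forall x, e None (Some x)) -> (forall x y, e (Some x) (Some y) = e' x y) ->
  planar R (SGraph es ei) -> outerplanar R (SGraph es' ei').
Proof.
move=> eN eS /planarP[/= pos [E [pi arcE symE ver dis]]].
pose a := pos None; pose inv := inversion a.
pose pos' (x : T) := inv (pos (Some x)).
pose E' (x y : T) := inv @` E (Some x) (Some y).
have posa x : pos (Some x) <> a by move/pi.
have Ea x y z : e (Some x) (Some y) -> E (Some x) (Some y) z -> z <> a.
  by move=> exy Ez za; rewrite za in Ez; case: (ver _ _ None exy Ez).
have dr : drawing tarc e' pos' E'.
  split.
  - by move=> x y /(inversion_inj (posa x) (posa y))/pi[].
  - move=> x y; rewrite -eS => exy; have [f [fc fi f0 f1 fE]] := arcE _ _ exy.
    have fa (t : R) : 0 <= t <= 1 -> f t <> a.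
      by move=> t01; apply: (Ea x y) => //; rewrite fE; exact: traceT.
    exists (fun t => inv (f t)); split.
    + exact: inversion_cont01.
    + by move=> s t s01 t01 /(inversion_inj (fa s s01) (fa t t01)); exact: fi.
    + by rewrite f0.
    + by rewrite f1.
    + rewrite /E' fE; apply/seteqP; split=> z; first by case=> w [t t01 ->] <-; exists t.
      by case=> t t01 ->; exists (f t) => //; exact: traceT.
  - by move=> x y; rewrite -eS => exy; rewrite /E' symE.
  - move=> x y v; rewrite -eS => exy [w Ew wv].
    have E1 : E (Some x) (Some y) (pos (Some v)).
      by rewrite -(inversion_inj (Ea _ _ _ exy Ew) (posa v) wv).
    by case: (ver _ _ _ exy E1) => -[->]; [left|right].
  - move=> x y x' y' z; rewrite -!eS => exy exy' [w Ew wz] [w' Ew' wz'].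
    have ww : w = w'.
      by apply: (inversion_inj (Ea _ _ _ exy Ew) (Ea _ _ _ exy' Ew')); exact: (etrans wz (esym wz')).
    rewrite -ww in Ew'; case: (dis _ _ _ _ _ exy exy' Ew Ew') => [/set2_eq[[[->] [->]]|[[->] [->]]]|[[v|] vE]].
    + by left.
    + by left; rewrite finset.setUC.
    + by right; exists v; rewrite -wz vE.
    + by exfalso; apply: (Ea _ _ _ exy Ew).
have [D [Dpos Darc]] := @drawing_planar R (SGraph es' ei') pos' E' dr.
exists D => x; rewrite Dpos.
have exN : e (Some x) None by rewrite es.
have [b [bc bi b0 b1 bE]] := arcE _ _ exN.
have innerb (t : R) v : 0 < t < 1 -> b t <> pos v.
  move=> /andP[t0 t1] bv; have t01 : 0 <= t <= 1 by rewrite !ltW.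
  have : E (Some x) None (pos v) by rewrite bE -bv; exact: traceT.
  case/(ver _ _ _ exN) => vE; move: bv; rewrite vE.
    by rewrite -b0 => /(bi _ _ t01 (in00 R)) t00; rewrite t00 ltxx in t0.
  by rewrite -b1 => /(bi _ _ t01 (in11 R)) t11; rewrite t11 ltxx in t1.
have offD (t : R) : 0 < t < 1 -> ~ drawn_set D (inv (b t)).
  move=> ti; have ba : b t <> a by exact: innerb.
  have t01 : 0 <= t <= 1 by move: ti => /andP[? ?]; rewrite !ltW.
  case=> [[v _]|[c _ [s s01 cs]]].
    by rewrite Dpos => /(inversion_inj (posa v) ba)/esym; exact: innerb.
  have [u [v [_ uv trE]]] := Darc c.
  have [w Ew wb] : E' u v (inv (b t)).
    by rewrite -trE; exists s => //; move: s01; rewrite /= in_itv.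
  rewrite /= -eS in uv.
  have wE := inversion_inj (Ea _ _ _ uv Ew) ba wb; rewrite wE in Ew.
  have Eb : E (Some x) None (b t) by rewrite bE; exact: traceT.
  case: (dis _ _ _ _ _ uv exN Ew Eb) => [/set2_eq[[]|[]]//|[v' ]].
  exact: innerb.
have comp (t t' : R) : 0 < t < 1 -> 0 < t' < 1 ->
    connected_component (~` drawn_set D) (inv (b t)) (inv (b t')).
  move=> ti t'i; pose g u := inv (b (t + u * (t' - t))).
  have gi (u : R) : 0 <= u <= 1 -> 0 < t + u * (t' - t) < 1.
    move: ti t'i => /andP[t0 t1] /andP[t'0 t'1] /andP[u0 u1].
    have v0 : 0 <= 1 - u by lra.
    have [tt|/ltW tt] := leP t t'.
      have p0 : 0 <= t' - t by lra.
      have := mulr_ge0 u0 p0; have := mulr_ge0 v0 p0; rewrite mulrBl mul1r.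
      by move=> ? ?; apply/andP; split; lra.
    have p0 : 0 <= t - t' by lra.
    have := mulr_ge0 u0 p0; have := mulr_ge0 v0 p0; rewrite mulrBl mul1r.
    rewrite -[t - t']opprB mulrN.
    by move=> ? ?; apply/andP; split; lra.
  have tI : 0 <= t <= 1 by move: ti => /andP[? ?]; rewrite !ltW.
  have t'I : 0 <= t' <= 1 by move: t'i => /andP[? ?]; rewrite !ltW.
  have gc : cont01 g.
    apply: (inversion_cont01 (cont01_sub bc tI t'I)) => u /gi; exact: innerb.
  have /within_cont01 gw := gc.
  have gconn : connected (g @` `[0%R, 1%R]).
    by apply: connected_continuous_connected gw; exact: segment_connected.
  apply: (@connected_component_max _ _ (g @` `[0%R, 1%R])) gconn _ _ => //.
  - by exists 0; [rewrite /= in_itv /= lexx ler01|rewrite /g mul0r addr0].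
  - by move=> z [u]; rewrite /= in_itv /= => /gi ui <-; exact: offD.
  - by exists 1; [rewrite /= in_itv /= lexx ler01|rewrite /g mul1r addrC subrK].
(* The image of the open edge lies in one component, which is unbounded because points close to the
   apex are sent arbitrarily far. *)
have outer (t : R) : 0 < t < 1 -> outer_face D (inv (b t)).
  move=> ti; split; first exact: offD.
  move=> /bounded_setE[M hM].
  have M0 : 0 <= `|M| by exact: normr_ge0.
  have q0 : 0 < (2 * (`|M| + 1))^-1 by rewrite invr_gt0; lra.
  have [d d0 hd] := bc 1 (in11 R) _ q0.
  pose s := Num.max (1 / 2) (1 - d / 2).
  have s1 : s < 1 by rewrite gt_max; lra.
  have s2 : 1 / 2 <= s by rewrite le_max lexx.
  have s3 : 1 - d / 2 <= s by rewrite le_max lexx orbT.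
  have si : 0 < s < 1 by lra.
  have := hM _ (comp t s ti si); apply/negP; rewrite -ltNge.
  apply: le_lt_trans (ler_norm M) _; apply: inversion_big => //; first exact: innerb.
  have -> : a = b 1 by rewrite b1.
  by apply: hd; [lra|rewrite ltr_norml; lra].
move=> B /nbhs_ptP[r r0 hB].
have h2 : 0 <= (1 / 2 : R) <= 1 by lra.
(* Near parameter 0 the image runs into the vertex, which puts it in the closure of the outer face.
   Only the first half of the edge is used, since the inversion is not continuous at its other
   end. *)
have gc : cont01 (fun u => inv (b (0 + u * (1 / 2 - 0)))).
  apply: (inversion_cont01 (cont01_sub bc (in00 R) h2)) => u /andP[u0 u1].
  have [->|un0] := eqVneq u 0; first by rewrite mul0r addr0 b0; exact: posa.
  have up : 0 < u by rewrite lt_neqAle eq_sym un0.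
  by apply: innerb; lra.
have [d d0 hd] := gc 0 (in00 R) r r0.
pose u := Num.min (1 / 2) (d / 2).
have u0 : 0 < u by rewrite lt_min; lra.
have u1 : u <= 1 / 2 by rewrite ge_min lexx.
have ud : u <= d / 2 by rewrite ge_min lexx orbT.
exists (inv (b (0 + u * (1 / 2 - 0)))); split; first by apply: outer; lra.
apply: hB; have := hd u ltac:(lra) ltac:(rewrite subr0 gtr0_norm //; lra).
by rewrite [0 * _]mul0r addr0 b0.
Qed.

End Inversion.

(** * Edge bounds *)

Section EdgeBounds.
Variables (R : realType) (k : nat) (G : sgraph).
Local Notation B := (chi_k k (line_graph G) * alpha_reg k (line_graph G))%N.

Lemma planar_edges (H : sgraph) : planar R H -> (2 < #|H|)%N ->
  (#|edge_set H| + 6 <= 3 * #|H|)%N.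
Proof.
move=> /planar_vK[lt [lt_asym vK]] H3.
have := vK_planar_arcs lt_asym (@adj_sym H) (@adj_irr H) vK.
by rewrite arcs_in_setT cardsT => /(_ H3); lia.
Qed.

(** For maximality, remove the apex from a planar supergraph: what remains is outerplanar and
    contains [G], hence has no new edge, and at the apex no edge can be added. *)
Lemma apex_triangulation : maximal_outerplanar R G -> triangulation R (apex G).
Proof.
move=> [oG maxG]; split; first exact: (outerplanar_apex (e := @apex_adj G)).
move=> e es ei sub pl.
have eN x : e None (Some x) by exact: sub.
pose e' : rel G := fun x y => e (Some x) (Some y).
have es' : symmetric e' by move=> x y; exact: es.
have ei' : irreflexive e' by move=> x; exact: ei.
have op := apex_outerplanar es' ei' eN (fun x y => erefl) pl.
have sub' := maxG e' es' ei' (fun x y xy => sub (Some x) (Some y) xy) op.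
by move=> [x|] [y|] //=; [exact: sub'|rewrite ei].
Qed.

Lemma maximal_outerplanar_bound : maximal_outerplanar R G -> has_factor 2 G ->
  (#|edge_set G| <= 14 * B)%N.
Proof.
move=> /apex_triangulation tA fG.
have [/edges_le_mul//|m15] := leqP #|edge_set G| 14.
have n4 : (3 < #|G|)%N.
  rewrite ltnNge; apply/negP => n3; have := leq_mul n3 n3; have := edges_le_square G; lia.
have cA : #|apex G| = #|G|.+1 by rewrite card_option.
(* Both degrees are one larger in the apex graph, so the bound 7 there becomes 5. *)
have lo (x y : G) : adj x y -> (5 <= degree x + degree y)%N.
  move=> xy; have A5 : (4 < #|apex G|)%N by rewrite cA.
  have := @triangulation_degree_sum R (apex G) (Some x) (Some y) tA A5 xy.
  rewrite !apex_degree; lia.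
(* The planar bound for the apex graph is [m + n + 6 <= 3 (n + 1)], that is [m <= 2 n - 3]. *)
have := planar_edges (proj1 tA); rewrite cA apex_edges => /(_ ltac:(lia)).
have := factor_bound k 7 fG lo.
have -> : (\sum_(i < 7) (7 - i) = 28)%N by rewrite !big_ord_recl big_ord0.
by set b := B; lia.
Qed.

(** With [S] the sum over [c], [2 (s + c) n <= 8 m + 2 S B] and [m + 6 <= 3 n] give
    [(s + c - 12) m <= 3 S B]. The condition [12 <= K] ensures five vertices as soon as [m] exceeds
    [K]. *)
Lemma triangulation_bound (s c K : nat) : triangulation R G -> has_factor 2 G ->
  ((4 < #|G|)%N -> forall x y : G, adj x y -> (s <= degree x + degree y)%N) ->
  (12 <= K)%N -> (12 < s + c)%N -> (3 * \sum_(i < c) (c - i) <= (s + c - 12) * K)%N ->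
  (#|edge_set G| <= K * B)%N.
Proof.
move=> tG fG lo K12 sc hK.
have [/edges_le_mul//|mK] := leqP #|edge_set G| K.
have n5 : (4 < #|G|)%N.
  rewrite ltnNge; apply/negP => n4; have := leq_mul n4 n4; have := edges_le_square G; lia.
have pb := planar_edges (proj1 tG) (ltn_trans (isT : 2 < 4)%N n5).
have := factor_bound k c fG (lo n5).
move: (leq_mul hK (leqnn B)) pb; move: sc hK; set S := (\sum_(i < c) _)%N; set b := B.
move: {lo} (s + c)%N #|edge_set G| #|G| => q m n q12 hK hB pb fb.
have qn := leq_mul (leqnn q) pb.
rewrite -(@leq_pmul2l (q - 12)) ?subn_gt0 // mulnA; apply: leq_trans hB.
rewrite mulnBl leq_subLR; lia.
Qed.

End EdgeBounds.

Theorem theorem4p3 (R : realType) (k : nat) (G : sgraph) :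
  let m : rat := #|edge_set G|%:R in
  let alpha : rat := (alpha_reg k (line_graph G))%:R in
  let chi : rat := (chi_k k (line_graph G))%:R in
  [/\ (is_tree G -> has_perfect_matching G -> alpha >= m / (6 * chi)),
      (maximal_outerplanar R G -> has_factor 2 G -> alpha >= m / (14 * chi)),
      (triangulation R G -> has_factor 2 G -> alpha >= m / (33 * chi)),
      (triangulation R G -> has_factor 2 G -> has_min_degree 4 G ->
         alpha >= m / (27 * chi)) &
      (triangulation R G -> has_factor 2 G -> has_min_degree 5 G ->
         alpha >= m / (15 * chi))].
Proof.
move=> m alpha chi; split=> [tG pm|oG fG|tG fG|tG fG [_ dG]|tG fG [_ dG]]; apply: ratio_bound.
- exact: tree_bound.
- exact: (maximal_outerplanar_bound (R := R)).
(* In the three applications the condition on [K] is an equality: [3 * 66 = 6 * 33],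
   [3 * 45 = 5 * 27] and [3 * 15 = 3 * 15]. *)
- apply: (@triangulation_bound R k G 7 11) => //; last by rewrite !big_ord_recl big_ord0.
  by move=> G5 x y; exact: triangulation_degree_sum tG G5.
- apply: (@triangulation_bound R k G 8 9) => //; last by rewrite !big_ord_recl big_ord0.
  by move=> _ x y _; exact: leq_add (dG x) (dG y).
- apply: (@triangulation_bound R k G 10 5) => //; last by rewrite !big_ord_recl big_ord0.
  by move=> _ x y _; exact: leq_add (dG x) (dG y).
Qed.
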